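(* For integers $k,m\ge1$ let $G_{k,m}(t)=\int_{\{\mathrm{Ord}\,x=k,\ \mathrm{Ord}\,y=m\}}t^{\mu(\gamma)}d\gamma$. Then: 1. $G_{k,m}(t)$ is a rational function of the parameter $t$ and the class $\mathbb{L}$ of the affine line. 2. $G_{1,1}(t)=(\mathbb{L}-1)^2\,\mathbb{L}^{-2}$. 3. $G_{k,m}(t)=G_{m,k}(t)$. 4. $G_{k,m}(t)=t^{k(k-1)}\,\mathbb{L}^{-k}\,G_{k,m-k}(t)$ for $m>k$. 5. $G_{k,k}(t)=(\mathbb{L}-1)\sum_{m>k}G_{k,m}(t)$. 6. For $k\ge2$, $\displaystyle G_{k,k}(t)=\frac{(\mathbb{L}-1)\,t^{k(k-1)}\,\mathbb{L}^{-k}}{1-t^{k(k-1)}\,\mathbb{L}^{1-k}}\sum_{1\le m<k}G_{k,m}(t)$.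
   Context: Arcs: $\mathcal{L}$ is the space of arcs at the origin of $\mathbb{C}^2$, i.e. pairs $\gamma=(x(s),y(s))$ of formal power series over $\mathbb{C}$ without constant terms. $\mathcal{L}_n$ is the space of their $n$-jets (truncations modulo $s^{n+1}$, so $\mathcal{L}_n\cong\mathbb{C}^{2n}$) and $\pi_n:\mathcal{L}\to\mathcal{L}_n$ is the truncation map. $\mathrm{Ord}$ denotes the order of a power series in $s$. Grothendieck ring: $K_0(Var_{\mathbb{C}})$ is generated by isomorphism classes $[X]$ of complex quasi-projective varieties modulo $[X]=[Y]+[X\setminus Y]$ for $Y\subset X$ Zariski closed, with product $[X][Y]=[X\times Y]$; $\mathbb{L}$ is the class of the affine line. $\mathcal{M}$ is the completion of $K_0(Var_{\mathbb{C}})[\mathbb{L}^{-1}]$ with respect to the filtration in which $F_k$ is generated by the elements $[X]\mathbb{L}^{-n}$ with $n-\dim X\ge k$. Motivic measure (Kontsevich, Denef–Loeser): a set $A\subset\mathcal{L}$ is cylindric if $A=\pi_n^{-1}(A_n)$ for some $n$ and some constructible $A_n\subset\mathcal{L}_n$, and its measure is $[A_n]\mathbb{L}^{-2n}\in\mathcal{M}$; this extends to an additive $\mathcal{M}$-valued measure $\chi_g$ on a suitable algebra of subsets of $\mathcal{L}$. For a function $f$ with countably many values and measurable level sets, $\int f\,d\gamma=\sum_g g\cdot\chi_g(f^{-1}(g))$ whenever this sum converges. The integrals: $\mu(\gamma)$ is the Milnor number of the germ of plane curve parametrised by $\gamma$, i.e. $\mu=\dim_{\mathbb{C}}\mathbb{C}[[x,y]]/(f_x,f_y)$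 for a reduced equation $f=0$ of the branch when $\gamma$ is a primitive parametrisation; for non-primitive arcs (a set of measure zero) $\mu(\gamma)=\infty$ and $t^{\infty}=0$. Thus $$G_{k,m}(t)=\sum_{n\ge 0}t^n\chi_g\{\gamma:\mathrm{Ord}\,x=k,\ \mathrm{Ord}\,y=m,\ \mu(\gamma)=n\}\in\mathcal{M}[[t]].$$ All identities are in $\mathcal{M}[[t]]$; rational functions in $t$ and $\mathbb{L}$ are identified with their expansions as power series in $t$, and infinite sums converge coefficientwise in $t$ in the topology of $\mathcal{M}$. *)

(* Defs.v *)
From HB Require Import structures.
From mathcomp Require Import all_boot all_order all_algebra generic_quotient.
From mathcomp Require Import ring_quotient.
From mathcomp Require Import boolp classical_sets functions reals.
From mathcomp Require Import complex mpoly.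
From mathcomp Require monalg.

Set Implicit Arguments.
Unset Strict Implicit.
Unset Printing Implicit Defensive.

Import Order.TTheory GRing.Theory Num.Theory.
Local Open Scope classical_set_scope.
Local Open Scope ring_scope.

Record fps (R : Type) := Fps { fcoef :> nat -> R }.

HB.instance Definition _ (R : Type) := gen_eqMixin (fps R).
HB.instance Definition _ (R : Type) := gen_choiceMixin (fps R).

Lemma fpsP (R : Type) (f g : fps R) : f =1 g -> f = g.
Proof. by case: f g => [f] [g] /= /funext ->. Qed.

Lemma conv_assoc (V : nmodType) (T : nat -> nat -> nat -> V) n :
  \sum_(i < n.+1) \sum_(j < i.+1) T j (i - j)%N (n - i)%N =
  \sum_(j < n.+1) \sum_(l < (n - j).+1) T j l (n - j - l)%N.
Proof.
rewrite -(big_mkord xpredT (fun i => \sum_(j < i.+1) T j (i - j)%N (n - i)%N)).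
rewrite (eq_big_nat _ _ (F2 := fun i =>
  \sum_(0 <= j < n.+1 | (j < i.+1)%N) T j (i - j)%N (n - i)%N)); last first.
  move=> i /= ltin; rewrite -(big_mkord xpredT (fun j => T j (i - j)%N (n - i)%N)).
  by rewrite (big_nat_widen _ _ n.+1).
rewrite (exchange_big_dep_nat xpredT) //= big_mkord.
apply: eq_bigr => -[j /= ltjn] _.
rewrite -(big_nat_widenl j 0 n.+1 xpredT) // -{1}[j]add0n big_addn big_mkord subSn //.
by apply: eq_bigr => l _; rewrite addnK addnC subnDA.
Qed.

Section FpsZmod.
Variable V : zmodType.
Implicit Types f g h : fps V.

Definition fzero : fps V := Fps (fun _ => 0).
Definition fopp f : fps V := Fps (fun n => - f n).
Definition fadd f g : fps V := Fps (fun n => f n + g n).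

Fact faddA : associative fadd.
Proof. by move=> f g h; apply: fpsP => n /=; rewrite addrA. Qed.
Fact faddC : commutative fadd.
Proof. by move=> f g; apply: fpsP => n /=; rewrite addrC. Qed.
Fact fadd0 : left_id fzero fadd.
Proof. by move=> f; apply: fpsP => n /=; rewrite add0r. Qed.
Fact faddN : left_inverse fzero fopp fadd.
Proof. by move=> f; apply: fpsP => n /=; rewrite addNr. Qed.

HB.instance Definition _ := GRing.isZmodule.Build (fps V) faddA faddC fadd0 faddN.

Lemma fcoefD f g n : (f + g) n = f n + g n. Proof. by []. Qed.

(* the monomial [c t^n] *)
Definition fmono (c : V) (n : nat) : fps V := Fps (fun i => if i == n then c else 0).
Definition fconst (c : V) : fps V := fmono c 0.

Definition fderiv f : fps V := Fps (fun n => f n.+1 *+ n.+1).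

Definition ford f (k : nat) : Prop := f k != 0 /\ forall i, (i < k)%N -> f i = 0.

End FpsZmod.

Section FpsRing.
Variable R : comPzRingType.
Implicit Types f g h u : fps R.

Definition fmul f g : fps R := Fps (fun n => \sum_(i < n.+1) f i * g (n - i)%N).

Fact fmulC : commutative fmul.
Proof.
move=> f g; apply: fpsP => n /=; rewrite (reindex_inj rev_ord_inj) /=.
by apply: eq_bigr => -[i /= ltin] _; rewrite subSS subKn -1?ltnS // mulrC.
Qed.
Fact fmulA : associative fmul.
Proof.
move=> f g h; apply: fpsP => n /=; symmetry.
under eq_bigr do rewrite big_distrl.
rewrite (conv_assoc (fun i j l => f i * g j * h l)).
apply: eq_bigr => i _; rewrite /= big_distrr /=.
by apply: eq_bigr => j _; rewrite mulrA.
Qed.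
Fact fmul1 : left_id (fconst (1 : R)) fmul.
Proof.
move=> f; apply: fpsP => n /=; rewrite big_ord_recl /= mul1r subn0.
by rewrite big1 ?addr0 // => i _; rewrite /= mul0r.
Qed.
Fact fmulDl : left_distributive fmul (@fadd R).
Proof.
move=> f g h; apply: fpsP => n /=; rewrite -big_split /=.
by apply: eq_bigr => i _; rewrite mulrDl.
Qed.

HB.instance Definition _ :=
  GRing.Zmodule_isComPzRing.Build (fps R) fmulA fmulC fmul1 fmulDl.

(* [f(u)], meant for [u 0 = 0]: then [u ^+ i] does not contribute to the
   coefficient of index [n] for [i > n]. *)
Definition fcomp f u : fps R :=
  Fps (fun n => \sum_(i < n.+1) f i * (u ^+ i) n).

(* the expansion of [1 / (1 - u)], meant for [u 0 = 0] *)
Definition fgeom u : fps R := Fps (fun n => \sum_(i < n.+1) (u ^+ i) n).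

End FpsRing.

Section FpsModule.
Variables (R : comPzRingType) (V : lmodType R).

Definition fscale (a : fps R) (f : fps V) : fps V :=
  Fps (fun n => \sum_(i < n.+1) a i *: f (n - i)%N).

Fact fscaleA a b f : fscale a (fscale b f) = fscale (a * b) f.
Proof.
apply: fpsP => n /=; symmetry.
under eq_bigr do rewrite scaler_suml.
rewrite (conv_assoc (fun i j l => (a i * b j) *: f l)).
apply: eq_bigr => i _; rewrite scaler_sumr.
by apply: eq_bigr => j _; rewrite scalerA.
Qed.
Fact fscale1 : left_id 1 fscale.
Proof.
move=> f; apply: fpsP => n /=; rewrite big_ord_recl /= scale1r subn0.
by rewrite big1 ?addr0 // => i _; rewrite /= scale0r.
Qed.
Fact fscaleDr : right_distributive fscale +%R.
Proof.
move=> a f g; apply: fpsP => n; rewrite fcoefD /= -big_split /=.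
by apply: eq_bigr => i _; rewrite scalerDr.
Qed.
Fact fscaleDl f : {morph fscale^~ f : a b / a + b}.
Proof.
move=> a b; apply: fpsP => n; rewrite fcoefD /= -big_split /=.
by apply: eq_bigr => i _; rewrite scalerDl.
Qed.

HB.instance Definition _ := GRing.Zmodule_isLmodule.Build (fps R) (fps V)
  fscaleA fscale1 fscaleDr fscaleDl.

End FpsModule.

(* polynomials over the integers in infinitely many variables; [monalg] is only
   imported locally because it redefines the notation of [mpoly] *)
Module FreeRing.
Import monalg.
Definition zpoly (T : choiceType) : comNzRingType := {malg int[{cmonom T}]}.
Definition zvar (T : choiceType) (x : T) : zpoly T := mkmalgU (ucm x) 1.
End FreeRing.
Export FreeRing.

Section Varieties.
Variable F : closedFieldType.

(* A locally closed subset of P^(n-1), presented by the homogeneous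
   polynomials [qeqs], all required to vanish, and [qneqs], not all allowed to
   vanish.  Its set of points [qpts] is represented by the corresponding cone
   in F^n, with the origin removed. *)
Record qpvar (n : nat) := QPVar {
  qeqs : seq {mpoly F[n]};
  qneqs : seq {mpoly F[n]};
  qeqs_homog : all (fun p => p \is (@ishomog n F mdeg)) qeqs;
  qneqs_homog : all (fun p => p \is (@ishomog n F mdeg)) qneqs }.

Definition peval n (p : {mpoly F[n]}) (v : 'rV[F]_n) : F := p.@[v ord0].

Definition proj_zeros n (s : seq {mpoly F[n]}) : set 'rV[F]_n :=
  [set v | v != 0 /\ forall p, p \in s -> peval p v = 0].

Definition qpts n (X : qpvar n) : set 'rV[F]_n :=
  proj_zeros (qeqs X) `\` proj_zeros (qneqs X).

(* [v] and [w] represent the same point of projective space *)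
Definition same_pt n (v w : 'rV[F]_n) : Prop := exists2 c : F, c != 0 & v = c *: w.

Definition regular_map n m (X : qpvar n) (Y : qpvar m) (phi : 'rV[F]_n -> 'rV[F]_m) :=
  (forall v, qpts X v -> qpts Y (phi v)) /\
  forall p, qpts X p ->
    exists (q : {mpoly F[n]}) (d : nat) (P : 'I_m -> {mpoly F[n]}),
    [/\ q \is (@ishomog n F mdeg), peval q p != 0,
        forall j, P j \is (@ishomog1 n F d mdeg) &
        forall v, qpts X v -> peval q v != 0 ->
          same_pt (phi v) (\row_j peval (P j) v)].

Definition qiso n m (X : qpvar n) (Y : qpvar m) : Prop :=
  exists phi psi, [/\ regular_map X Y phi, regular_map Y X psi,
    forall v, qpts X v -> same_pt (psi (phi v)) v &
    forall w, qpts Y w -> same_pt (phi (psi w)) w].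

(* [Y] is Zariski closed in [X] *)
Definition rel_closed n (X Y : set 'rV[F]_n) : Prop :=
  exists2 s : seq {mpoly F[n]},
    all (fun p => p \is (@ishomog n F mdeg)) s & Y = X `&` proj_zeros s.

(* [Z] is the image of [X * Y] under the Segre embedding *)
Definition segre n m (X : qpvar n) (Y : qpvar m) (Z : qpvar (n * m)) : Prop :=
  qpts Z = [set u | exists v w, [/\ qpts X v, qpts Y w & u = mxvec (v^T *m w)]].

Definition irr_closed n (X Z : set 'rV[F]_n) : Prop :=
  [/\ rel_closed X Z, Z !=set0 &
      forall Z1 Z2, rel_closed X Z1 -> rel_closed X Z2 ->
        Z = Z1 `|` Z2 -> Z = Z1 \/ Z = Z2].

(* [dim X <= e] for the Krull dimension (with [dim set0 = -oo]): every chain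
   [Z 0 < ... < Z d] of irreducible closed subsets has [d <= e]. *)
Definition dim_le n (X : qpvar n) (e : int) : Prop :=
  forall (d : nat) (Z : nat -> set 'rV[F]_n),
    (forall i, (i <= d)%N -> irr_closed (qpts X) (Z i)) ->
    (forall i, (i < d)%N -> Z i `<` Z i.+1) ->
    d%:Z <= e.

Fact homog_nil n : all (fun p => p \is (@ishomog n F mdeg)) [::].
Proof. by []. Qed.
Fact homog_one n : all (fun p => p \is (@ishomog n F mdeg)) [:: 1].
Proof. by rewrite /= andbT; apply/homogP; exists 0%N; apply: dhomog1. Qed.
Fact homog_X0 : all (fun p => p \is (@ishomog 2 F mdeg)) [:: 'X_ord0].
Proof. by rewrite /= andbT; apply/homogP; exists 1%N; rewrite dhomogX; apply/eqP/mdeg1. Qed.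

(* the point P^0, and the affine line as the chart [X_0 != 0] of P^1 *)
Definition point_var : qpvar 1 := QPVar (homog_nil 1) (homog_one 1).
Definition affine_line : qpvar 2 := QPVar (homog_nil 2) homog_X0.

End Varieties.

Section Grothendieck.
Variable F : closedFieldType.

(* The generators of K_0(Var)[L^-1]: [Some X] stands for the class of [X], [None] for [L^-1] *)
Definition kgen : Type := option {n : nat & qpvar F n}.
HB.instance Definition _ := gen_eqMixin kgen.
HB.instance Definition _ := gen_choiceMixin kgen.

Definition kfree : comNzRingType := zpoly kgen.

Definition kvar (g : kgen) : kfree := zvar g.
Definition kfcls n (X : qpvar F n) : kfree := kvar (Some (Tagged (@qpvar F) X)).

Inductive krel : kfree -> Prop :=
| krel_iso n m (X : qpvar F n) (Y : qpvar F m) :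
    qiso X Y -> krel (kfcls X - kfcls Y)
| krel_scissor n (X Y U : qpvar F n) :
    rel_closed (qpts X) (qpts Y) -> qpts U = qpts X `\` qpts Y ->
    krel (kfcls X - (kfcls Y + kfcls U))
| krel_prod n m (X : qpvar F n) (Y : qpvar F m) (Z : qpvar F (n * m)) :
    segre X Y Z -> krel (kfcls X * kfcls Y - kfcls Z)
| krel_point : krel (kfcls (point_var F) - 1)
| krel_inv : krel (kfcls (affine_line F) * kvar None - 1)
| krel0 : krel 0
| krelB a b : krel a -> krel b -> krel (a - b)
| krelM a b : krel b -> krel (a * b).

Definition krel_pred : {pred kfree} := fun a => `[< krel a >].

Fact krel_zmod_closed : zmod_closed krel_pred.
Proof.
split; first exact/asboolP/krel0.
by move=> a b /asboolP ha /asboolP hb; apply/asboolP/krelB.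
Qed.
HB.instance Definition _ := GRing.isZmodClosed.Build kfree krel_pred krel_zmod_closed.

Definition KL : Type := {ideal_quot krel_pred}.
HB.instance Definition _ := GRing.Zmodule.on KL.

Local Open Scope quotient_scope.

Definition kpi (a : kfree) : KL := \pi_({ideal_quot krel_pred}) a.
Definition krepr (x : KL) : kfree := repr (x : {ideal_quot krel_pred}).

Lemma kreprK x : kpi (krepr x) = x. Proof. exact: reprK. Qed.
Lemma kpiP a b : kpi a = kpi b <-> krel (a - b).
Proof.
split=> [/eqP|h]; last apply/eqP; rewrite -Quotient.idealrBE; first by move/asboolP.
exact/asboolP.
Qed.
Lemma kpiD a b : kpi (a + b) = kpi a + kpi b.
Proof. exact: Quotient.pi_add. Qed.

(* [ring_quotient] only provides products for proper ideals.  The constants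
   below are locked to keep unification from unfolding the quotient. *)
Fact kone_key : unit. Proof. exact: tt. Qed.
Definition kone : KL := locked_with kone_key (kpi 1).
Definition kmul (x y : KL) : KL := kpi (krepr x * krepr y).
Lemma koneE : kone = kpi 1. Proof. exact: unlock. Qed.

Lemma kpiM a b : kpi (a * b) = kmul (kpi a) (kpi b).
Proof.
have [ha hb] : krel (a - krepr (kpi a)) /\ krel (b - krepr (kpi b)).
  by split; apply/kpiP; rewrite kreprK.
apply/kpiP; set a' := krepr _ in ha *; set b' := krepr _ in hb *.
have -> : a * b - a' * b' = b * (a - a') - (- a') * (b - b').
  by rewrite mulNr opprK !mulrBr [b * a]mulrC [b * a']mulrC addrA subrK.
by apply: krelB; apply: krelM.
Qed.

Fact kmulA : associative kmul.
Proof.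
by move=> x y z; rewrite -[x]kreprK -[y]kreprK -[z]kreprK -!kpiM mulrA.
Qed.
Fact kmulC : commutative kmul.
Proof. by move=> x y; rewrite /kmul mulrC. Qed.
Fact kmul1 : left_id kone kmul.
Proof. by move=> x; rewrite -[x]kreprK koneE -kpiM mul1r. Qed.
Fact kmulDl : left_distributive kmul +%R.
Proof.
move=> x y z; rewrite -[x]kreprK -[y]kreprK -[z]kreprK.
by rewrite -kpiD -!kpiM -kpiD mulrDl.
Qed.

HB.instance Definition _ :=
  GRing.Zmodule_isComPzRing.Build KL kmulA kmulC kmul1 kmulDl.

Fact cls_key : unit. Proof. exact: tt. Qed.
Definition cls n (X : qpvar F n) : KL := locked_with cls_key (kpi (kfcls X)).
Lemma clsE n (X : qpvar F n) : cls X = kpi (kfcls X). Proof. exact: unlock. Qed.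
Fact Linv_key : unit. Proof. exact: tt. Qed.
Definition Linv : KL := locked_with Linv_key (kpi (kvar None)).
Lemma LinvE : Linv = kpi (kvar None). Proof. exact: unlock. Qed.
(* [L ^ i] *)
Definition Lz (i : int) : KL :=
  match i with
  | Posz n => cls (affine_line F) ^+ n
  | Negz n => Linv ^+ n.+1
  end.

Lemma LLinv : cls (affine_line F) * Linv = 1.
Proof.
rewrite clsE LinvE -[LHS]kpiM -[RHS]/kone koneE; exact/kpiP/krel_inv.
Qed.

Lemma LzS i : cls (affine_line F) * Lz i = Lz (i + 1).
Proof.
case: i => [n|[|n]].
- by rewrite -PoszD addn1 /Lz exprS.
- have -> : Negz 0 + 1 = Posz 0 by rewrite NegzE addNr.
  by rewrite /Lz expr1 LLinv expr0.
have -> : Negz n.+1 + 1 = Negz n by rewrite !NegzE -addn1 PoszD opprD addrNK.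
by rewrite /Lz [in LHS]exprS mulrA LLinv mul1r.
Qed.

Lemma LzP i : Linv * Lz i = Lz (i - 1).
Proof.
have {1}-> : i = i - 1 + 1 by rewrite subrK.
by rewrite -LzS mulrA [Linv * _]mulrC LLinv mul1r.
Qed.

(* the subgroup F_k generated by the [X] L^-n with n - dim X >= k *)
Inductive filt (k : int) : KL -> Prop :=
| filt_gen n (X : qpvar F n) (i : int) :
    dim_le X (i - k) -> filt k (cls X * Lz (- i))
| filt0 : filt k 0
| filtB a b : filt k a -> filt k b -> filt k (a - b).

Lemma filtD k a b : filt k a -> filt k b -> filt k (a + b).
Proof.
move=> ha hb; rewrite -[b]opprK -[- b]sub0r; exact: filtB ha (filtB (filt0 k) hb).
Qed.

Lemma filtW k j a : j <= k -> filt k a -> filt j a.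
Proof.
move=> lejk; elim=> [n X i hX||b c _ hb _ hc]; last exact: filtB hb hc; last exact: filt0.
apply: filt_gen => d Z h1 h2; apply: le_trans (hX d Z h1 h2) _.
by rewrite lerD2l lerN2.
Qed.

Inductive laurent : KL -> Prop :=
| laurentL : laurent (cls (affine_line F))
| laurentV : laurent Linv
| laurent1 : laurent 1
| laurentB a b : laurent a -> laurent b -> laurent (a - b)
| laurentM a b : laurent a -> laurent b -> laurent (a * b).

Definition laurent_pred : {pred KL} := fun a => `[< laurent a >].
Fact laurent_closed : subring_closed laurent_pred.
Proof.
split; first exact/asboolP/laurent1.
- by move=> a b /asboolP ha /asboolP hb; apply/asboolP/laurentB.
- by move=> a b /asboolP ha /asboolP hb; apply/asboolP/laurentM.
Qed.
HB.instance Definition _ := GRing.isSubringClosed.Build KL laurent_pred laurent_closed.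

(* the ring Z[L, L^-1] *)
Record ZL := MkZL { ZLval : KL; ZLP : ZLval \in laurent_pred }.
HB.instance Definition _ := [isSub for ZLval].
HB.instance Definition _ := gen_eqMixin ZL.
HB.instance Definition _ := gen_choiceMixin ZL.
HB.instance Definition _ :=
  GRing.SubChoice_isSubComPzRing.Build KL laurent_pred ZL laurent_closed.

Lemma laurent_Lz i : Lz i \in laurent_pred.
Proof. by case: i => n; apply/rpredX/asboolP; [exact: laurentL | exact: laurentV]. Qed.

Definition Lpow (i : int) : ZL := MkZL (laurent_Lz i).

(* multiplication by Z[L, L^-1] is continuous *)
Lemma laurent_filt a : laurent a ->
  exists c : int, forall k x, filt (k + c) x -> filt k (a * x).
Proof.
have gen (b : KL) (c : int) : (forall i, b * Lz i = Lz (i + c)) ->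
    forall k x, filt (k + c) x -> filt k (b * x).
  move=> hb k x; elim=> [n X i hX||y z _ hy _ hz].
  - rewrite mulrCA hb -[- i + c]opprK opprD opprK; apply: filt_gen.
    by rewrite addrAC -addrA -opprD.
  - by rewrite mulr0; apply: filt0.
  - rewrite mulrBr; exact: filtB hy hz.
elim=> [|||b d _ [c hc] _ [e he]|b d _ [c hc] _ [e he]].
- by exists 1; apply: gen => i; rewrite LzS.
- by exists (- 1); apply: gen => i; rewrite LzP.
- by exists 0 => k x; rewrite addr0 mul1r.
- exists (Num.max c e) => k x hx; rewrite mulrBl.
  have h1 : filt (k + c) x by apply: filtW hx; rewrite lerD2l le_max lexx.
  have h2 : filt (k + e) x by apply: filtW hx; rewrite lerD2l le_max lexx orbT.
  exact: filtB (hc _ _ h1) (he _ _ h2).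
- by exists (c + e) => k x hx; rewrite -mulrA; apply/hc/he; rewrite -addrA.
Qed.

Definition cauchy (a : nat -> KL) : Prop :=
  forall k : int, exists N, forall i j, (N <= i)%N -> (N <= j)%N -> filt k (a i - a j).
Definition cauchy_pred : {pred nat -> KL} := fun a => `[< cauchy a >].

Fact cauchy_closed : zmod_closed cauchy_pred.
Proof.
split; first by apply/asboolP => k; exists 0%N => i j _ _; rewrite subrr; exact: filt0.
move=> a b /asboolP ha /asboolP hb; apply/asboolP => k.
have [[N hN] [M hM]] := (ha k, hb k); exists (maxn N M) => i j.
rewrite !geq_max => /andP[Ni Mi] /andP[Nj Mj].
have -> : (a - b) i - (a - b) j = (a i - a j) - (b i - b j).
  rewrite -[(a - b) i]/(a i - b i) -[(a - b) j]/(a j - b j).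
  by rewrite [- (a j - b j)]opprD addrACA -opprD.
exact: filtB (hN _ _ Ni Nj) (hM _ _ Mi Mj).
Qed.
HB.instance Definition _ := GRing.isZmodClosed.Build (nat -> KL) cauchy_pred cauchy_closed.

Record cseq := MkCseq { cval : nat -> KL; cvalP : cval \in cauchy_pred }.
HB.instance Definition _ := [isSub for cval].
HB.instance Definition _ := gen_eqMixin cseq.
HB.instance Definition _ := gen_choiceMixin cseq.
HB.instance Definition _ := [SubChoice_isSubZmodule of cseq by <:].

Definition eventually_filt (k : int) (a : cseq) : Prop :=
  exists N, forall i, (N <= i)%N -> filt k (cval a i).
Definition null_pred : {pred cseq} := fun a => `[< forall k, eventually_filt k a >].

Fact null_closed : zmod_closed null_pred.
Proof.
split; first by apply/asboolP => k; exists 0%N => i _; exact: filt0.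
move=> a b /asboolP ha /asboolP hb; apply/asboolP => k.
have [[N hN] [M hM]] := (ha k, hb k); exists (maxn N M) => i.
rewrite geq_max => /andP[Ni Mi].
exact: filtB (hN _ Ni) (hM _ Mi).
Qed.
HB.instance Definition _ := GRing.isZmodClosed.Build cseq null_pred null_closed.

(* The completion: Cauchy sequences modulo null sequences.  Of its ring
   structure we only build the action of Z[L, L^-1]: extending the product to
   all of it needs dim (X * Y) <= dim X + dim Y. *)
Definition Mhat : Type := {ideal_quot null_pred}.
HB.instance Definition _ := GRing.Zmodule.on Mhat.

Definition mpi (a : cseq) : Mhat := \pi_({ideal_quot null_pred}) a.
Definition mrepr (x : Mhat) : cseq := repr (x : {ideal_quot null_pred}).

Lemma mreprK x : mpi (mrepr x) = x. Proof. exact: reprK. Qed.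
Lemma mpiP a b : mpi a = mpi b <-> a - b \in null_pred.
Proof. by split=> [/eqP|h]; last apply/eqP; rewrite -Quotient.idealrBE. Qed.
Lemma mpiD a b : mpi (a + b) = mpi a + mpi b.
Proof. exact: Quotient.pi_add. Qed.

Fact cscale_subproof (r : ZL) (a : cseq) :
  (fun n => ZLval r * cval a n) \in cauchy_pred.
Proof.
apply/asboolP => k; have [c hc] := laurent_filt (asboolW (ZLP r)).
have [N hN] := asboolW (cvalP a) (k + c).
by exists N => i j Ni Nj; rewrite -mulrBr; apply/hc/hN.
Qed.
Definition cscale r a : cseq := MkCseq (cscale_subproof r a).
Definition mscale (r : ZL) (x : Mhat) : Mhat := mpi (cscale r (mrepr x)).

Lemma mpiZ r a : mpi (cscale r a) = mscale r (mpi a).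
Proof.
apply/mpiP/asboolP => k; have [c hc] := laurent_filt (asboolW (ZLP r)).
have /mpiP/asboolP/(_ (k + c))[N hN] : mpi a = mpi (mrepr (mpi a)) by rewrite mreprK.
by exists N => i Ni; rewrite /= -[_ - _]mulrBr; apply/hc/hN.
Qed.

Lemma cseqP (a b : cseq) : cval a =1 cval b -> a = b.
Proof. by move=> /funext h; apply: val_inj. Qed.

Fact mscaleA r s x : mscale r (mscale s x) = mscale (r * s) x.
Proof.
rewrite -[x]mreprK -!mpiZ; congr mpi; apply: cseqP => n /=.
by rewrite mulrA.
Qed.
Fact mscale1 : left_id 1 mscale.
Proof.
move=> x; rewrite -[x]mreprK -!mpiZ; congr mpi; apply: cseqP => n /=.
by rewrite mul1r.
Qed.
Fact mscaleDr : right_distributive mscale +%R.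
Proof.
move=> r x y; rewrite -[x]mreprK -[y]mreprK -mpiD -!mpiZ -mpiD.
by congr mpi; apply: cseqP => n /=; rewrite -mulrDr.
Qed.
Fact mscaleDl x : {morph mscale^~ x : r s / r + s}.
Proof.
move=> r s /=; rewrite -[x]mreprK -!mpiZ -mpiD.
by congr mpi; apply: cseqP => n /=; rewrite -mulrDl.
Qed.
HB.instance Definition _ :=
  GRing.Zmodule_isLmodule.Build ZL Mhat mscaleA mscale1 mscaleDr mscaleDl.

Fact cconst_subproof (a : KL) : (fun _ => a) \in cauchy_pred.
Proof. by apply/asboolP => k; exists 0%N => i j _ _; rewrite subrr; exact: filt0. Qed.

(* the canonical map K_0(Var)[L^-1] -> Mhat *)
Definition Mcls (a : KL) : Mhat := mpi (MkCseq (cconst_subproof a)).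

(* the closure of F_k in the completion: a basis of neighbourhoods of 0 *)
Definition Mfilt (k : int) : set Mhat := [set x | eventually_filt k (mrepr x)].

Definition Msum_to (u : nat -> Mhat) (x : Mhat) : Prop :=
  forall k : int, exists N, forall n, (N <= n)%N -> Mfilt k (x - \sum_(i < n) u i).

(* coefficientwise convergence of a series of power series *)
Definition fps_sum_to (u : nat -> fps Mhat) (f : fps Mhat) : Prop :=
  forall n, Msum_to (fun i => u i n) (f n).

(* [p(L, t)] for [p] in Z[L][t] *)
Definition fpsL (p : {poly {poly int}}) : fps ZL :=
  Fps (fun n => \sum_(i < size p`_n) Lpow i *~ (p`_n)`_i).

(* [f] is the expansion of P / Q with P, Q in Z[L][t] and Q(0) invertible in
   the completion *)
Definition rational_in_L_t (f : fps Mhat) : Prop :=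
  exists P Q : {poly {poly int}},
    bijective (fun x : Mhat => fpsL Q 0%N *: x) /\
    fpsL Q *: f = fpsL P *: fconst (Mcls 1).

Record plane_arc := PlaneArc {
  arcx : fps F;
  arcy : fps F;
  arcx0 : arcx 0%N = 0;
  arcy0 : arcy 0%N = 0 }.

(* the [n]-jet, as a point of F^(2n) *)
Definition jet (n : nat) (g : plane_arc) : 'rV[F]_(n + n) :=
  row_mx (\row_i arcx g i.+1) (\row_i arcy g i.+1).

(* [B] is the disjoint union of the locally closed sets [X i]; affine space is
   identified with the chart [X_0 != 0] of projective space *)
Definition stratification N (B : set 'rV[F]_N) r (X : 'I_r -> qpvar F (1 + N)) : Prop :=
  [/\ forall i v, qpts (X i) v -> v ord0 (lshift N ord0) != 0,
      forall i j, i != j -> qpts (X i) `&` qpts (X j) = set0 &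
      forall v, B v <-> exists i, qpts (X i) (row_mx 1 v)].

Definition constructible N (B : set 'rV[F]_N) : Prop :=
  exists r (X : 'I_r -> qpvar F (1 + N)), stratification B X.

Definition constr_class N (B : set 'rV[F]_N) : KL :=
  xget 0 [set a | exists r (X : 'I_r -> qpvar F (1 + N)),
    stratification B X /\ a = \sum_i cls (X i)].

Definition cylinder n (B : set 'rV[F]_(n + n)) : set plane_arc := [set g | B (jet n g)].

Definition cylindric (A : set plane_arc) : Prop :=
  exists n (B : set 'rV[F]_(n + n)), constructible B /\ A = cylinder B.

Definition chi (A : set plane_arc) : Mhat :=
  xget 0 [set m | exists n (B : set 'rV[F]_(n + n)),
    [/\ constructible B, A = cylinder B &
        m = Mcls (constr_class B * Lz (- (2 * n)%:Z))]].

(* [F[[x, y]]]; the coefficient of x^i y^j in [f] is [f j i] *)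
Definition fps2 : comPzRingType := fps (fps F).

Definition deriv_y (f : fps2) : fps2 := fderiv f.
Definition deriv_x (f : fps2) : fps2 := Fps (fun j => fderiv (f j)).

(* [f(x(s), y(s))] *)
Definition fsubst (f : fps2) (g : plane_arc) : fps F :=
  Fps (fun n => \sum_(i < n.+1) \sum_(j < n.+1)
                  f j i * (arcx g ^+ i * arcy g ^+ j) n).

Definition primitive (g : plane_arc) : Prop :=
  ~ exists (h : plane_arc) (u : fps F), [/\ u 0%N = 0, u 1%N = 0,
      arcx g = fcomp (arcx h) u & arcy g = fcomp (arcy h) u].

(* [f] generates the ideal of the branch parametrised by [g] *)
Definition reduced_equation (g : plane_arc) (f : fps2) : Prop :=
  forall h : fps2, fsubst h g = 0 <-> exists q : fps2, h = q * f.

Definition jacobian_ideal (f : fps2) : set fps2 :=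
  [set h | exists a b : fps2, h = a * deriv_x f + b * deriv_y f].

(* the quotient of [F[[x, y]]] by the ideal [I] has dimension [n] *)
Definition has_codim (I : set fps2) (n : nat) : Prop :=
  exists e : 'I_n -> fps2,
    (forall h : fps2, exists c : 'I_n -> F,
        I (h - \sum_i fconst (fconst (c i)) * e i)) /\
    (forall c : 'I_n -> F,
        I (\sum_i fconst (fconst (c i)) * e i) -> forall i, c i = 0).

(* The Milnor number of [g] is [n]; it is infinite if there is no such [n]. *)
Definition milnor (g : plane_arc) (n : nat) : Prop :=
  primitive g /\ exists2 f : fps2, reduced_equation g f & has_codim (jacobian_ideal f) n.

Definition mu_level (k m n : nat) : set plane_arc :=
  [set g | [/\ ford (arcx g) k, ford (arcy g) m & milnor g n]].

(* the integral of t^mu over the arcs with Ord x = k and Ord y = m *)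
Definition G_mu (k m : nat) : fps Mhat := Fps (fun n => chi (mu_level k m n)).

End Grothendieck.

Arguments Lpow {F} i.
Arguments mu_level F k m n : clear implicits.

(* Main.v *)
(* Write a branch as [(s^k, y(s))] and let [z] be a primitive [k]-th root of unity.
   Its equation [f] satisfies [f(s^k, Y) = U(s, Y) * prod_(i < k) (Y - y(z^i s))] with
   [U] a unit.  The codimension of an ideal [(G, H)] of [F[[x, y]]] is the sum of the
   orders of [H] along the Puiseux roots of [G]; for [G = f_y], where
   [d/dt f(x, eta) = f_x dx/dt] along a root [eta], this gives
     mu + k - 1 = sum_(1 <= i < k) ord (y(s) - y(z^i s)),
   the sum being infinite exactly for the non-primitive arcs.
   Hence [mu] is invariant under [y |-> y + c x], vanishes for [k = 1], and grows by
   [k (k - 1)] under the blow-up map [(x, y) |-> (x, x y)].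
   Now let [T] be the set of arcs with [ord x = k < ord y].  The blow-up map divides
   measures by [L^k] and maps the arcs of orders [(k, m - k)] onto those of orders
   [(k, m)], and the arcs with [ord x = k] onto [T], while [(k, k)] is the image of
   [T] under the shears with [c <> 0], which multiply the measure by [L - 1].
   Writing [S] for the integral over [T], this yields [G_(k, k) = (L - 1) S] and
     S = t^(k (k - 1)) L^(-k) (sum_(m < k) G_(k, m) + G_(k, k) + S),
   which determines [S]; rationality follows by induction on [k + m].
   The class of a constructible set does not depend on the stratification, and it is
   invariant under bijections that are rational in both directions with nowhere
   vanishing denominators, because two stratifications have a common refinement. *)

Require Import Defs.
From HB Require Import structures.
From mathcomp Require Import all_boot all_order all_algebra.
From mathcomp Require Import boolp classical_sets functions reals.
From mathcomp Require Import complex mpoly.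
From mathcomp Require Import cyclic.
From mathcomp Require separable cyclotomic.
From mathcomp Require Import ring zify.

Set Implicit Arguments.
Unset Strict Implicit.
Unset Printing Implicit Defensive.

Import Order.TTheory GRing.Theory Num.Theory.
Local Open Scope ring_scope.

(** * Formal power series *)

(** The Milnor number refers to an unspecified generator f of the kernel of substitution. When the
    conjugates y_i = y(z^i s) are distinct, prod (Y - y_i) descends to F[[x, Y]] and generates this
    kernel, so f differs from it by a unit. Passing from the Puiseux roots eta_j of f_y to the y_i
    is a double count: f_y(y_i) and f(eta_j) are, up to units, products of the same differences y_i
    - eta_j. The roots exist only after x = t^N, which multiplies codimensions by N. The measure is
    a chosen value with default 0, so cylindricity has to be known before anything is computed. For
    k >= 2 a blow-up raises mu by k (k - 1) > 0, so ord y is bounded on each level of mu; in each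
    degree T is a finite union of levels, and cylindricity follows by induction on mu. For k = 1 mu
    is constant and the remainders are only geometrically small: the one case where the sum over m
    is not finite in each degree. The completion is a module over Z[L, L^-1], so identities are
    stated as actions of this ring and rationality is proved by cross-multiplication. *)

Section StrongChoice.
Variable T : Type.
Variable x0 : T.
Variable Rl : nat -> (nat -> T) -> T -> Prop.
Hypothesis Rl_ext : forall n f g t, (forall i, (i < n)%N -> f i = g i) -> Rl n f t -> Rl n g t.
Hypothesis Rl_ex : forall n f, (forall i, (i < n)%N -> Rl i f (f i)) -> exists t, Rl n f t.

(** Course-of-values recursion along a relation: a next value is known to exist only when all
    earlier ones were admissible. The construction is made total with the default [x0], and
    admissibility follows by strong induction. *)
Lemma strong_choice : exists f : nat -> T, forall n, Rl n f (f n).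
Proof.
pose nxt n f := match pselect (exists t, Rl n f t) with
  | left e => projT1 (cid e) | right _ => x0 end.
pose fix st n : nat -> T := match n with
  | 0 => fun _ => x0
  | m.+1 => let f := st m in fun i => if i == m then nxt m f else f i end.
have stb m n i : (i < m)%N -> (m <= n)%N -> st n i = st m i.
  move=> im; elim: n => [|n IH] mn; first by have := leq_trans im mn.
  move: mn; rewrite leq_eqVlt => /orP[/eqP<-//|]; rewrite ltnS => mn.
  by rewrite /= ifN ?IH //; rewrite neq_ltn (leq_trans im mn).
pose f i := st i.+1 i.
have fE n i : (i < n)%N -> f i = st n i by move=> h; rewrite /f (stb i.+1 n).
exists f => n; elim/ltn_ind: n => n IH.
have [t ht] := Rl_ex IH.
have ex : exists t, Rl n (st n) t by exists t; apply: Rl_ext ht => i /fE.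
rewrite {2}/f /= eqxx /nxt; case: pselect => // e; case: cid => u /= hu.
by apply: Rl_ext hu => i /fE.
Qed.
End StrongChoice.

HB.instance Definition _ (R : comNzRingType) :=
  GRing.PzSemiRing_isNonZero.Build (fps R)
    (introN eqP (fun h : (1 : fps R) = 0 =>
       elimN eqP (oner_neq0 R) (congr1 (fun f : fps R => f 0%N) h))).

Lemma fcoef_sum (V : zmodType) I r (P : pred I) (F : I -> fps V) n :
  (\sum_(i <- r | P i) F i) n = \sum_(i <- r | P i) F i n.
Proof. by elim/big_rec2: _ => // i x y _ <-. Qed.

Section FpsBasics.
Variable R : comPzRingType.
Implicit Types f g u : fps R.

Lemma fcoef0 n : (0 : fps R) n = 0. Proof. by []. Qed.
Lemma fcoef1 n : (1 : fps R) n = (n == 0%N)%:R.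
Proof. by rewrite /= ; case: eqP. Qed.
Lemma fcoefN f n : (- f) n = - f n. Proof. by []. Qed.
Lemma fcoefB f g n : (f - g) n = f n - g n. Proof. by []. Qed.
Lemma fcoefM f g n : (f * g) n = \sum_(i < n.+1) f i * g (n - i)%N. Proof. by []. Qed.
Lemma fcoefM0 f g : (f * g) 0%N = f 0%N * g 0%N.
Proof. by rewrite fcoefM big_ord_recl big_ord0 addr0. Qed.
Lemma fcoefX0 f n : (f ^+ n) 0%N = f 0%N ^+ n.
Proof. by elim: n => [|n IH]; rewrite ?expr0 ?exprS ?fcoefM0 ?IH. Qed.
Lemma fcoef_natr m n : (m%:R : fps R) n = if n == 0%N then m%:R else 0.
Proof.
elim: m => [|m IH]; first by case: ifP.
by rewrite -addn1 !natrD fcoefD IH fcoef1; case: eqP => _ //; rewrite addr0.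
Qed.

Lemma fmonoE (c : R) k n : fmono c k n = if n == k then c else 0. Proof. by []. Qed.

Lemma fcoef_monoM c k f n : (fmono c k * f) n = if (k <= n)%N then c * f (n - k)%N else 0.
Proof.
rewrite fcoefM; case: leqP => kn.
  rewrite (bigD1 (Ordinal (kn : k < n.+1)%N)) //= eqxx big1 ?addr0 // => i ik.
  by rewrite /= ifN ?mul0r.
by rewrite big1 // => i _; rewrite /= ifN ?mul0r // neq_ltn (leq_trans (ltn_ord i)).
Qed.

Lemma fcoef_constM c f n : (fconst c * f) n = c * f n.
Proof. by rewrite fcoef_monoM leq0n subn0. Qed.

Lemma fconstD (a b : R) : fconst (a + b) = fconst a + fconst b.
Proof. by apply: fpsP => n; rewrite fcoefD !fmonoE; case: eqP => // _; rewrite addr0. Qed.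
Lemma fconstN (a : R) : fconst (- a) = - fconst a.
Proof. by apply: fpsP => n; rewrite fcoefN !fmonoE; case: eqP => // _; rewrite oppr0. Qed.
Lemma fconst0 : fconst (0 : R) = 0.
Proof. by apply: fpsP => n; rewrite fmonoE; case: eqP. Qed.

Lemma fmonoM (a b : R) i j : fmono a i * fmono b j = fmono (a * b) (i + j).
Proof.
apply: fpsP => n; rewrite fcoef_monoM !fmonoE.
case: leqP => h; last by rewrite ifN // neq_ltn ltn_addr.
by rewrite -(eqn_add2l i) subnKC // ; case: eqP => //; rewrite mulr0.
Qed.
Lemma fconstM (a b : R) : fconst (a * b) = fconst a * fconst b.
Proof. by rewrite fmonoM. Qed.
Lemma fmonoX (a : R) i j : fmono a i ^+ j = fmono (a ^+ j) (i * j).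
Proof.
elim: j => [|j IH]; first by rewrite !expr0 muln0.
by rewrite !exprS IH fmonoM mulnS.
Qed.
Lemma fconstX (a : R) j : fconst (a ^+ j) = fconst a ^+ j.
Proof. by rewrite fmonoX. Qed.

Lemma fcoef_lt_expr u i n : u 0%N = 0 -> (n < i)%N -> (u ^+ i) n = 0.
Proof.
move=> u0; elim: i n => // i IH n; rewrite ltnS => ni; rewrite exprS fcoefM.
rewrite big_ord_recl u0 mul0r add0r big1 // => j _.
by rewrite IH ?mulr0 // lift0; have := ltn_ord j; lia.
Qed.

(** Up to degree [n] the series agrees with a finite geometric sum, since [u ^+ i] starts in degree
    [i] at the earliest; after telescoping, the remainder [u ^+ n.+1] is invisible in degree [n]. *)
Lemma fgeomE u : u 0%N = 0 -> fgeom u * (1 - u) = 1.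
Proof.
move=> u0; apply: fpsP => n.
have tr m : (m <= n)%N -> fgeom u m = (\sum_(i < n.+1) u ^+ i) m.
  move=> mn; rewrite fcoef_sum /= (big_ord_widen n.+1 (fun i => (u ^+ i) m)) ?ltnS //.
  rewrite [RHS](bigID (fun i : 'I_ _ => (i < m.+1)%N)) /= [X in _ + X]big1 ?addr0 //.
  by move=> i; rewrite -leqNgt => im; apply: fcoef_lt_expr.
rewrite fcoefM (eq_bigr (fun i : 'I_n.+1 => (\sum_(i < n.+1) u ^+ i) i * (1 - u) (n - i)%N)).
  rewrite -fcoefM mulrC -opprB mulNr -subrX1 opprB fcoefB (fcoef_lt_expr u0) ?subr0 //.
by move=> i _; rewrite tr // -ltnS.
Qed.
End FpsBasics.

Section FpsUnit.
Variable R : comUnitRingType.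
Implicit Types f g u : fps R.

Definition fps_unit : pred (fps R) := fun f => f 0%N \is a GRing.unit.
(** Dividing by the constant term reduces to 1 / (1 - u) with u(0) = 0. Non-units are fixed, as the
    unit ring interface demands. *)
Definition fps_inv f :=
  if fps_unit f then fconst (f 0%N)^-1 * fgeom (1 - fconst (f 0%N)^-1 * f) else f.

Fact fps_mulVf : {in fps_unit, left_inverse 1 fps_inv *%R}.
Proof.
move=> f fu; rewrite /fps_inv ifT //.
have fu' : f 0%N \is a GRing.unit by [].
rewrite mulrAC mulrC -{2}[fconst _ * f](subKr 1) fgeomE //.
by rewrite fcoefB fcoef1 fcoef_constM mulVr // subrr.
Qed.
Fact fps_unitP f g : g * f = 1 -> fps_unit f.
Proof.
move=> /(congr1 (fun h : fps R => h 0%N)); rewrite fcoefM0 fcoef1 => h.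
by apply/unitrPr; exists (g 0%N); rewrite mulrC.
Qed.
Fact fps_inv_out : {in [predC fps_unit], fps_inv =1 id}.
Proof. by move=> f /negbTE fu; rewrite /fps_inv [fps_unit f]fu. Qed.

HB.instance Definition _ :=
  GRing.ComNzRing_hasMulInverse.Build (fps R) fps_mulVf fps_unitP fps_inv_out.

Lemma fps_unitE f : (f \is a GRing.unit) = (f 0%N \is a GRing.unit).
Proof. by []. Qed.
End FpsUnit.

(** * Orders of power series *)

Section Order.
Variable V : zmodType.
Implicit Types f g : fps V.

Lemma fps_neq0 f : f != 0 -> exists n, f n != 0.
Proof.
move=> f0; apply: contrapT => h; move/eqP: f0; apply; apply: fpsP => n.
by apply/eqP; apply: contraT => hn; case: h; exists n.
Qed.

Definition ordf f : nat :=
  match pselect (exists n, f n != 0) with left e => ex_minn e | right _ => 0 end.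

Lemma ordf_neq0 f : f != 0 -> f (ordf f) != 0.
Proof. by move/fps_neq0 => h; rewrite /ordf; case: pselect => // e; case: ex_minnP. Qed.
Lemma ordf_lt f n : (n < ordf f)%N -> f n = 0.
Proof.
rewrite /ordf; case: pselect => // e; case: ex_minnP => m _ hm nm.
by apply/eqP; apply: contraTT nm => /hm; rewrite -leqNgt.
Qed.
Lemma ordf_ge f n : f != 0 -> (forall i, (i < n)%N -> f i = 0) -> (n <= ordf f)%N.
Proof.
by move=> f0 h; rewrite leqNgt; apply/negP => /h /eqP; apply/negP/ordf_neq0.
Qed.
Lemma ford_neq0 f n : ford f n -> f != 0.
Proof. by case=> h _; apply: contraNneq h => ->. Qed.
Lemma ford_ordf f n : ford f n -> ordf f = n.
Proof.
move=> [h1 h2]; apply/eqP; rewrite eqn_leq; apply/andP; split.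
  by rewrite leqNgt; apply/negP => /ordf_lt /eqP; apply/negP.
by apply: ordf_ge => //; apply: ford_neq0 (conj h1 h2).
Qed.
Lemma ordfP f : f != 0 -> ford f (ordf f).
Proof. by move=> f0; split; [exact: ordf_neq0|move=> i; apply: ordf_lt]. Qed.
Lemma fordE f n : ford f n <-> f != 0 /\ ordf f = n.
Proof.
split=> [h|[f0 <-]]; [split; [exact: ford_neq0 h|exact: ford_ordf]|exact: ordfP].
Qed.
Lemma fordN f n : ford f n -> ford (- f) n.
Proof. by case=> h1 h2; split=> [|i /h2 hi]; rewrite ?oppr_eq0 //= hi oppr0. Qed.
Lemma ordfN f : ordf (- f) = ordf f.
Proof.
have [->|f0] := eqVneq f 0; first by rewrite oppr0.
exact/ford_ordf/fordN/ordfP.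
Qed.
End Order.

Section FpsIdomain.
Variable R : idomainType.
Implicit Types f g u : fps R.

Lemma fordM f g i j : ford f i -> ford g j -> ford (f * g) (i + j).
Proof.
move=> [fi fl] [gj gl]; split=> [|n nij]; rewrite fcoefM.
  have h : (i < (i + j).+1)%N by rewrite ltnS leq_addr.
  rewrite (bigD1 (Ordinal h)) //= addKn big1 ?addr0 ?mulf_neq0 // => l li.
  have [/fl->|il] := ltnP l i; first by rewrite mul0r.
  rewrite gl ?mulr0 //.
  have {}il : (i < l)%N by rewrite ltn_neqAle il andbT eq_sym.
  by have := ltn_ord l; lia.
rewrite big1 // => l _; have [/fl->|il] := ltnP l i; first by rewrite mul0r.
rewrite gl ?mulr0 //; have := ltn_ord l; lia.
Qed.

Fact fps_integral f g : f * g = 0 -> (f == 0) || (g == 0).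
Proof.
move=> fg; apply/norP => -[/ordfP hf /ordfP hg].
by have := ford_neq0 (fordM hf hg); rewrite fg eqxx.
Qed.

HB.instance Definition _ := GRing.ComUnitRing_isIntegral.Build (fps R) fps_integral.

Lemma ordfM f g : f != 0 -> g != 0 -> ordf (f * g) = (ordf f + ordf g)%N.
Proof. by move=> f0 g0; apply: ford_ordf; apply: fordM; apply: ordfP. Qed.
Lemma ordf1 : ordf (1 : fps R) = 0%N.
Proof. by apply: ford_ordf; split => //; rewrite fcoef1 oner_neq0. Qed.
Lemma ordf_unit f : f 0%N != 0 -> ordf f = 0%N.
Proof. by move=> h; apply: ford_ordf. Qed.
Lemma ordf_prod I (r : seq I) (F : I -> fps R) : (forall i, F i != 0) ->
  ordf (\prod_(i <- r) F i) = (\sum_(i <- r) ordf (F i))%N.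
Proof.
move=> h; elim: r => [|a r IH]; first by rewrite !big_nil ordf1.
rewrite !big_cons ordfM ?IH //.
by elim/big_rec: _ => [|i x _ x0]; [exact: oner_neq0|exact: mulf_neq0].
Qed.
Lemma ordfX f n : f != 0 -> ordf (f ^+ n) = (n * ordf f)%N.
Proof.
move=> f0; elim: n => [|n IH]; first by rewrite ordf1.
by rewrite exprS ordfM ?expf_neq0 // IH mulSn.
Qed.
Lemma ordf_mono (c : R) n : c != 0 -> ordf (fmono c n) = n.
Proof.
move=> c0; apply: ford_ordf; split; first by rewrite fmonoE eqxx.
by move=> i ilt; rewrite fmonoE ltn_eqF.
Qed.
Lemma fmono_neq0 (c : R) n : c != 0 -> fmono c n != 0.
Proof.
move=> c0; apply: contraNneq c0 => /(congr1 (fun f : fps R => f n)).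
by rewrite fmonoE eqxx => ->.
Qed.
End FpsIdomain.

Notation fX n := (fmono 1 n).

Section Shift.
Variable R : comPzRingType.
Implicit Types f g u : fps R.
Lemma fcoef_XM n f i : (fX n * f) i = if (n <= i)%N then f (i - n)%N else 0.
Proof. by rewrite fcoef_monoM; case: ifP => // _; rewrite mul1r. Qed.

Definition fdrop n f : fps R := Fps (fun i => f (n + i)%N).

Lemma fdropP n f : (forall i, (i < n)%N -> f i = 0) -> f = fX n * fdrop n f.
Proof.
move=> h; apply: fpsP => i; rewrite fcoef_XM.
by case: leqP => [ni|/h //]; rewrite /= subnKC.
Qed.
Lemma fXX (n i : nat) : (fX n : fps R) ^+ i = fX (n * i).
Proof. by rewrite fmonoX expr1n. Qed.
Lemma fXM (n i : nat) : (fX n : fps R) * fX i = fX (n + i).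
Proof. by rewrite fmonoM mulr1. Qed.
Lemma fX0 : (fX 0 : fps R) = 1. Proof. by []. Qed.
End Shift.

Section Derivation.
Variable R : comPzRingType.
Implicit Types f g u : fps R.
Lemma fderivD f g : fderiv (f + g) = fderiv f + fderiv g.
Proof. by apply: fpsP => n; rewrite fcoefD /= mulrnDl. Qed.
Lemma fderivM f g : fderiv (f * g) = fderiv f * g + f * fderiv g.
Proof.
apply: fpsP => n; rewrite fcoefD 2!fcoefM [fderiv _ n]/= -sumrMnl.
transitivity (\sum_(i < n.+2) (f i * g (n.+1 - i)%N *+ i + f i * g (n.+1 - i)%N *+ (n.+1 - i))).
  by apply: eq_bigr => i _; rewrite -mulrnDr subnKC // -ltnS.
rewrite big_split /=; congr (_ + _).
  rewrite big_ord_recl mulr0n. rewrite add0r; apply: eq_bigr => i _.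
  by rewrite lift0 /= subSS mulrnAl.
rewrite big_ord_recr /= subnn mulr0n addr0; apply: eq_bigr => i _.
by rewrite subSn ?mulrnAr // -ltnS.
Qed.
Lemma fderiv0 : fderiv (0 : fps R) = 0.
Proof. by apply: fpsP => n; rewrite /= mul0rn. Qed.
End Derivation.

Section OrdDeriv.
Variable F : idomainType.
Hypothesis char0 : forall n, n.+1%:R != 0 :> F.
Lemma ford_fderiv (f : fps F) n : ford f n.+1 -> ford (fderiv f) n.
Proof.
move=> [h1 h2]; split=> [|i ilt] /=; last by rewrite h2 // mul0rn.
by rewrite -mulr_natr mulf_neq0.
Qed.
End OrdDeriv.

Section Rmor.
Variables A B : comPzRingType.
(** A predicate rather than a bundled structure: substitutions such as [feval^~ y] are morphisms
    only under the side condition [y 0 = 0]. *)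
Definition rmor (phi : A -> B) : Prop :=
  [/\ {morph phi : x y / x + y}, {morph phi : x y / x * y} & phi 1 = 1].
Variable phi : A -> B.
Hypothesis h : rmor phi.
Lemma rmorD x y : phi (x + y) = phi x + phi y. Proof. by case: h. Qed.
Lemma rmorM x y : phi (x * y) = phi x * phi y. Proof. by case: h. Qed.
Lemma rmor1 : phi 1 = 1. Proof. by case: h. Qed.
Lemma rmor0 : phi 0 = 0.
Proof. by apply: (addrI (phi 0)); rewrite -rmorD !addr0. Qed.
Lemma rmorN x : phi (- x) = - phi x.
Proof. by apply: (addrI (phi x)); rewrite -rmorD !subrr rmor0. Qed.
Lemma rmorB x y : phi (x - y) = phi x - phi y.
Proof. by rewrite rmorD rmorN. Qed.
Lemma rmor_sum I r (P : pred I) F :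
  phi (\sum_(i <- r | P i) F i) = \sum_(i <- r | P i) phi (F i).
Proof. by apply: (big_morph _ rmorD rmor0). Qed.
Lemma rmor_prod I r (P : pred I) F :
  phi (\prod_(i <- r | P i) F i) = \prod_(i <- r | P i) phi (F i).
Proof. by apply: (big_morph _ rmorM rmor1). Qed.
Lemma rmorX x n : phi (x ^+ n) = phi x ^+ n.
Proof. by elim: n => [|n IH]; rewrite ?expr0 ?rmor1 ?exprS ?rmorM ?IH. Qed.
End Rmor.

Lemma rmor_comp (A B C : comPzRingType) (f : B -> C) (g : A -> B) :
  rmor f -> rmor g -> rmor (fun x => f (g x)).
Proof.
move=> hf hg; split=> [x y|x y|]; first by rewrite !rmorD.
- by rewrite !rmorM.
- by rewrite !rmor1.
Qed.

Lemma rmor_pack (A B : comNzRingType) (f : A -> B) :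
  rmor f -> exists g : {rmorphism A -> B}, g = f :> (A -> B).
Proof.
move=> hf.
have am : nmod_morphism f by split; [exact: rmor0|exact: rmorD].
have mm : monoid_morphism f by split; [exact: rmor1|exact: rmorM].
pose m1 := GRing.isNmodMorphism.Build A B f am.
pose m2 := GRing.isMonoidMorphism.Build A B f mm.
pose g : {rmorphism A -> B} := HB.pack f m1 m2.
by exists g.
Qed.

Lemma rmor_fconst (A : comPzRingType) : rmor (@fconst A).
Proof. by split; [exact: fconstD|exact: fconstM|]. Qed.
Lemma rmor_coef0 (A : comPzRingType) : rmor (fun f : fps A => f 0%N).
Proof. by split=> // f g; exact: fcoefM0. Qed.

Definition fmap (A B : Type) (phi : A -> B) (f : fps A) : fps B := Fps (fun j => phi (f j)).

Lemma rmor_fmap (A B : comPzRingType) (phi : A -> B) : rmor phi -> rmor (fmap phi).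
Proof.
move=> h; split=> [f g|f g|]; apply: fpsP => n.
- by rewrite fcoefD /= (rmorD h).
- rewrite fcoefM /= (rmor_sum h); apply: eq_bigr => i _; exact: rmorM.
- by rewrite fcoef1 /=; case: eqP => _; rewrite ?(rmor1 h) ?(rmor0 h).
Qed.

Lemma fmap_const (A B : zmodType) (phi : A -> B) c :
  phi 0 = 0 -> fmap phi (fconst c) = fconst (phi c).
Proof. by move=> h; apply: fpsP => n /=; case: ifP. Qed.
Lemma fmap_fX (A B : comPzRingType) (phi : A -> B) n :
  rmor phi -> fmap phi (fX n) = fX n.
Proof. by move=> h; apply: fpsP => i /=; case: ifP; rewrite ?(rmor1 h) ?(rmor0 h). Qed.

Section Swap.
Variable R : comPzRingType.
(** Reads a series in Y over [F[[x]]] as a series in x over [F[[Y]]]. Weierstrass preparation needs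
    this to solve degree by degree in x, and the symmetry of the Milnor number rests on it. *)
Definition swap (f : fps (fps R)) : fps (fps R) := Fps (fun i => Fps (fun j => f j i)).
Lemma swapK : involutive swap.
Proof. by move=> f; apply: fpsP => i; apply: fpsP. Qed.
Lemma rmor_swap : rmor swap.
Proof.
split=> [f g|f g|]; apply: fpsP => i; apply: fpsP => j.
- by [].
- rewrite -[LHS]/((f * g) j i) (fcoefM f) (fcoefM (swap f)) !fcoef_sum.
  under eq_bigr do rewrite fcoefM.
  by rewrite exchange_big; apply: eq_bigr => a _; rewrite fcoefM.
- by case: i => [|i]; case: j => [|j].
Qed.
Lemma swap_const (c : fps R) : swap (fconst c) = fmap (@fconst R) c.
Proof. by apply: fpsP => i; apply: fpsP => j /=; case: ifP. Qed.
End Swap.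

(** * Substitution of a series for Y *)

Section Feval.
Variable R : comNzRingType.
Implicit Types (f : fps (fps R)) (y : fps R).

Definition feval f y : fps R := Fps (fun n => \sum_(j < n.+1) (f j * y ^+ j) n).

Lemma fevalE f y n : feval f y n = \sum_(j < n.+1) (f j * y ^+ j) n.
Proof. by []. Qed.

Lemma fcoef_mul_ext (f f' g g' : fps R) n : (forall i, (i <= n)%N -> f i = f' i) ->
  (forall i, (i <= n)%N -> g i = g' i) -> (f * g) n = (f' * g') n.
Proof.
move=> h1 h2; rewrite !fcoefM; apply: eq_bigr => i _.
by rewrite h1 ?h2 ?leq_subr // -ltnS.
Qed.

Lemma fcoef_mul_lt y (a : fps R) n j : y 0%N = 0 -> (n < j)%N -> (a * y ^+ j) n = 0.
Proof.
move=> y0 nj; rewrite fcoefM big1 // => i _.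
by rewrite (fcoef_lt_expr y0) ?mulr0 // (leq_ltn_trans (leq_subr _ _)).
Qed.

(** Coefficient [n] of a substitution only sees the coefficients of [f] up to index [n], so
    identities about [feval] reduce to [horner] identities for truncations. *)
Lemma feval_poly y n (p : {poly fps R}) f : y 0%N = 0 ->
  (forall j, (j <= n)%N -> p`_j = f j) -> feval f y n = p.[y] n.
Proof.
move=> y0 h; rewrite (horner_coef_wide y (leq_maxl (size p) n.+1)).
set m := maxn _ _.
rewrite fcoef_sum [LHS]/= (big_ord_widen m (fun j => (f j * y ^+ j) n)) ?leq_maxr //.
rewrite big_mkcond; apply: eq_bigr => i _; case: ifP => [|/negbT].
  by rewrite ltnS => /h->.
by rewrite -leqNgt => /(fcoef_mul_lt _ y0)->.
Qed.

Lemma coef_trunc n f j : (j <= n)%N -> (\poly_(i < n.+1) f i)`_j = f j.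
Proof. by move=> jn; rewrite coef_poly ltnS jn. Qed.

Lemma rmor_feval y : y 0%N = 0 -> rmor (feval^~ y).
Proof.
move=> y0; split=> [f g|f g|]; apply: fpsP => n.
- rewrite fcoefD -big_split; apply: eq_bigr => i _.
  exact: (congr1 (fun h : fps R => h n) (mulrDl (f i) (g i) (y ^+ i))).
- pose p := \poly_(i < n.+1) f i; pose q := \poly_(i < n.+1) g i.
  rewrite (feval_poly (p := p * q)) // => [|j jn]; last first.
    rewrite coefM fcoefM; apply: eq_bigr => i _; rewrite !coef_trunc //.
      by rewrite (leq_trans (leq_subr _ _)).
    by rewrite (leq_trans _ jn) // -ltnS.
  rewrite hornerM; apply: fcoef_mul_ext => i lin.
    by rewrite (feval_poly (p := p)) // => j ji; rewrite coef_trunc ?(leq_trans ji).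
  by rewrite (feval_poly (p := q)) // => j ji; rewrite coef_trunc ?(leq_trans ji).
rewrite (feval_poly (p := 1)) ?hornerC // => j _; rewrite coef1.
by case: j.
Qed.

Lemma feval_const a y : feval (fconst a) y = a.
Proof.
apply: fpsP => n; rewrite fevalE big_ord_recl expr0 mulr1 big1 ?addr0 // => i _.
by rewrite fmonoE mul0r.
Qed.
Lemma feval_fX1 y : y 0%N = 0 -> feval (fX 1) y = y.
Proof.
move=> y0; apply: fpsP => n; rewrite (feval_poly (p := 'X)) ?hornerX // => j _.
by rewrite coefX fmonoE; case: (j == 1%N).
Qed.
Lemma feval_0 f y : (feval f y) 0%N = f 0%N 0%N.
Proof. by rewrite fevalE big_ord_recl big_ord0 addr0 expr0 mulr1. Qed.

Lemma feval_zero f : feval f 0 = f 0%N.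
Proof.
apply: fpsP => n; rewrite fevalE big_ord_recl expr0 mulr1 big1 ?addr0 // => i _.
by rewrite exprS mul0r mulr0.
Qed.

Definition Yminus y : fps (fps R) := fX 1 - fconst y.

Lemma feval_Yminus y (z : fps R) : z 0%N = 0 -> feval (Yminus y) z = z - y.
Proof. by move=> z0; rewrite (rmorB (rmor_feval z0)) feval_fX1 // feval_const. Qed.

Lemma feval_drop f y : y 0%N = 0 -> feval f y = f 0%N + y * feval (fdrop 1 f) y.
Proof.
move=> y0; have {1}-> : f = fconst (f 0%N) + fX 1 * fdrop 1 f.
  apply: fpsP => n; rewrite fcoefD fcoef_XM fmonoE; case: n => [|n] /=.
    by rewrite addr0.
  by rewrite add0r add1n subn1.
by rewrite (rmorD (rmor_feval y0)) (rmorM (rmor_feval y0)) feval_const feval_fX1.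
Qed.

(** Horner's division scheme: coefficient [j] of the quotient is the tail of [f] from index [j.+1]
    on, evaluated at [y]. *)
Lemma Yminus_dvd f y : y 0%N = 0 -> feval f y = 0 -> exists q, f = Yminus y * q.
Proof.
move=> y0 fy; pose q : fps (fps R) := Fps (fun j => feval (fdrop j.+1 f) y).
have qE j : q j = feval (fdrop j.+1 f) y by [].
have dd n : fdrop 1 (fdrop n f) = fdrop n.+1 f.
  by apply: fpsP => i /=; congr (f _); lia.
exists q; apply: fpsP => n; rewrite mulrBl fcoefB fcoef_XM fcoef_constM qE.
case: n => [|n].
  by rewrite ltnn sub0r; apply/eqP; rewrite -addr_eq0 -fy (feval_drop f).
by rewrite subn1 qE (feval_drop (fdrop n.+1 f)) // dd [fdrop _ _ _]/= addn0 addrK.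
Qed.
End Feval.

Section Fcomp.
Variable R : comNzRingType.
Implicit Types (f g u v : fps R).

Lemma fcompE f u : fcomp f u = feval (fmap (@fconst R) f) u.
Proof. by apply: fpsP => n; apply: eq_bigr => i _; rewrite fcoef_constM. Qed.

Lemma rmor_fcomp u : u 0%N = 0 -> rmor (@fcomp R ^~ u).
Proof.
move=> u0; have -> : @fcomp R ^~ u = fun f => feval (fmap (@fconst R) f) u.
  by apply: funext => f; rewrite fcompE.
exact: rmor_comp (rmor_feval u0) (rmor_fmap (@rmor_fconst R)).
Qed.

Lemma fcomp_const (c : R) u : fcomp (fconst c) u = fconst c.
Proof. by rewrite fcompE fmap_const ?feval_const // fconst0. Qed.
Lemma fcomp_X1 u : u 0%N = 0 -> fcomp (fX 1) u = u.
Proof. by move=> u0; rewrite fcompE fmap_fX ?feval_fX1 //; exact: rmor_fconst. Qed.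
Lemma fX1X n : (fX n : fps R) = fX 1 ^+ n.
Proof. by rewrite fXX mul1n. Qed.
Lemma fcomp_fX n u : u 0%N = 0 -> fcomp (fX n) u = u ^+ n.
Proof. by move=> u0; rewrite fX1X (rmorX (rmor_fcomp u0)) fcomp_X1. Qed.
Lemma fcomp_0 f u : (fcomp f u) 0%N = f 0%N.
Proof. by rewrite fcompE feval_0 /= . Qed.

Lemma fcomp_ext f g u n : (forall i, (i <= n)%N -> f i = g i) -> fcomp f u n = fcomp g u n.
Proof. by move=> h; apply: eq_bigr => -[i /= lin] _; rewrite h. Qed.

(** Composition with [v] is a ring morphism, so on truncations the claim is [horner_map].
    Associativity of composition is the special case of constant coefficients. *)
Lemma fcomp_feval (f : fps (fps R)) (y v : fps R) : y 0%N = 0 -> v 0%N = 0 ->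
  fcomp (feval f y) v = feval (fmap (@fcomp R ^~ v) f) (fcomp y v).
Proof.
move=> y0 v0; apply: fpsP => n.
pose p := \poly_(i < n.+1) f i.
rewrite (@fcomp_ext _ p.[y]) => [|i lin]; last first.
  by apply: feval_poly => // j ji; rewrite coef_trunc // (leq_trans ji).
have [phi hphi] := rmor_pack (rmor_fcomp v0).
have hp x : phi x = fcomp x v by rewrite hphi.
rewrite -hp -horner_map hp; symmetry; apply: feval_poly.
  by rewrite fcomp_0.
by move=> j jn; rewrite coef_map coef_trunc //; exact: hp.
Qed.

Lemma fcompA f u v : u 0%N = 0 -> v 0%N = 0 ->
  fcomp (fcomp f u) v = fcomp f (fcomp u v).
Proof.
move=> u0 v0; rewrite (fcompE f u) fcomp_feval // (fcompE f (fcomp u v)); congr feval.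
by apply: fpsP => i /=; rewrite fcomp_const.
Qed.
Lemma fcomp_id f : fcomp f (fX 1) = f.
Proof.
apply: fpsP => n /=; rewrite (bigD1 ord_max) //= fXX mul1n fmonoE eqxx mulr1.
rewrite big1 ?addr0 // => i ni; rewrite fXX mul1n fmonoE ifN ?mulr0 //.
by rewrite eq_sym.
Qed.

Lemma fcomp_fX_coef N f n : (0 < N)%N ->
  (fcomp f (fX N)) n = if (N %| n)%N then f (n %/ N)%N else 0.
Proof.
move=> N0 /=; under eq_bigr do rewrite fXX fmonoE.
case: ifP => [/dvdnP[k ->]|Nn]; last first.
  by rewrite big1 // => i _; case: eqP => [h|]; rewrite ?mulr0 //; case/negP: (negbT Nn); apply/dvdnP; exists i; rewrite mulnC.
rewrite mulnK //.
have kn : (k < (k * N).+1)%N by rewrite ltnS leq_pmulr.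
rewrite (bigD1 (Ordinal kn)) //= [(N * k)%N]mulnC eqxx mulr1 big1 ?addr0 // => i ik.
by rewrite [(N * i)%N]mulnC eqn_pmul2r // ifN ?mulr0 // eq_sym.
Qed.
Lemma fcomp_scale_coef (z : R) f n : (fcomp f (fmono z 1)) n = z ^+ n * f n.
Proof.
rewrite /= (bigD1 ord_max) //= fmonoX mul1n fmonoE eqxx mulrC big1 ?addr0 // => i ni.
by rewrite fmonoX mul1n fmonoE ifN ?mulr0 // eq_sym.
Qed.
End Fcomp.

Section FevalDeriv.
Variable R : comNzRingType.
Implicit Types (f : fps (fps R)) (y : fps R).

Lemma fderiv_horner (p : {poly fps R}) y :
  fderiv p.[y] = (\poly_(i < size p) fderiv p`_i).[y] + (p^`()).[y] * fderiv y.
Proof.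
elim/poly_ind: p => [|p c IH].
  by rewrite size_poly0 poly_def big_ord0 deriv0 !horner0 fderiv0 mul0r addr0.
have -> : \poly_(i < size (p * 'X + c%:P)) fderiv (p * 'X + c%:P)`_i =
          (\poly_(i < size p) fderiv p`_i) * 'X + (fderiv c)%:P.
  apply/polyP => i; rewrite coef_poly.
  have h : (if (i < size (p * 'X + c%:P)%R)%N then fderiv (p * 'X + c%:P)`_i else 0)
    = fderiv (p * 'X + c%:P)`_i by case: ltnP => // hi; rewrite nth_default // fderiv0.
  rewrite h !(coefD, coefMX, coefC) coef_poly; case: i {h} => [|i] /=; first by rewrite !add0r.
  by rewrite !addr0; case: ltnP => // hi; rewrite nth_default // fderiv0.
rewrite derivD derivM derivX derivC addr0 mulr1 !(hornerD, hornerM, hornerX, hornerC).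
rewrite fderivD fderivM IH; ring.
Qed.

(** The total derivative of f(x, y(x)): [fmap (@fderiv R)] is the partial derivative in x, the outer
    [fderiv] the one in Y. Along a root of f_y this identity leaves only f_x. *)
Lemma fderiv_feval f y : y 0%N = 0 ->
  fderiv (feval f y) = feval (fmap (@fderiv R) f) y + feval (fderiv f) y * fderiv y.
Proof.
move=> y0; apply: fpsP => n.
(* One degree more than [n], because the derivative reads coefficient [n.+1]. *)
pose p := \poly_(i < n.+2) f i.
have -> : fderiv (feval f y) n = fderiv p.[y] n.
  rewrite /fderiv /=; congr (_ *+ _); apply: feval_poly => // j jn.
  by rewrite coef_trunc.
rewrite fderiv_horner !fcoefD; congr (_ + _).
  symmetry; apply: feval_poly => // j jn; rewrite coef_poly.
  have pj : p`_j = f j by rewrite coef_trunc // (leq_trans jn).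
  by case: ltnP => [_|hj]; rewrite /= -pj // nth_default // fderiv0.
apply: fcoef_mul_ext => // i lin; symmetry; apply: feval_poly => // j ji.
by rewrite coef_deriv coef_trunc //= ltnS (leq_trans ji).
Qed.
End FevalDeriv.

(** * Weierstrass division and Puiseux series *)

Section Weierstrass.
Variable F : fieldType.

Definition yord (h : fps (fps F)) d := h d 0%N != 0 /\ forall j, (j < d)%N -> h j 0%N = 0.

(** Solved degree by degree in x over [F[[Y]]], starting from Q_0 = Y^d and the unit U_0 = [u0]. In
    degree n+1 the equation reads u0 Q_(n+1) + U_(n+1) Y^d = (known terms), with Q_(n+1) of degree
    below d in Y. *)
Lemma weierstrass_preparation (h : fps (fps F)) d : yord h d ->
  exists U Q : fps (fps F), [/\ h = U * Q, U 0%N 0%N != 0, Q d = 1,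
    forall j, (d < j)%N -> Q j = 0 & forall j, (j < d)%N -> Q j 0%N = 0].
Proof.
move=> [hd hlt]; pose H := swap h.
have H0 : H 0%N = fX d * fdrop d (H 0%N) by apply: fdropP => i /hlt.
set u0 := fdrop d (H 0%N) in H0.
have u0n : u0 0%N != 0 by rewrite /u0 /= addn0.
have u0u : u0 \is a GRing.unit by rewrite fps_unitE unitfE.
pose Rl n (f : nat -> fps F * fps F) (t : fps F * fps F) : Prop :=
  if n is m.+1 then
    (f 0%N).1 * t.2 + \sum_(i < m) (f i.+1).1 * (f (m - i)%N).2 + t.1 * (f 0%N).2 = H n
    /\ forall j, (d <= j)%N -> t.2 j = 0
  else t = (u0, fX d).
have [|n f IH|f hf] := @strong_choice _ (0, 0) Rl.
- case=> [|n] f g t fg //= [h1 h2]; split=> //; rewrite -h1 !fg //.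
  congr (_ + _ + _); apply: eq_bigr => -[i /= ilt] _.
  by rewrite !fg // ltnS leq_subr.
- case: n IH => [|n] IH; first by exists (u0, fX d).
  have f0 := IH 0%N isT; rewrite /= in f0.
  (* After division by [u0], the part of [w] below degree [d] is the new coefficient of Q, and the
     rest is a multiple of Y^d, absorbed by U. *)
  pose w := u0^-1 * (H n.+1 - \sum_(i < n) (f i.+1).1 * (f (n - i)%N).2).
  pose b : fps F := Fps (fun i => if (i < d)%N then w i else 0).
  exists (u0 * fdrop d (w - b), b); split; last by move=> j dj; rewrite /= ltnNge dj.
  have key : fdrop d (w - b) * fX d = w - b.
    by rewrite mulrC -fdropP // => i ilt; rewrite fcoefB /b /= ilt subrr.
  rewrite f0 [RHS]/= [(_, b).1]/= [(_, b).2]/= [(u0, _).2]/= [(u0, _).1]/=.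
  rewrite addrAC -mulrA key -mulrDr [b + _]addrC subrK /w mulrA mulrV // mul1r subrK //.
pose U : fps (fps F) := Fps (fun n => (f n).1); pose Q : fps (fps F) := Fps (fun n => (f n).2).
have f0 := hf 0%N; rewrite /= in f0.
have UQ : H = U * Q.
  apply: fpsP => -[|n]; first by rewrite [LHS]H0 fcoefM0 [U _]/= [Q _]/= f0 mulrC.
  have [e _] := hf n.+1; rewrite -e fcoefM big_ord_recl big_ord_recr /=.
  rewrite subnn addrA; congr (_ + _ + _).
exists (swap U), (swap Q); split.
- by rewrite -(rmorM (rmor_swap _)) -UQ /H swapK.
- by rewrite /= f0.
- apply: fpsP => -[|n] /=; first by rewrite f0 /= eqxx.
  by have [_ ->] := hf n.+1.
- move=> j dj; apply: fpsP => -[|n] /=; first by rewrite f0 /= gtn_eqF.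
  by have [_ ->] := hf n.+1; rewrite // ltnW.
- by move=> j jd; rewrite /= f0 /= ltn_eqF.
Qed.

(** The case [d = 1] of Weierstrass preparation: the distinguished factor is Y + Q_0, whose root is
    visible. *)
Lemma implicit_function (h : fps (fps F)) : h 0%N 0%N = 0 -> h 1%N 0%N != 0 ->
  exists eta : fps F, eta 0%N = 0 /\ feval h eta = 0.
Proof.
move=> h0 h1; have [|U [Q [hE _ Q1 Qg Ql]]] := @weierstrass_preparation h 1.
  by split=> // -[].
have e0 : (- Q 0%N) 0%N = 0 by rewrite fcoefN Ql // oppr0.
exists (- Q 0%N); split=> //.
have QE : Q = fX 1 + fconst (Q 0%N).
  apply: fpsP => -[|[|n]]; rewrite fcoefD !fmonoE /= ?add0r ?addr0 //.
  by rewrite Qg.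
rewrite hE (rmorM (rmor_feval e0)) {2}QE (rmorD (rmor_feval e0)) feval_fX1 //.
by rewrite feval_const addNr mulr0.
Qed.

Lemma comp_right_inverse (u : fps F) : u 0%N = 0 -> u 1%N != 0 ->
  exists v : fps F, [/\ v 0%N = 0, v 1%N != 0 & fcomp u v = fX 1].
Proof.
move=> u0 u1.
have [||v [v0 hv]] := @implicit_function (fmap (@fconst F) u - fconst (fX 1)).
- by rewrite fcoefB /= u0 subr0.
- by rewrite fcoefB /= subr0.
have uv : fcomp u v = fX 1.
  by apply/eqP; rewrite -subr_eq0 -hv (rmorB (rmor_feval v0)) feval_const fcompE.
exists v; split=> //; apply/eqP => v1.
have := congr1 (fun f : fps F => f 1%N) uv.
rewrite /= !big_ord_recl big_ord0 /= addr0 u0 mul0r add0r expr1 v1 mulr0 => /eqP.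
by rewrite eq_sym oner_eq0.
Qed.

(** The right inverse [v] has itself a right inverse [w], and associativity gives [u = w]; hence [v]
    is two-sided. *)
Lemma comp_inverse (u : fps F) : u 0%N = 0 -> u 1%N != 0 ->
  exists v : fps F, [/\ v 0%N = 0, v 1%N != 0, fcomp u v = fX 1 & fcomp v u = fX 1].
Proof.
move=> u0 u1; have [v [v0 v1 uv]] := comp_right_inverse u0 u1.
have [w [w0 w1 vw]] := comp_right_inverse v0 v1.
have uw : u = w by rewrite -[u]fcomp_id -vw -fcompA // uv fcomp_X1.
by exists v; rewrite {2}uw.
Qed.
End Weierstrass.

Section Roots.
Variable F : closedFieldType.
Hypothesis char0 : forall n, n.+1%:R != 0 :> F.

Lemma exists_root (p : {poly F}) : (1 < size p)%N -> exists c, root p c.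
Proof.
move=> sp; have : size p != 1%N by rewrite gtn_eqF.
by move/closed_rootP.
Qed.

Lemma exists_kth_root (k : nat) (c : F) : (0 < k)%N -> exists a, a ^+ k = c.
Proof.
move=> k0; have [|a /rootP] := @exists_root ('X^k - c%:P).
  by rewrite size_XnsubC.
by rewrite !hornerE => /eqP; rewrite subr_eq0 => /eqP <-; exists a.
Qed.

Lemma fcoef1X (R : comPzRingType) (f : fps R) k :
  (f ^+ k.+1) 1%N = f 0%N ^+ k * f 1%N *+ k.+1.
Proof.
elim: k => [|k IH]; first by rewrite !expr1 expr0 mul1r.
have e : (f ^+ k.+2) 1%N = f 0%N * (f ^+ k.+1) 1%N + f 1%N * (f ^+ k.+1) 0%N.
  by rewrite exprS fcoefM !big_ord_recl big_ord0 addr0.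
by rewrite e IH fcoefX0 mulrnAr mulrA -exprS [f 1%N * _]mulrC -mulrSr.
Qed.

(** The implicit function theorem for (a + Y)^k - e with a^k = e(0): the derivative k a^(k-1) at the
    origin is nonzero in characteristic zero. *)
Lemma fps_kth_root (k : nat) (e : fps F) : (0 < k)%N -> e 0%N != 0 ->
  exists r : fps F, r ^+ k = e.
Proof.
move=> k0 e0; have [a ak] := exists_kth_root (e 0%N) k0.
have a0 : a != 0 by apply: contra_neq e0 => a0; rewrite -ak a0 expr0n gtn_eqF.
case: k k0 ak => // k _ ak.
pose h := (fconst (fconst a) + fX 1) ^+ k.+1 - fconst e.
have [||y [y0 hy]] := @implicit_function _ h.
- by rewrite /h fcoefB !fcoefX0 fcoefD !fmonoE !eqxx addr0 ak subrr.
- rewrite /h fcoefB fcoef1X !fcoefD !fmonoE !eqxx addr0 add0r mulr1 subr0 -fconstX.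
  by rewrite -mulr_natr fcoefM0 fcoef_natr fmonoE eqxx mulf_neq0 ?expf_neq0.
exists (fconst a + y); apply/eqP; rewrite -subr_eq0 -hy /h.
rewrite (rmorB (rmor_feval y0)) (rmorX (rmor_feval y0)) (rmorD (rmor_feval y0)).
by rewrite !feval_const feval_fX1.
Qed.

(** In characteristic zero X^n - 1 is separable, so it has n distinct roots, and a group of n such
    roots of unity contains a primitive one. *)
Lemma exists_prim_root n : (0 < n)%N -> exists z : F, n.-primitive_root z.
Proof.
move=> n_gt0; pose p : {poly F} := 'X^n - 1; have [r Dp] := closed_field_poly_normal p.
rewrite (monicP _) ?monicXnsubC // scale1r in Dp.
have rn1: all n.-unity_root r by apply/allP=> z; rewrite -root_prod_XsubC -Dp.
have sz_r: (n < (size r).+1)%N.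
  by rewrite -(size_prod_XsubC r id) -Dp size_XnsubC.
have [|z] := hasP (has_prim_root n_gt0 rn1 _ sz_r); last by exists z.
rewrite -separable.separable_prod_XsubC -Dp cyclotomic.separable_Xn_sub_1 //.
by case: n n_gt0 {p r Dp rn1 sz_r}.
Qed.
End Roots.

Section BaseChange.
Variable R : comNzRingType.

Definition cf0 (f : fps R) : R := f 0%N.
Fact cf0_nmod : nmod_morphism cf0. Proof. by []. Qed.
Fact cf0_monoid : monoid_morphism cf0. Proof. by split=> // f g; exact: fcoefM0. Qed.
HB.instance Definition _ := GRing.isNmodMorphism.Build (fps R) R cf0 cf0_nmod.
HB.instance Definition _ := GRing.isMonoidMorphism.Build (fps R) R cf0 cf0_monoid.

(** The ramified base change x = t^(N+1); the shift by one keeps the exponent positive without a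
    hypothesis. *)
Definition bs N (f : fps R) : fps R := fcomp f (fX N.+1).
Lemma rmor_bs N : rmor (bs N). Proof. exact: rmor_fcomp. Qed.
Arguments rmor_bs : clear implicits.
Fact bs_nmod N : nmod_morphism (bs N).
Proof. by split; [exact: rmor0 (rmor_bs N)|exact: rmorD (rmor_bs N)]. Qed.
Fact bs_monoid N : monoid_morphism (bs N).
Proof. by split; [exact: rmor1 (rmor_bs N)|exact: rmorM (rmor_bs N)]. Qed.
HB.instance Definition _ N := GRing.isNmodMorphism.Build (fps R) (fps R) (bs N) (bs_nmod N).
HB.instance Definition _ N := GRing.isMonoidMorphism.Build (fps R) (fps R) (bs N) (bs_monoid N).

Lemma bs_coef N f n : bs N f n = if (N.+1 %| n)%N then f (n %/ N.+1)%N else 0.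
Proof. exact: fcomp_fX_coef. Qed.
Lemma bs_coefM N f n : bs N f (n * N.+1)%N = f n.
Proof. by rewrite bs_coef dvdn_mull // mulnK. Qed.
Lemma bs_0 N f : bs N f 0%N = f 0%N.
Proof. by rewrite -[0%N in LHS](mul0n N.+1) bs_coefM. Qed.
Lemma bs_fconst N (c : R) : bs N (fconst c) = fconst c.
Proof. exact: fcomp_const. Qed.
Lemma bs_bs M N f : bs M (bs N f) = bs (N.+1 * M.+1).-1 f.
Proof.
rewrite /bs fcompA // fcomp_fX // fXX prednK ?muln_gt0 //.
by rewrite mulnC.
Qed.
Lemma bs0 f : bs 0 f = f. Proof. exact: fcomp_id. Qed.
End BaseChange.

Lemma bs_neq0 (R : idomainType) N (f : fps R) : f != 0 -> bs N f != 0.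
Proof.
move=> /fps_neq0[n]; apply: contraNneq => /(congr1 (fun f : fps R => f (n * N.+1)%N)).
by rewrite bs_coefM => ->.
Qed.
Lemma ordf_bs (R : idomainType) N (f : fps R) : f != 0 -> ordf (bs N f) = (N.+1 * ordf f)%N.
Proof.
move=> f0; apply: ford_ordf; split; first by rewrite mulnC bs_coefM ordf_neq0.
move=> i; rewrite bs_coef; case: ifP => // /dvdnP[k ->].
by rewrite mulnK // mulnC ltn_pmul2l // => /ordf_lt.
Qed.

Section Puiseux.
Variable F : closedFieldType.
Hypothesis char0 : forall n, n.+1%:R != 0 :> F.

Lemma feval_of_poly (p : {poly fps F}) (y : fps F) : y 0%N = 0 ->
  feval (Fps (fun j => p`_j)) y = p.[y].
Proof. by move=> y0; apply: fpsP => n; apply: feval_poly. Qed.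

Lemma coefPn_XsubCX (R : comNzRingType) (c : R) d : (0 < d)%N ->
  (('X - c%:P) ^+ d)`_d.-1 = - (c *+ d).
Proof.
move=> d0; have := @coefPn_prod_XsubC R (nseq d c); rewrite size_nseq !big_nseq.
by rewrite iter_mulr_1 iter_addr_0 => -> //; rewrite -lt0n.
Qed.

Lemma comp_poly_scaleX (R : comNzRingType) (p : {poly R}) (a : R) :
  p \Po (a%:P * 'X) = \poly_(i < size p) (p`_i * a ^+ i).
Proof.
rewrite comp_polyE poly_def; apply: eq_bigr => i _.
by rewrite exprMn -polyC_exp -!mul_polyC polyCM mulrA.
Qed.

(** The classical shift by a_(d-1) / d kills the coefficient of index d-1. It preserves the
    vanishing at x = 0 because [c] vanishes there as well. *)
Lemma tschirnhaus (p : {poly fps F}) d : (0 < d)%N -> p \is monic -> size p = d.+1 ->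
  (forall j, (j < d)%N -> p`_j 0%N = 0) ->
  exists c, let p2 := p \Po ('X - c%:P) in
  [/\ c 0%N = 0, p2 \is monic, size p2 = d.+1, p2`_d.-1 = 0 &
      forall j, (j < d)%N -> p2`_j 0%N = 0].
Proof.
move=> d0 pm sp pl; pose a := p`_d.-1; pose c := fconst (d%:R^-1) * a.
have dn0 : d%:R != 0 :> F by case: (d) d0.
have cd : c *+ d = a.
  rewrite -mulr_natl mulrA (_ : d%:R = fconst d%:R) ?(-fconstM).
    by rewrite -fconstM mulfV // mul1r.
  by apply: fpsP => n; rewrite fcoef_natr fmonoE.
have c0 : c 0%N = 0 by rewrite /c fcoef_constM /a pl ?mulr0 // prednK.
clearbody c.
have sq : size ('X - c%:P) = 2%N by rewrite size_XsubC.
have p0E : map_poly (@cf0 F) p = 'X^d.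
  apply/polyP => j; rewrite coef_map coefXn; case: (ltngtP j d) => [/pl //|h|->].
    by rewrite nth_default ?sp.
  by move/monicP: pm; rewrite lead_coefE sp => ->; rewrite rmorph1.
have lc : lead_coef (p \Po ('X - c%:P)) = 1.
  by rewrite lead_coef_comp ?sq // (monicP pm) lead_coefXsubC expr1n mulr1.
exists c => /=; split=> //; first exact/monicP.
- by rewrite size_comp_poly2.
(* The terms of degree below d-1 stay below it under the shift, so only the two leading terms
   contribute to this coefficient. *)
- pose r := p - 'X^d - a%:P * 'X^(d.-1).
  have sr : (size r <= d.-1)%N.
    apply/leq_sizeP => j hj; rewrite /r !coefB coefXn coefCM coefXn.
    move: hj; rewrite leq_eqVlt => /orP[/eqP<-|hj].
      by rewrite eqxx mulr1 ltn_eqF ?prednK // subr0 subrr.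
    rewrite (gtn_eqF hj) mulr0 subr0; move: hj; rewrite prednK // leq_eqVlt.
    case/orP=> [/eqP<-|hj].
      by move/monicP: pm; rewrite lead_coefE sp => ->; rewrite eqxx subrr.
    by rewrite gtn_eqF // nth_default ?sp // subr0.
  have pE : p = 'X^d + a%:P * 'X^(d.-1) + r by rewrite /r; ring.
  clearbody r; rewrite pE !comp_polyD comp_polyM comp_polyC !comp_Xn_poly !coefD coefCM.
  rewrite coefPn_XsubCX // cd.
  have -> : (('X - c%:P) ^+ d.-1)`_d.-1 = 1.
    have := monic_exp d.-1 (monicXsubC c); move/monicP; rewrite lead_coefE.
    by rewrite size_exp_XsubC.
  rewrite mulr1 addNr add0r nth_default //.
  by rewrite size_comp_poly2.
- move=> j jd; rewrite -[_ 0%N]/(cf0 _) -coef_map map_comp_poly p0E.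
  rewrite rmorphB /= map_polyX map_polyC /=. rewrite [cf0 c]c0 subr0 comp_polyXr coefXn.
  by rewrite ltn_eqF.
Qed.

(* The Newton polygon step: the substitution [x = t^q, Y = t^P Z] with [P / q] the
   smallest slope, where [Z^(d-1)] does not occur, so that the reduced polynomial
   is not a [d]-th power. *)
Lemma newton_step (p : {poly fps F}) d : (0 < d)%N -> p \is monic -> size p = d.+1 ->
  p`_d.-1 = 0 -> (forall j, (j < d)%N -> p`_j 0%N = 0) ->
  (exists2 j, (j < d)%N & p`_j != 0) ->
  exists N P (p3 : {poly fps F}), [/\ (0 < P)%N,
    map_poly (bs N) p \Po ((fX P)%:P * 'X) = (fX (P * d))%:P * p3 &
    exists c m q, [/\ map_poly (@cf0 F) p3 = q * ('X - c%:P) ^+ m, ~~ root q c,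
      (0 < m)%N & (m < d)%N]].
Proof.
move=> d0 pm sp pd1 pl [j0 j0d pj0].
pose o j := ordf p`_j.
(* The slopes o_i / (d - i) are compared as integers after scaling by d!, which every d - i
   divides. *)
pose w (i : 'I_d) := (o i * (d`! %/ (d - i)))%N.
have hP0 : p`_(Ordinal j0d) != 0 by [].
have [i0 pi0 hmin] := arg_minnP (P := fun i : 'I_d => p`_i != 0) w hP0.
(* The slope P / q is not reduced to lowest terms: any denominator will do as ramification index. *)
pose q := (d - i0)%N; pose P := ordf p`_i0.
have q0 : (0 < q)%N by rewrite subn_gt0.
have P0 : (0 < P)%N.
  rewrite lt0n; apply/eqP => h.
  by have := ordf_neq0 pi0; rewrite -/P h pl // eqxx.
have hd (i : 'I_d) : (d - i %| d`!)%N.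
  by apply: dvdn_fact; rewrite subn_gt0 ltn_ord leq_subr.
have slope j : p`_j != 0 -> (j < d)%N -> (P * (d - j) <= q * o j)%N.
  move=> pj jd; have := hmin (Ordinal jd) pj; rewrite /w /= => h.
  have f0 := fact_gt0 d; rewrite -(leq_pmul2r f0).
  rewrite -{1}(divnK (hd i0)) -{2}(divnK (hd (Ordinal jd))) /= -/P -/q.
  have := leq_mul (leqnn (q * (d - j))%N) h; rewrite -/P.
  by rewrite -/q; congr (_ <= _)%N; ring.
pose N := q.-1.
have Nq : N.+1 = q by rewrite prednK.
pose b j := fdrop (P * (d - j)) (bs N p`_j).
have hb j : (j <= d)%N -> bs N p`_j = fX (P * (d - j)) * b j.
  move=> jd; apply: fdropP => n hn.
  have {}jd : (j < d)%N.
    by move: jd; rewrite leq_eqVlt => /orP[/eqP jd|//]; move: hn; rewrite jd subnn muln0.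
  rewrite bs_coef Nq; case: ifP => // /dvdnP[k hk]; rewrite hk mulnK //.
  have [->|pj] := eqVneq p`_j 0; first by [].
  apply: ordf_lt; rewrite -(ltn_pmul2l q0) [(q * k)%N]mulnC -hk.
  exact: leq_trans hn (slope _ pj jd).
pose p3 := \poly_(j < d.+1) b j.
have pd : p`_d = 1 by move/monicP: pm; rewrite lead_coefE sp.
have bd : b d = 1.
  by have := hb d (leqnn d); rewrite subnn muln0 fX0 mul1r pd rmorph1.
have bi0 : b i0 0%N != 0.
  have -> : b i0 0%N = bs N p`_i0 (P * (d - i0) + 0)%N by [].
  by rewrite addn0 -/q -Nq bs_coefM; exact: ordf_neq0.
have bd1 : b d.-1 = 0.
  by apply: fpsP => n; rewrite /b pd1 rmorph0.
pose r := map_poly (@cf0 F) p3.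
have rE j : r`_j = if (j < d.+1)%N then b j 0%N else 0.
  by rewrite /r coef_map coef_poly; case: ifP.
have sr : size r = d.+1.
  apply/eqP; rewrite eqn_leq; apply/andP; split.
    by apply/leq_sizeP => j hj; rewrite rE ltnNge hj.
  rewrite ltnNge; apply: contraTN isT => /leq_sizeP/(_ d (leqnn d)).
  by rewrite rE ltnSn bd fcoef1 => /eqP; rewrite oner_eq0.
have rm : r \is monic by rewrite monicE lead_coefE sr rE ltnSn bd.
exists N, P, p3; split=> //.
  have sz : size (map_poly (bs N) p) = d.+1.
    by rewrite size_map_poly_id0 ?sp // (monicP pm) rmorph1 oner_neq0.
  rewrite comp_poly_scaleX sz; apply/polyP => j; rewrite coefCM !coef_poly.
  case: ifP => [jd|_]; last by rewrite mulr0.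
  rewrite sp jd hb // fXX mulrAC fXM; congr (fX _ * _).
  by rewrite -mulnDr subnK.
have [|c rc] := @exists_root _ r; first by rewrite sr ltnS.
have [m [q' hq' rE']] := multiplicity_XsubC r c.
have r0 : r != 0 by rewrite -size_poly_eq0 sr.
rewrite r0 /= in hq'.
have q'0 : q' != 0 by apply: contraNneq hq' => ->; rewrite root0.
have szr : (size q' + m)%N = d.+1.
  rewrite -sr rE' size_Mmonic ?monic_exp ?monicXsubC // size_exp_XsubC.
  by rewrite addnS.
exists c, m, q'; split=> //.
  rewrite lt0n; apply: contraNneq hq' => m0; move: rc.
  by rewrite rE' m0 expr0 mulr1.
(* For m = d the reduced polynomial would be (X - c)^d; the missing term of degree d-1 forces c = 0,
   but the coefficient at [i0] does not vanish. *)
rewrite ltnNge; apply/negP => dm.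
have sq1 : size q' = 1%N.
  by apply/eqP; rewrite eqn_leq lt0n size_poly_eq0 q'0 andbT; lia.
have md : m = d by lia.
have q1 : q' = 1.
  move/monicP: rm; rewrite rE' lead_coef_Mmonic ?monic_exp ?monicXsubC //.
  have /size_poly1P[a a0 ->] : size q' == 1%N by apply/eqP.
  by rewrite lead_coefC => ->.
have c0 : c = 0.
  have := rE d.-1; rewrite bd1 if_same {1}rE' q1 mul1r md coefPn_XsubCX //.
  move/eqP; rewrite oppr_eq0 -mulr_natr mulf_eq0 => /orP[/eqP//|].
  by case: (d) d0 => // d' _; rewrite (negbTE (char0 d')).
have := rE i0; rewrite rE' q1 c0 subr0 mul1r md coefXn ltn_eqF // ltnS ltnW //.
by move/eqP; rewrite eq_sym (negbTE bi0).
Qed.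

(** Induction on the order d in Y: a root b of the reduced polynomial given by [newton_step] has
    multiplicity m < d, and recentring at b produces a series of order m. A root om of that series
    yields the root t^P (b + om), shifted back by c. *)
Lemma puiseux_root d (h : fps (fps F)) : (0 < d)%N -> yord h d ->
  exists N (eta : fps F), eta 0%N = 0 /\ feval (fmap (bs N) h) eta = 0.
Proof.
elim/ltn_ind: d h => d IH h d0 hd.
have [U [Q [hE U0 Qd Qg Ql]]] := weierstrass_preparation hd.
pose p := \poly_(j < d.+1) Q j.
have pj j : p`_j = Q j by rewrite coef_poly ltnS; case: leqP => // /Qg.
have sp : size p = d.+1 by apply: size_poly_eq; rewrite Qd oner_neq0.
have pm : p \is monic by rewrite monicE lead_coefE sp pj Qd.
have [|c [c0 p2m sp2 p2d p2l]] := tschirnhaus d0 pm sp.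
  by move=> j jd; rewrite pj Ql.
set p2 := p \Po _ in p2m sp2 p2d p2l.
suff [N [eta [e0 he]]] : exists N (eta : fps F), eta 0%N = 0 /\ (map_poly (bs N) p2).[eta] = 0.
  have e1 : (eta - bs N c) 0%N = 0 by rewrite fcoefB e0 bs_0 c0 subr0.
  exists N, (eta - bs N c); split=> //.
  rewrite hE (rmorM (rmor_fmap (rmor_bs _ N))) (rmorM (rmor_feval e1)).
  have -> : fmap (bs N) Q = Fps (fun j => (map_poly (bs N) p)`_j).
    by apply: fpsP => j /=; rewrite coef_map /= pj.
  rewrite (feval_of_poly _ e1); move: he; rewrite /p2 map_comp_poly.
  by rewrite rmorphB /= map_polyX map_polyC /= horner_comp !hornerE => ->; rewrite mulr0.
have [[j0 j0d pj0]|none] := pselect (exists2 j, (j < d)%N & p2`_j != 0); last first.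
  exists 0%N, 0; split=> //.
  have -> : p2 = 'X^d.
    apply/polyP => j; rewrite coefXn; case: (ltngtP j d) => [jd|jd|->].
    - by apply/eqP/contraT => h0; case: none; exists j.
    - by rewrite nth_default // sp2.
    - by move/monicP: p2m; rewrite lead_coefE sp2.
  by rewrite map_polyXn hornerXn expr0n gtn_eqF.
have [|N [P [p3 [P0 p3E [b [m [q [rE rq m0 md]]]]]]]] := newton_step d0 p2m sp2 p2d p2l.
  by exists j0.
(* Recentring at the root [b]: at t = 0 the polynomial becomes X^m times a factor not vanishing at
   0. *)
pose p4 := p3 \Po ('X + (fconst b)%:P).
pose h1 : fps (fps F) := Fps (fun j => p4`_j).
have h1E : map_poly (@cf0 F) p4 = (q \Po ('X + b%:P)) * 'X^m.
  rewrite map_comp_poly rE rmorphD /= map_polyX map_polyC /= comp_polyM.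
  rewrite rmorphXn rmorphB /= comp_polyX comp_polyC.
  by rewrite addrK.
have h1m : yord h1 m.
  have e j : h1 j 0%N = (map_poly (@cf0 F) p4)`_j by rewrite coef_map.
  split; rewrite ?e ?h1E ?coefMXn ?ltnn ?subnn.
    by rewrite -horner_coef0 horner_comp !hornerE.
  by move=> j jm; rewrite e h1E coefMXn jm.
have [N1 [om [om0 hom]]] := IH m md h1 m0 h1m.
exists (N.+1 * N1.+1).-1, (bs N1 (fX P) * (fconst b + om)); split.
  by rewrite fcoefM0 bs_0 fmonoE eq_sym gtn_eqF // mul0r.
have -> : map_poly (bs (N.+1 * N1.+1).-1) p2 = map_poly (bs N1) (map_poly (bs N) p2).
  by apply/polyP => j; rewrite !coef_map /= bs_bs.
have hz : fmap (bs N1) h1 = Fps (fun j => (map_poly (bs N1) p4)`_j).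
  by apply: fpsP => j /=; rewrite coef_map.
rewrite hz (feval_of_poly _ om0) in hom.
move: hom; rewrite map_comp_poly rmorphD /= map_polyX map_polyC /= horner_comp.
rewrite !hornerE bs_fconst => hom.
have := congr1 (map_poly (bs N1)) p3E.
rewrite map_comp_poly !rmorphM /= !map_polyC map_polyX /=.
move/(congr1 (fun p => p.[fconst b + om])); rewrite horner_comp !hornerE /= => ->.
by rewrite [fconst b + om]addrC hom mulr0.
Qed.

(** Roots are split off one at a time. Each one may need a further ramification, so the factor
    already found is pulled back to the composite base change. *)
Lemma puiseux d (h : fps (fps F)) : yord h d ->
  exists N (U : fps (fps F)) (e : nat -> fps F),
  [/\ U 0%N 0%N != 0, forall j, e j 0%N = 0 &
      fmap (bs N) h = U * \prod_(j < d) Yminus (e j)].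
Proof.
elim: d h => [|d IH] h hd.
  exists 0%N, h, (fun=> 0); split=> //; first by case: hd.
  by rewrite big_ord0 mulr1; apply: fpsP => j; rewrite /= bs0.
have [N [eta [e0 he]]] := puiseux_root (ltn0Sn d) hd.
have [h' h'E] := Yminus_dvd e0 he.
have rc0 := @rmor_coef0 F.
have hd' : yord h' d.
  have hj j : h' j 0%N = h j.+1 0%N.
    rewrite -[RHS](bs_0 N) -[bs N _]/(fmap (bs N) h j.+1) h'E.
    by rewrite mulrBl !fcoefB fcoef_XM fcoef_constM fcoefM0 e0 mul0r subr0 subn1.
  by case: hd => h1 h2; split=> [|j jd]; rewrite hj //; apply: h2.
have [N' [U [e [U0 ee hU]]]] := IH h' hd'.
exists (N.+1 * N'.+1).-1, U, (fun j => if j == d then bs N' eta else e j).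
split=> // [j|]; first by case: ifP => // _; rewrite bs_0.
have -> : fmap (bs (N.+1 * N'.+1).-1) h = fmap (bs N') (fmap (bs N) h).
  by apply: fpsP => j /=; rewrite bs_bs.
rewrite h'E (rmorM (rmor_fmap (rmor_bs _ N'))) hU big_ord_recr /= eqxx.
rewrite mulrC mulrA; congr (U * _ * _).
  by apply: eq_bigr => -[j /= jd] _; rewrite ltn_eqF.
rewrite (rmorB (rmor_fmap (rmor_bs _ N'))) (fmap_fX _ (rmor_bs _ N')).
by rewrite fmap_const // rmorph0.
Qed.
End Puiseux.

(** * Codimension of ideals of F[[x, y]] *)

Section Codim.
Variable F : fieldType.
Notation R2 := (fps (fps F)).

Definition kc (c : F) : R2 := fconst (fconst c).
Lemma rmor_kc : rmor kc.
Proof. exact: rmor_comp (@rmor_fconst _) (@rmor_fconst _). Qed.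
Definition lcomb (T : finType) (c : T -> F) (e : T -> R2) : R2 := \sum_t kc (c t) * e t.

Definition subspace (I : set R2) : Prop :=
  [/\ I 0, forall a b, I a -> I b -> I (a - b) & forall c a, I a -> I (kc c * a)].
(** Dimensions of quotients are expressed by families modulo [I], without forming the quotient.
    Arbitrary finite index types allow bases to be assembled along sums and products of types. *)
Definition spans (I : set R2) (T : finType) (e : T -> R2) : Prop :=
  forall h, exists c : T -> F, I (h - lcomb c e).
Definition indep (I : set R2) (T : finType) (e : T -> R2) : Prop :=
  forall c : T -> F, I (lcomb c e) -> forall t, c t = 0.

Lemma lcomb_enum (T : finType) c (e : T -> R2) :
  lcomb (fun i : 'I_#|T| => c (enum_val i)) (fun i => e (enum_val i)) = lcomb c e.
Proof. by rewrite /lcomb [RHS](reindex _ (onW_bij _ (@enum_val_bij T))). Qed.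

Lemma spans_enum I (T : finType) (e : T -> R2) : spans I e ->
  spans I (fun i : 'I_#|T| => e (enum_val i)).
Proof.
by move=> h x; have [c hc] := h x; exists (fun i => c (enum_val i)); rewrite lcomb_enum.
Qed.
Lemma indep_enum I (T : finType) (e : T -> R2) : indep I e ->
  indep I (fun i : 'I_#|T| => e (enum_val i)).
Proof.
move=> h c hc i; have -> : c i = c (enum_rank (enum_val i)) by rewrite enum_valK.
apply: (h (fun t => c (enum_rank t))); rewrite -lcomb_enum.
by congr (I _): hc; apply: eq_bigr => j _; rewrite enum_valK.
Qed.

Section Subspace.
Variable I : set R2.
Hypothesis hI : subspace I.
Lemma subspaceD a b : I a -> I b -> I (a + b).
Proof.
case: hI => h0 hB _ ha hb; rewrite -[b]opprK -[- b]sub0r.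
by apply: (hB) ha _; apply: (hB).
Qed.
Lemma subspace_lcomb (T : finType) (c : T -> F) e : (forall t, I (e t)) -> I (lcomb c e).
Proof.
case: hI => h0 hB hZ he; rewrite /lcomb; elim/big_rec: _ => // t x _ hx.
by apply: subspaceD hx; apply: hZ.
Qed.

(** Steinitz: the coordinates of [e2] modulo [I] form a matrix with more rows than columns, and a
    nonzero vector in its left kernel is a linear relation modulo [I]. *)
Lemma indep_le_spans_ord n m (e1 : 'I_n -> R2) (e2 : 'I_m -> R2) :
  spans I e1 -> indep I e2 -> (m <= n)%N.
Proof.
move=> h1 h2; rewrite leqNgt; apply/negP => nm.
have [c hc] := @boolp.choice _ _ (fun j d => I (e2 j - lcomb d e1)) (fun j => h1 (e2 j)).
pose M : 'M[F]_(m, n) := \matrix_(j, i) c j i.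
have kn0 : kermx M != 0.
  rewrite -mxrank_eq0 mxrank_ker -lt0n subn_gt0.
  by rewrite (leq_ltn_trans (rank_leq_col M)).
have /rowV0Pn[v vk v0] := kn0.
have vM : v *m M = 0 by apply/sub_kermxP.
case/eqP: v0; apply/rowP => j; rewrite mxE.
apply: (h2 (fun j => v 0 j)).
have -> : lcomb (fun j => v 0 j) e2 =
    lcomb (fun j => v 0 j) (fun j => e2 j - lcomb (c j) e1).
  rewrite /lcomb -[LHS]subr0; under [RHS]eq_bigr do rewrite mulrBr.
  rewrite sumrB; congr (_ - _).
  under eq_bigr do rewrite mulr_sumr; rewrite exchange_big /= big1 // => i _.
  have /rowP/(_ i) := vM; rewrite !mxE => /(congr1 kc); rewrite (rmor_sum rmor_kc).
  rewrite (rmor0 rmor_kc) => e.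
  rewrite (eq_bigr (fun j => kc (v 0 j * M j i) * e1 i)) => [|l _]; last first.
    by rewrite mxE (rmorM rmor_kc) mulrA.
  by rewrite -mulr_suml e mul0r.
exact: subspace_lcomb.
Qed.

Lemma indep_le_spans (T1 T2 : finType) (e1 : T1 -> R2) (e2 : T2 -> R2) :
  spans I e1 -> indep I e2 -> (#|T2| <= #|T1|)%N.
Proof. by move=> /spans_enum h1 /indep_enum h2; exact: indep_le_spans_ord h1 h2. Qed.

Lemma basis_card (T1 T2 : finType) (e1 : T1 -> R2) (e2 : T2 -> R2) :
  spans I e1 -> indep I e1 -> spans I e2 -> indep I e2 -> #|T1| = #|T2|.
Proof.
move=> s1 i1 s2 i2; apply/eqP; rewrite eqn_leq.
by rewrite (indep_le_spans s1 i2) (indep_le_spans s2 i1).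
Qed.

(** A maximal independent family spans. This provides a basis modulo an ideal of [F[[x, Y]]] when
    finite codimension is known only after base change. *)
Lemma bounded_indep_codim M :
  (forall m (e : 'I_m -> R2), indep I e -> (m <= M)%N) ->
  exists n, exists2 e : 'I_n -> R2, spans I e & indep I e.
Proof.
move=> hM; pose P n := `[< exists e : 'I_n -> R2, indep I e >].
have P0 : exists n, P n.
  by exists 0%N; apply/asboolP; exists (fun=> 0) => c _ [].
have PM n : P n -> (n <= M)%N by move=> /asboolP[e]; apply: hM.
case: (ex_maxnP P0 PM) => n /asboolP[e he] nmax; exists n, e => // h.
pose e' (o : 'I_n.+1) := if unlift ord0 o is Some i then e i else h.
have : ~ indep I e'.
  by move=> hi; have := nmax n.+1 (introT (asboolP _) (ex_intro _ _ hi)); rewrite ltnn.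
rewrite -existsNE => -[c /not_implyP[hc]]; rewrite -existsNE => -[t /eqP ct].
have lE : lcomb c e' = kc (c ord0) * h + lcomb (fun i => c (lift ord0 i)) e.
  rewrite /lcomb big_ord_recl /e' unlift_none; congr (_ + _).
  by apply: eq_bigr => i _; rewrite liftK.
rewrite lE in hc; have [h0 hB hZ] := hI.
have c0 : c ord0 != 0.
  apply: contraNneq ct => c0; move: hc; rewrite c0 (rmor0 rmor_kc) mul0r add0r.
  move=> /he hc; case: (unliftP ord0 t) => [j|] -> //; last by rewrite c0.
  by rewrite hc.
exists (fun i => - (c ord0)^-1 * c (lift ord0 i)).
have := hZ (c ord0)^-1 _ hc; rewrite mulrDr mulrA -(rmorM rmor_kc) mulVf //.
rewrite (rmor1 rmor_kc) mul1r; congr (I (_ + _)).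
rewrite /lcomb mulr_sumr -sumrN; apply: eq_bigr => i _.
by rewrite mulrA -(rmorM rmor_kc) mulNr (rmorN rmor_kc) mulNr opprK.
Qed.
End Subspace.

Definition ideal2 (G H : R2) : set R2 := [set h | exists a b, h = a * G + b * H]%classic.
Lemma ideal2_subspace G H : subspace (ideal2 G H).
Proof.
split=> [|a b [a1 [b1 ->]] [a2 [b2 ->]]|c a [a1 [b1 ->]]].
- by exists 0, 0; rewrite !mul0r addr0.
- by exists (a1 - a2), (b1 - b2); ring.
- by exists (kc c * a1), (kc c * b1); ring.
Qed.

(* Multiplication by [Y - eta] embeds [R/(G, H)] into [R/((Y - eta) G, H)], with
   cokernel [R/(Y - eta, H)], of dimension the order of [H] along [Y = eta]. *)
Lemma codim_roots (H U : R2) d (eta : nat -> fps F) : U 0%N 0%N != 0 ->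
  (forall j, eta j 0%N = 0) ->
  (forall j, (j < d)%N -> feval H (eta j) != 0) ->
  exists (T : finType) (e : T -> R2),
  [/\ spans (ideal2 (U * \prod_(j < d) Yminus (eta j)) H) e,
      indep (ideal2 (U * \prod_(j < d) Yminus (eta j)) H) e &
      #|T| = (\sum_(j < d) ordf (feval H (eta j)))%N].
Proof.
move=> U0 e0; elim: d => [|d IH] hH.
  exists 'I_0, (fun=> 0); split; last by rewrite card_ord big_ord0.
    move=> h; exists (fun=> 0); exists (h * U^-1), 0.
    rewrite /lcomb !big_ord0 subr0 mul0r addr0 mulr1 divrK //.
    by rewrite fps_unitE fps_unitE unitfE.
  by move=> c _ [].
have [|T [e [hs hi hc]]] := IH; first by move=> j jd; apply: hH; apply: ltnW.
set g := U * _ in hs hi.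
pose Y := Yminus (eta d); pose w := feval H (eta d).
have wn0 : w != 0 by apply: hH.
have ev := rmor_feval (e0 d).
have evY : feval Y (eta d) = 0 by rewrite feval_Yminus // subrr.
have Yn0 : Y != 0.
  have e1 : (eta d + fX 1) 0%N = 0 by rewrite fcoefD e0 fmonoE addr0.
  apply/eqP => Y0; have := feval_Yminus (eta d) e1; rewrite -/Y Y0 (rmor0 (rmor_feval e1)).
  by rewrite addrC addKr => /eqP; rewrite eq_sym (negbTE (fmono_neq0 _ (oner_neq0 _))).
pose o := ordf w.
(* The old basis multiplied by Y - eta, together with lifts 1, x, ..., x^(o-1) of a basis of F[[x]]
   / (w). *)
pose e' (t : T + 'I_o) := match t with inl t => Y * e t | inr a => fconst (fX a) end.
have gE : U * \prod_(j < d.+1) Yminus (eta j) = g * Y by rewrite big_ord_recr mulrA.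
have wE : w = fX o * fdrop o w by apply: fdropP => i; apply: ordf_lt.
have w'u : fdrop o w \is a GRing.unit.
  rewrite fps_unitE unitfE (_ : fdrop o w 0%N = w (o + 0)%N) // addn0.
  exact: ordf_neq0.
have lE c : lcomb c e' = Y * lcomb (fun t => c (inl t)) e
     + fconst (\sum_(a < o) fmono (c (inr a)) a).
  rewrite /lcomb big_sumType /= mulr_sumr (rmor_sum (@rmor_fconst _)).
  congr (_ + _); apply: eq_bigr => i _; first by rewrite mulrCA.
  by rewrite -fconstM fmonoM mulr1.
have sE (c : 'I_o -> F) n : (\sum_(a < o) fmono (c a) a) n =
    if insub n is Some a then c a else 0.
  rewrite fcoef_sum; case: insubP => [a _ na|]; last first.
    rewrite -leqNgt => on; rewrite big1 // => a _.
    by rewrite fmonoE ifN // gtn_eqF // (leq_trans (ltn_ord a)).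
  rewrite (bigD1 a) //= na eqxx big1 ?addr0 // => b ba.
  by rewrite -na ifN // eq_sym.
exists (T + 'I_o)%type, e'; split; last first.
- by rewrite card_sum card_ord hc big_ord_recr.
- move=> c; rewrite gE lE => -[a [b hab]].
  have := congr1 (fun h => feval h (eta d)) hab.
  rewrite !(rmorD ev) !(rmorM ev) evY mul0r add0r feval_const !mulr0 add0r -/w => hev.
  have cr i : c (inr i) = 0.
    have := sE (fun a => c (inr a)) i; rewrite hev wE mulrCA fcoef_XM.
    by rewrite leqNgt ltn_ord valK => <-.
  have s0 : \sum_(a < o) fmono (c (inr a)) a = 0.
    by rewrite big1 // => i _; apply: fpsP => n; rewrite cr fmonoE if_same.
  move: hev; rewrite s0 => /esym/eqP; rewrite mulf_eq0 (negbTE wn0) orbF => /eqP b0.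
  have [b' bE] := Yminus_dvd (e0 d) b0.
  have cl t : c (inl t) = 0.
    apply: (hi (fun t => c (inl t))); exists a, b'; apply: (mulfI Yn0).
    move: hab; rewrite s0 fconst0 addr0 => ->; rewrite bE -/Y; ring.
  by case=> t.
- move=> h; pose z := feval h (eta d); pose c1 (a : 'I_o) := z a.
  pose s := \sum_(a < o) fmono (c1 a) a.
  have zs : z - s = fX o * fdrop o (z - s).
    apply: fdropP => i io; rewrite fcoefB sE insubT /c1 subrr //.
  pose b := (fdrop o w)^-1 * fdrop o (z - s).
  have bw : b * w = z - s.
    by rewrite wE mulrCA /b [_ * fdrop o w]mulrC mulVKr // -zs.
  have [|q hq] := @Yminus_dvd _ (h - fconst s - fconst b * H) (eta d) (e0 d).
    by rewrite !(rmorB ev) (rmorM ev) !feval_const bw subrr.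
  have [c [a1 [b1 hab]]] := hs q.
  exists (fun t => match t with inl t => c t | inr a => c1 a end).
  rewrite lE -/s gE; exists a1, (Y * b1 + fconst b).
  have -> : lcomb (fun t => c t) e = q - (a1 * g + b1 * H) by rewrite -hab subKr.
  have -> : h = Y * q + fconst s + fconst b * H by rewrite -hq; ring.
  ring.
Qed.

(* [R_t = F[[t, Y]]] is free over [R = F[[x, Y]]], [x = t^(N+1)], with basis the
   powers [t^a], [a <= N]; [pr a] is the coordinate of index [a]. *)
Section BaseChangeCodim.
Variable N : nat.
Definition comp_part a (f : fps F) : fps F := Fps (fun n => f (a + n * N.+1)%N).
Definition pr (a : 'I_N.+1) (h : R2) : R2 := fmap (comp_part a) h.
Definition bs2 (h : R2) : R2 := fmap (bs N) h.
Lemma rmor_bs2 : rmor bs2. Proof. exact/rmor_fmap/rmor_bs. Qed.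

Lemma comp_part_coef a f n : comp_part a f n = f (a + n * N.+1)%N.
Proof. by []. Qed.
Lemma comp_part_sum a I r (P : pred I) E :
  comp_part a (\sum_(i <- r | P i) E i) = \sum_(i <- r | P i) comp_part a (E i).
Proof. by elim/big_rec2: _ => [|i x y _ <-]; apply: fpsP. Qed.

Lemma comp_part_basis (a b : 'I_N.+1) u :
  comp_part a (fX b * bs N u) = if a == b then u else 0.
Proof.
apply: fpsP => n; rewrite comp_part_coef fcoef_XM.
case: eqP => [->|/eqP ab].
  by rewrite leq_addr addKn bs_coefM.
case: leqP => // ba; rewrite bs_coef; case: ifP => // h; exfalso.
move/eqP: ab; apply; apply: val_inj => /=.
have : (a + n * N.+1 == b %[mod N.+1])%N by rewrite eqn_mod_dvd.
by rewrite addnC modnMDl !modn_small // => /eqP.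
Qed.

Lemma comp_partE f : f = \sum_(a < N.+1) fX a * bs N (comp_part a f).
Proof.
apply: fpsP => n; rewrite fcoef_sum.
pose a := Ordinal (ltn_pmod n (ltn0Sn N)).
rewrite (bigD1 a) // fcoef_XM leq_mod bs_coef.
have nm : (n - n %% N.+1 = n %/ N.+1 * N.+1)%N by rewrite {1}(divn_eq n N.+1) addnK.
rewrite nm dvdn_mull // mulnK // comp_part_coef addnC -divn_eq.
rewrite big1 /= ?addr0 // => b ba; rewrite -[LHS]/((fX b * bs N (comp_part b f)) n) fcoef_XM; case: leqP => // bn.
rewrite bs_coef; case: ifP => // h; case/eqP: ba; apply: val_inj => /=.
move: h; rewrite -(eqn_mod_dvd _ bn) => /eqP ->.
by rewrite modn_small.
Qed.

Lemma comp_partM (a : 'I_N.+1) g f : comp_part a (bs N g * f) = g * comp_part a f.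
Proof.
rewrite {1}(comp_partE f) mulr_sumr comp_part_sum.
under eq_bigr do rewrite mulrCA -rmorphM comp_part_basis.
rewrite (bigD1 a) //= eqxx big1 ?addr0 // => b ba.
by rewrite eq_sym (negbTE ba).
Qed.

Lemma prD a h k : pr a (h + k) = pr a h + pr a k.
Proof. by apply: fpsP => j; apply: fpsP. Qed.
Lemma pr_sum a I r (P : pred I) E :
  pr a (\sum_(i <- r | P i) E i) = \sum_(i <- r | P i) pr a (E i).
Proof. by elim/big_rec2: _ => [|i x y _ <-]; apply: fpsP => j; apply: fpsP. Qed.
Lemma prM a g h : pr a (bs2 g * h) = g * pr a h.
Proof.
apply: fpsP => n; rewrite fcoefM [LHS]comp_part_sum; apply: eq_bigr => i _.
exact: comp_partM.
Qed.
Lemma pr_basis (a b : 'I_N.+1) h :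
  pr a (fconst (fX b) * bs2 h) = if a == b then h else 0.
Proof.
apply: fpsP => n; rewrite -[LHS]/(comp_part a ((fconst (fX b) * bs2 h) n)) fcoef_constM comp_part_basis.
by case: eqP.
Qed.
Lemma prE h : h = \sum_(a < N.+1) fconst (fX a) * bs2 (pr a h).
Proof.
apply: fpsP => n; rewrite fcoef_sum {1}(comp_partE (h n)).
by apply: eq_bigr => a _; rewrite fcoef_constM.
Qed.
Lemma bs2_kc c : bs2 (kc c) = kc c.
Proof. by rewrite /bs2 /kc fmap_const ?rmorph0 // bs_fconst. Qed.

Definition lift_family (T : finType) (e : T -> R2) (p : 'I_N.+1 * T) : R2 :=
  fconst (fX p.1) * bs2 (e p.2).

Lemma lift_familyE (T : finType) (e : T -> R2) c :
  lcomb c (lift_family e) =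
  \sum_(a < N.+1) fconst (fX a) * bs2 (lcomb (fun t => c (a, t)) e).
Proof.
rewrite /lcomb (eq_bigr (fun p : 'I_N.+1 * T => kc (c (p.1, p.2)) * lift_family e (p.1, p.2))); last by case.
rewrite -(pair_bigA _ (fun a t => kc (c (a, t)) * lift_family e (a, t))) /=.
apply: eq_bigr => a _; rewrite (rmor_sum rmor_bs2) mulr_sumr.
by apply: eq_bigr => t _; rewrite (rmorM rmor_bs2) bs2_kc mulrCA.
Qed.

Lemma indep_lift G H (T : finType) (e : T -> R2) : indep (ideal2 G H) e ->
  indep (ideal2 (bs2 G) (bs2 H)) (lift_family e).
Proof.
move=> he c [A [B hAB]] [a t].
apply: (he (fun t => c (a, t))); exists (pr a A), (pr a B).
have := congr1 (pr a) hAB; rewrite prD mulrC prM [B * _]mulrC prM.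
rewrite lift_familyE pr_sum (bigD1 a) //= pr_basis eqxx big1 ?addr0 => [|b ba].
  by move=> ->; congr (_ + _); rewrite mulrC.
by rewrite pr_basis eq_sym (negbTE ba).
Qed.

Lemma spans_lift G H (T : finType) (e : T -> R2) : spans (ideal2 G H) e ->
  spans (ideal2 (bs2 G) (bs2 H)) (lift_family e).
Proof.
move=> he h.
have [c hc] := @boolp.choice _ _ (fun a d => ideal2 G H (pr a h - lcomb d e)) (fun a => he (pr a h)).
have [A hA] := @boolp.choice _ _ (fun a A => exists B, pr a h - lcomb (c a) e = A * G + B * H) hc.
have [B hB] := boolp.choice hA.
exists (fun p => c p.1 p.2); rewrite lift_familyE {1}(prE h) -sumrB.
exists (\sum_(a < N.+1) fconst (fX a) * bs2 (A a)), (\sum_(a < N.+1) fconst (fX a) * bs2 (B a)).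
rewrite !mulr_suml -big_split; apply: eq_bigr => a _ /=.
rewrite -mulrBr -(rmorB rmor_bs2) (_ : lcomb _ e = lcomb (c a) e) // hB.
rewrite (rmorD rmor_bs2) !(rmorM rmor_bs2); ring.
Qed.
End BaseChangeCodim.

(** [F[[t, Y]]] is free of rank N+1 over [F[[x, Y]]], so codimensions are multiplied by N+1. Lifting
    independent families gives the bound needed for a basis downstairs; lifting that basis then
    gives equality. *)
Lemma codim_base_change (N : nat) G H (T : finType) (e : T -> R2) :
  spans (ideal2 (bs2 N G) (bs2 N H)) e -> indep (ideal2 (bs2 N G) (bs2 N H)) e ->
  exists2 n, (N.+1 * n = #|T|)%N &
    exists2 e' : 'I_n -> R2, spans (ideal2 G H) e' & indep (ideal2 G H) e'.
Proof.
move=> hs hi; have hI := ideal2_subspace (bs2 N G) (bs2 N H).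
have [|n [e' hs' hi']] := @bounded_indep_codim _ (ideal2_subspace G H) #|T|.
  move=> m f hf; have := indep_le_spans hI hs (indep_lift (N := N) hf).
  rewrite card_prod !card_ord; apply: leq_trans; exact: leq_pmull.
exists n; last by exists e'.
have := basis_card hI (spans_lift N hs') (indep_lift (N := N) hi') hs hi.
by rewrite card_prod !card_ord.
Qed.

End Codim.

Section CodimFormula.
Variable F : closedFieldType.
Notation R2 := (fps (fps F)).

Lemma has_codim_uniq (f : R2) n m :
  has_codim (jacobian_ideal f) n -> has_codim (jacobian_ideal f) m -> n = m.
Proof.
move=> [e1 [s1 i1]] [e2 [s2 i2]].
have hI := ideal2_subspace (deriv_x f) (deriv_y f).
by have := basis_card hI s1 i1 s2 i2; rewrite !card_ord.
Qed.

Lemma has_codim_roots (f : R2) N d (U : R2) (eta : nat -> fps F) :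
  U 0%N 0%N != 0 -> (forall j, eta j 0%N = 0) ->
  fmap (bs N) (deriv_y f) = U * \prod_(j < d) Yminus (eta j) ->
  (forall j, (j < d)%N -> feval (fmap (bs N) (deriv_x f)) (eta j) != 0) ->
  exists2 n, (N.+1 * n = \sum_(j < d) ordf (feval (fmap (bs N) (deriv_x f)) (eta j)))%N &
    has_codim (jacobian_ideal f) n.
Proof.
move=> U0 e0 hU hne.
have [T [e [hs hi hc]]] := codim_roots U0 e0 hne.
rewrite -hU in hs hi; have [n hn [e' hs' hi']] := codim_base_change hs hi.
exists n; first by rewrite hn.
have sw h : ideal2 (deriv_y f) (deriv_x f) h <-> jacobian_ideal f h.
  by split=> -[a [b ->]]; exists b, a; rewrite addrC.
exists e'; split=> [h|c hc'].
  by have [c hc'] := hs' h; exists c; apply/sw.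
by apply: hi'; apply/sw.
Qed.
End CodimFormula.

Lemma fcoefMn (V : zmodType) (f : fps V) m n : (f *+ m) n = f n *+ m.
Proof. by elim: m => // m IH; rewrite !mulrS fcoefD IH. Qed.

Lemma fmap_fderiv (R : comPzRingType) (phi : fps R -> fps R) (f : fps (fps R)) :
  rmor phi -> fmap phi (fderiv f) = fderiv (fmap phi f).
Proof.
move=> h; apply: fpsP => n; rewrite /=.
elim: {2 4}n.+1 => [|m IH]; first by rewrite !mulr0n (rmor0 h).
by rewrite !mulrS (rmorD h) IH.
Qed.

Lemma fderiv_bs (R : comNzRingType) N (c : fps R) :
  fderiv (bs N c) = fmono N.+1%:R N * bs N (fderiv c).
Proof.
apply: fpsP => n; rewrite fcoef_monoM -[LHS]/(bs N c n.+1 *+ n.+1) !bs_coef.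
case: leqP => nN; last by rewrite ifF ?mul0rn // gtnNdvd.
have e : n.+1 = (n - N + N.+1)%N by lia.
rewrite e dvdn_addl ?dvdnn //; case: ifP => [/dvdnP[m ->]|_]; last by rewrite mul0rn mulr0.
rewrite mulnK // -mulSnr mulnK // -[fderiv c m]/(c m.+1 *+ m.+1).
by rewrite mulr_natl -mulrnA.
Qed.

Lemma bs_feval (R : comNzRingType) N (h : fps (fps R)) (w : fps R) : w 0%N = 0 ->
  bs N (feval h w) = feval (fmap (bs N) h) (bs N w).
Proof. by move=> w0; apply: fcomp_feval. Qed.

(** * The Milnor number of a branch *)

Section Conjugates.
Variable F : closedFieldType.
Hypothesis char0 : forall n, n.+1%:R != 0 :> F.
Notation R2 := (fps (fps F)).
Variables (K : nat) (z : F).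
Hypothesis prim_z : K.+1.-primitive_root z.

Definition sc (a : F) (f : fps F) : fps F := fcomp f (fmono a 1).
Lemma rmor_sc a : rmor (sc a). Proof. exact: rmor_fcomp. Qed.
Lemma sc_coef a f n : sc a f n = a ^+ n * f n.
Proof. exact: fcomp_scale_coef. Qed.
Lemma sc_sc a b f : sc a (sc b f) = sc (a * b) f.
Proof. by apply: fpsP => n; rewrite !sc_coef mulrA exprMn. Qed.
Lemma sc1 f : sc 1 f = f.
Proof. by apply: fpsP => n; rewrite sc_coef expr1n mul1r. Qed.
Lemma sc_neq0 a f : a != 0 -> f != 0 -> sc a f != 0.
Proof.
move=> a0; apply: contra_neq => h; rewrite -[f]sc1 -(mulVf a0) -sc_sc h.
exact: rmor0 (rmor_sc _).
Qed.
Lemma ordf_sc a f : a != 0 -> ordf (sc a f) = ordf f.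
Proof.
move=> a0; have [->|f0] := eqVneq f 0; first by rewrite (rmor0 (rmor_sc a)).
apply: ford_ordf; split; first by rewrite sc_coef mulf_neq0 ?expf_neq0 ?ordf_neq0.
by move=> i /ordf_lt h; rewrite sc_coef h mulr0.
Qed.

Lemma z_neq0 : z != 0.
Proof.
apply/eqP => z0; have := prim_expr_order prim_z; rewrite z0 expr0n => /eqP.
by rewrite eq_sym oner_eq0.
Qed.

Definition cjg (y : fps F) i : fps F := sc (z ^+ i) y.
(** For distinct conjugates, the minimal polynomial of y over F((x)), x = s^(K+1), written over
    [F[[s]]]. *)
Definition galois_prod (y : fps F) : R2 := \prod_(i < K.+1) Yminus (cjg y i).
Definition distinct_conj (y : fps F) : Prop := forall i, (i < K)%N -> cjg y i.+1 != y.
(** The value of mu + k - 1 for k = K+1. It is meaningful only under [distinct_conj]: a vanishing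
    difference would count as 0 instead of infinity. *)
Definition diff_ord (y : fps F) : nat := (\sum_(i < K) ordf (y - cjg y i.+1)%R)%N.

Lemma cjg_0 (y : fps F) i : y 0%N = 0 -> cjg y i 0%N = 0.
Proof. by move=> y0; rewrite /cjg sc_coef y0 mulr0. Qed.
Lemma cjg0 y : cjg y 0 = y. Proof. by rewrite /cjg expr0 sc1. Qed.
Lemma sc_bs i f : sc (z ^+ i) (bs K f) = bs K f.
Proof.
apply: fpsP => n; rewrite sc_coef bs_coef; case: ifP => [/dvdnP[m ->]|_]; last by rewrite mulr0.
have -> : (z ^+ i) ^+ (m * K.+1) = 1.
  by rewrite -exprM mulnA mulnC exprM (prim_expr_order prim_z) expr1n.
by rewrite mul1r.
Qed.

Lemma sc_fmap_bs i (h : R2) : fmap (sc (z ^+ i)) (fmap (bs K) h) = fmap (bs K) h.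
Proof. by apply: fpsP => j; exact: sc_bs. Qed.
Lemma sc_feval a (h : R2) (w : fps F) : w 0%N = 0 ->
  sc a (feval h w) = feval (fmap (sc a) h) (sc a w).
Proof. by move=> w0; apply: fcomp_feval. Qed.

Lemma fmap_Yminus (phi : fps F -> fps F) (y : fps F) :
  rmor phi -> fmap phi (Yminus y) = Yminus (phi y).
Proof.
move=> h; rewrite (rmorB (rmor_fmap h)) (fmap_fX _ h) fmap_const //.
exact: rmor0 h.
Qed.

Lemma galois_prod_inv y : fmap (sc z) (galois_prod y) = galois_prod y.
Proof.
rewrite /galois_prod (rmor_prod (rmor_fmap (rmor_sc z))) [LHS]big_ord_recr [RHS]big_ord_recl /=.
rewrite mulrC; congr (_ * _).
  rewrite fmap_Yminus; last exact: rmor_sc.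
  by rewrite /cjg sc_sc -exprS (prim_expr_order prim_z) expr0.
by apply: eq_bigr => i _; rewrite fmap_Yminus /cjg ?sc_sc -?exprS //; exact: rmor_sc.
Qed.

(** The substitution s -> z s permutes the factors cyclically, so only powers of s with exponent
    divisible by K+1 survive. *)
Lemma galois_prod_descent y : exists P, fmap (bs K) P = galois_prod y.
Proof.
exists (Fps (fun n => Fps (fun m => galois_prod y n (m * K.+1)%N))).
apply: fpsP => n; apply: fpsP => j; rewrite [fmap _ _ _]/= bs_coef.
case: ifP => [/dvdnP[m ->]|h]; first by rewrite mulnK.
have := congr1 (fun f : R2 => f n j) (galois_prod_inv y).
rewrite [LHS]sc_coef => /eqP; rewrite -subr_eq0 -[X in _ - X]mul1r -mulrBl mulf_eq0 subr_eq0.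
by rewrite -(prim_order_dvd prim_z) h => /eqP.
Qed.

Lemma coef0_galois_prod (y : fps F) (U : R2) j : y 0%N = 0 ->
  (U * galois_prod y) j 0%N = if (K.+1 <= j)%N then U (j - K.+1)%N 0%N else 0.
Proof.
move=> y0; have h := rmor_fmap (@rmor_coef0 F).
rewrite -[LHS]/(fmap (fun f : fps F => f 0%N) (U * galois_prod y) j).
rewrite (rmorM h) (rmor_prod h) (eq_bigr (fun=> fX 1)) => [|i _]; last first.
  rewrite (rmorB h) fmap_const // fmap_fX; last exact: rmor_coef0.
  by rewrite cjg_0 // fconst0 subr0.
by rewrite prodr_const card_ord fXX mul1n mulrC fcoef_XM.
Qed.

Section Teissier.
Variables (y : fps F) (f U : R2).
Hypotheses (y0 : y 0%N = 0) (hd : distinct_conj y).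
Hypotheses (fE : fmap (bs K) f = U * galois_prod y) (U0 : U 0%N 0%N != 0).

Let W := feval (fmap (bs K) (deriv_y f)) y.

(** By the Leibniz rule, the only term that survives at Y = y is the one where the factor Y - y is
    differentiated. *)
Lemma polar_eval : W != 0 /\ ordf W = diff_ord y.
Proof.
have ev := rmor_feval y0.
have fderivY (w : fps F) : fderiv (Yminus w) = 1.
  apply: fpsP => n; rewrite -[LHS]/((fX 1 n.+1 - fconst w n.+1) *+ n.+1) fcoef1 !fmonoE subr0.
  by rewrite eqSS; case: n => [|n] //=; rewrite mul0rn.
have gE : galois_prod y = Yminus y * \prod_(i < K) Yminus (cjg y i.+1).
  by rewrite /galois_prod big_ord_recl cjg0.
have WE : W = feval U y * \prod_(i < K) (y - cjg y i.+1).
  rewrite /W /deriv_y (fmap_fderiv _ (rmor_bs _ K)) fE gE !fderivM fderivY mul1r.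
  have : feval (Yminus y) y = 0 by rewrite feval_Yminus // subrr.
  move: (Yminus y) => Q evQ.
  rewrite !(rmorD ev, rmorM ev) evQ !mul0r mulr0 add0r addr0.
  rewrite (rmor_prod ev); congr (_ * _); apply: eq_bigr => i _.
  by rewrite feval_Yminus.
have hne (i : 'I_K) : y - cjg y i.+1 != 0 by rewrite subr_eq0 eq_sym; apply: hd.
have U0' : (feval U y) 0%N != 0 by rewrite feval_0.
have Une : feval U y != 0.
  by apply: contraNneq U0' => ->.
have pne : \prod_(i < K) (y - cjg y i.+1) != 0 by apply/prodf_neq0 => i _; apply: hne.
by rewrite WE mulf_neq0 // ordfM // ordf_prod // ordf_unit.
Qed.

(** Let f have roots y_i and f_y roots eta_j over a common ramification x = t^(N+1). The orders of
    y_i - eta_j, summed over all pairs, are counted by f_y at the y_i, giving (N+1) [diff_ord y],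
    and by f at the eta_j. By the chain rule ord f(eta_j) = ord f_x(eta_j) + N + 1, and the orders
    of f_x(eta_j) sum to N+1 times the codimension. *)
Lemma teissier : exists2 n, (n + K)%N = diff_ord y & has_codim (jacobian_ideal f) n.
Proof.
have [Wn0 Word] := polar_eval.
have coef_f j : f j 0%N = if (K.+1 <= j)%N then U (j - K.+1)%N 0%N else 0.
  by rewrite -(coef0_galois_prod U j y0) -fE [RHS]bs_0.
(* At x = 0, f is a unit times Y^(K+1); in characteristic zero its derivative has order K. *)
have hy : yord (deriv_y f) K.
  have e j : deriv_y f j 0%N = f j.+1 0%N *+ j.+1.
    exact: fcoefMn.
  split; first by rewrite e coef_f ltnS leqnn subnn -mulr_natr mulf_neq0.
  by move=> j jK; rewrite e coef_f ltnS leqNgt jK mul0rn.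
have [N0 [V [eta [V0 eta0 hV]]]] := puiseux char0 hy.
(* The branch needs x = s^(K+1) and the polar roots x = u^(N0+1); both live over x = t^(N+1) with
   N+1 = (N0+1)(K+1), through s = t^(N0+1) and u = t^(K+1). *)
pose N := (N0.+1 * K.+1).-1.
have NS : N.+1 = (N0.+1 * K.+1)%N by rewrite prednK // muln_gt0.
pose yt i := bs N0 (cjg y i); pose et j := bs K (eta j).
have et0 j : et j 0%N = 0 by rewrite /et bs_0.
have yt0 i : yt i 0%N = 0 by rewrite /yt bs_0 cjg_0.
have bsNl g : fmap (bs N) g = fmap (bs K) (fmap (bs N0) g).
  by apply: fpsP => j /=; rewrite bs_bs.
have bsNr g : fmap (bs N) g = fmap (bs N0) (fmap (bs K) g).
  by apply: fpsP => j /=; rewrite bs_bs /N mulnC.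
pose V' := fmap (bs K) V; pose U' := fmap (bs N0) U.
have V'0 : V' 0%N 0%N != 0 by rewrite [V' _ _]bs_0.
have U'0 : U' 0%N 0%N != 0 by rewrite [U' _ _]bs_0.
have fyE : fmap (bs N) (deriv_y f) = V' * \prod_(j < K) Yminus (et j).
  rewrite bsNl hV; have h := rmor_fmap (rmor_bs F K).
  rewrite (rmorM h) (rmor_prod h); congr (_ * _); apply: eq_bigr => j _.
  exact/fmap_Yminus/rmor_bs.
have fE' : fmap (bs N) f = U' * \prod_(i < K.+1) Yminus (yt i).
  rewrite bsNr fE; have h := rmor_fmap (rmor_bs F N0).
  rewrite (rmorM h) (rmor_prod h); congr (_ * _); apply: eq_bigr => j _.
  exact/fmap_Yminus/rmor_bs.
have unit_eval (g : R2) (v : fps F) : v 0%N = 0 -> g 0%N 0%N != 0 ->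
    feval g v != 0 /\ ordf (feval g v) = 0%N.
  move=> v0 g0; have g0' : (feval g v) 0%N != 0 by rewrite feval_0.
  by split; [apply: contraNneq g0' => ->|exact: ordf_unit].
have fy_yt i : feval (fmap (bs N) (deriv_y f)) (yt i) != 0 /\
    ordf (feval (fmap (bs N) (deriv_y f)) (yt i)) = (N0.+1 * diff_ord y)%N.
  have zi0 : z ^+ i != 0 by rewrite expf_neq0 // z_neq0.
  have -> : feval (fmap (bs N) (deriv_y f)) (yt i) = bs N0 (sc (z ^+ i) W).
    rewrite /W sc_feval // bs_feval; last exact: cjg_0.
    by rewrite bsNr sc_fmap_bs.
  by rewrite bs_neq0 ?sc_neq0 // ordf_bs ?sc_neq0 // ordf_sc // Word.
have yt_et i j : (j < K)%N -> yt i - et j != 0.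
  move=> jK; have [+ _] := fy_yt i; have ev := rmor_feval (yt0 i).
  rewrite fyE (rmorM ev) (rmor_prod ev) mulf_eq0 negb_or => /andP[_ /prodf_neq0].
  by move=> /(_ (Ordinal jK) isT); rewrite feval_Yminus.
have sum_yt i : (\sum_(j < K) ordf (yt i - et j)%R)%N = (N0.+1 * diff_ord y)%N.
  have [_ <-] := fy_yt i; have ev := rmor_feval (yt0 i).
  have [v1 v2] := unit_eval _ _ (yt0 i) V'0.
  rewrite fyE (rmorM ev) (rmor_prod ev).
  have pn (j : 'I_K) : feval (Yminus (et j)) (yt i) != 0 by rewrite feval_Yminus // yt_et.
  have pN : \prod_(j < K) feval (Yminus (et j)) (yt i) != 0.
    by apply/prodf_neq0 => j _; apply: pn.
  rewrite (ordfM v1 pN) v2 (ordf_prod _ pn).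
  by rewrite add0n; apply: eq_bigr => j _; rewrite feval_Yminus.
pose b j := feval (fmap (bs N) f) (et j).
have b_ord j : (j < K)%N -> b j != 0 /\ ordf (b j) = (\sum_(i < K.+1) ordf (yt i - et j)%R)%N.
  move=> jK; have ev := rmor_feval (et0 j).
  have [v1 v2] := unit_eval _ _ (et0 j) U'0.
  have pn (i : 'I_K.+1) : feval (Yminus (yt i)) (et j) != 0.
    by rewrite feval_Yminus // -opprB oppr_eq0 yt_et.
  have pN : \prod_(i < K.+1) feval (Yminus (yt i)) (et j) != 0.
    by apply/prodf_neq0 => i _; apply: pn.
  rewrite /b fE' (rmorM ev) (rmor_prod ev) (mulf_neq0 v1 pN); split=> //.
  rewrite (ordfM v1 pN) v2 (ordf_prod _ pn) add0n; apply: eq_bigr => i _.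
  by rewrite feval_Yminus // -opprB ordfN.
pose fx j := feval (fmap (bs N) (deriv_x f)) (et j).
have fx_ord j : (j < K)%N -> fx j != 0 /\ (ordf (fx j) + N.+1 = ordf (b j))%N.
  move=> jK; have [bn0 _] := b_ord j jK.
  (* The term with f_y drops out at its root eta_j, and dx/dt = (N+1) t^N. *)
  have db : fderiv (b j) = fmono N.+1%:R N * fx j.
    have ev := rmor_feval (et0 j).
    rewrite /b fderiv_feval // -(fmap_fderiv _ (rmor_bs F N)) fyE.
    rewrite (rmorM ev) (rmor_prod ev) (bigD1 (Ordinal jK)) //= feval_Yminus // subrr.
    rewrite mul0r mulr0 mul0r addr0.
    have -> : fmap (@fderiv F) (fmap (bs N) f) =
        fconst (fmono N.+1%:R N) * fmap (bs N) (deriv_x f).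
      by apply: fpsP => i; rewrite fcoef_constM [LHS]fderiv_bs.
    by rewrite (rmorM ev) feval_const.
  case ob : (ordf (b j)) => [|p].
    have := ordf_neq0 bn0; rewrite ob /b feval_0 [fmap _ _ _]/= bs_0 coef_f.
    by rewrite eqxx.
  have /fordE[] := ford_fderiv char0 (iffRL (fordE _ p.+1) (conj bn0 ob)).
  rewrite db mulf_eq0 negb_or => /andP[mn0 fxn0].
  rewrite ordfM // ordf_mono ?char0 // => <-; split=> //.
  by rewrite addnS addnC.
have [n hn hc] := has_codim_roots V'0 et0 fyE (fun j jK => (fx_ord j jK).1).
exists n => //; apply/eqP; rewrite -(eqn_pmul2l (ltn0Sn N)) mulnDr hn; apply/eqP.
transitivity (\sum_(j < K) ordf (b j))%N.
  rewrite [RHS](eq_bigr (fun j : 'I_K => (ordf (fx j) + N.+1)%N)).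
    by rewrite big_split /= sum_nat_const card_ord [(K * _)%N]mulnC.
  by move=> j _; rewrite (fx_ord j (ltn_ord j)).2.
rewrite (eq_bigr (fun j : 'I_K => (\sum_(i < K.+1) ordf (yt i - et j)%R)%N)); last first.
  by move=> j _; rewrite (b_ord j (ltn_ord j)).2.
rewrite exchange_big /= (eq_bigr (fun=> (N0.+1 * diff_ord y)%N)) => [|i _]; last exact: sum_yt.
by rewrite sum_nat_const card_ord NS mulnA [(K.+1 * _)%N]mulnC.
Qed.
End Teissier.
End Conjugates.

(** * Reparametrisation and exchange of coordinates *)

Section Subst.
Variable F : closedFieldType.
Notation R2 := (fps (fps F)).

Lemma plane_arcP (g h : plane_arc F) : arcx g = arcx h -> arcy g = arcy h -> g = h.
Proof.
case: g h => [x y x0 y0] [x' y' x0' y0'] /= ex ey; subst x' y'.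
by rewrite (eq_irrelevance x0 x0') (eq_irrelevance y0 y0').
Qed.

Lemma fcomp_wide (R : comPzRingType) (f u : fps R) a n : u 0%N = 0 -> (a <= n)%N ->
  fcomp f u a = \sum_(i < n.+1) f i * (u ^+ i) a.
Proof.
move=> u0 an; rewrite [LHS]/= (big_ord_widen n.+1 (fun i => f i * (u ^+ i) a)) ?ltnS //.
rewrite big_mkcond; apply: eq_bigr => i _; case: ltnP => // ai.
by rewrite (fcoef_lt_expr u0) // mulr0.
Qed.

Lemma fsubstE (f : fps2 F) (g : plane_arc F) :
  fsubst f g = feval (fmap (@fcomp F ^~ (arcx g)) f) (arcy g).
Proof.
apply: fpsP => n; rewrite fevalE -[LHS]/(\sum_(i < n.+1) \sum_(j < n.+1)
  f j i * (arcx g ^+ i * arcy g ^+ j) n) exchange_big; apply: eq_bigr => j _.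
under eq_bigr do rewrite fcoefM mulr_sumr.
rewrite exchange_big fcoefM; apply: eq_bigr => a _.
rewrite (@fcomp_wide _ _ _ _ n (arcx0 g)); last by rewrite -ltnS.
by rewrite mulr_suml; apply: eq_bigr => i _; rewrite mulrA.
Qed.

Section ArcComp.
Variables (g : plane_arc F) (v : fps F).
Hypothesis v0 : v 0%N = 0.
Fact arc_comp_x0 : fcomp (arcx g) v 0%N = 0. Proof. by rewrite fcomp_0 arcx0. Qed.
Fact arc_comp_y0 : fcomp (arcy g) v 0%N = 0. Proof. by rewrite fcomp_0 arcy0. Qed.
Definition arc_comp := PlaneArc arc_comp_x0 arc_comp_y0.

Lemma fsubst_comp (f : fps2 F) : fsubst f arc_comp = fcomp (fsubst f g) v.
Proof.
rewrite !fsubstE fcomp_feval ?arcy0 //; congr feval.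
by apply: fpsP => j; rewrite /= fcompA ?arcx0.
Qed.
End ArcComp.

(** An invertible reparametrisation leaves the kernel of [fsubst] unchanged, so the same equation
    serves, and a factorisation of the new arc gives one of the old arc. *)
Lemma milnor_comp_imp (g : plane_arc F) (u v : fps F) n : u 0%N = 0 -> v 0%N = 0 ->
  fcomp u v = fX 1 -> fcomp v u = fX 1 -> milnor g n -> milnor (arc_comp g v) n.
Proof.
move=> u0 v0 uv vu [gp [f fr fc]]; have back h : fcomp (fcomp h v) u = h by rewrite fcompA // vu fcomp_id.
split.
  move=> [h [w [w0 w1 hx hy]]]; apply: gp; exists h, (fcomp w u); split.
  - by rewrite fcomp_0.
  - by rewrite /= !big_ord_recl big_ord0 w0 w1 !mul0r !addr0.
  - by rewrite -fcompA // -hx /= back.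
  - by rewrite -fcompA // -hy /= back.
exists f => // h; rewrite -fr (fsubst_comp g v0); split=> [e|->]; last exact: rmor0 (rmor_fcomp v0).
by rewrite -[fsubst h g]back e (rmor0 (rmor_fcomp u0)).
Qed.

Lemma milnor_comp (g : plane_arc F) (v : fps F) n : v 0%N = 0 ->
  v 1%N != 0 -> milnor (arc_comp g v) n <-> milnor g n.
Proof.
move=> v0 v1; have [u [u0 u1 vu uv]] := comp_inverse v0 v1; split; last by apply: (@milnor_comp_imp _ u).
rewrite {2}(_ : g = arc_comp (arc_comp g v) u); last first.
  by apply: plane_arcP; rewrite /= fcompA // vu fcomp_id.
by apply: (@milnor_comp_imp _ v).
Qed.

Definition swap_arc (g : plane_arc F) := PlaneArc (arcy0 g) (arcx0 g).
Lemma swap_arcK : involutive swap_arc. Proof. by move=> g; apply: plane_arcP. Qed.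

Lemma fsubst_swap (f : fps2 F) (g : plane_arc F) : fsubst (swap f) (swap_arc g) = fsubst f g.
Proof.
apply: fpsP => n; rewrite -[LHS]/(\sum_(i < n.+1) \sum_(j < n.+1)
  f i j * (arcy g ^+ i * arcx g ^+ j) n) exchange_big; apply: eq_bigr => j _.
by apply: eq_bigr => i _; rewrite [arcy g ^+ _ * _]mulrC.
Qed.

Lemma milnor_swap_imp (g : plane_arc F) n : milnor g n -> milnor (swap_arc g) n.
Proof.
move=> [gp [f fr [e [es ei]]]]; have sM := rmorM (rmor_swap F).
split; first by move=> [h [u [u0 u1 hx hy]]]; apply: gp; exists (swap_arc h), u.
exists (swap f).
  move=> h; rewrite -[h]swapK fsubst_swap fr; split=> -[q hq]; exists (swap q).
    by rewrite hq sM.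
  by apply: (inv_inj (@swapK F)); rewrite hq sM swapK.
have dx : deriv_x (swap f) = swap (deriv_y f).
  by apply: fpsP => i; apply: fpsP => j; rewrite /= fcoefMn.
have dy : deriv_y (swap f) = swap (deriv_x f).
  by apply: fpsP => i; apply: fpsP => j; rewrite /= fcoefMn.
have jac h : jacobian_ideal f h -> jacobian_ideal (swap f) (swap h).
  move=> [a [b ->]]; exists (swap b), (swap a).
  by rewrite dx dy (rmorD (rmor_swap F)) !sM addrC.
have jac' h : jacobian_ideal (swap f) (swap h) -> jacobian_ideal f h.
  move=> [a [b hab]]; exists (swap b), (swap a); apply: (inv_inj (@swapK F)).
  by rewrite hab dx dy (rmorD (rmor_swap F)) !sM !swapK addrC.
have sl (c : 'I_n -> F) : \sum_i fconst (fconst (c i)) * swap (e i) =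
    swap (\sum_i fconst (fconst (c i)) * e i).
  rewrite (rmor_sum (rmor_swap F)); apply: eq_bigr => i _; rewrite sM swap_const.
  by rewrite fmap_const // fconst0.
exists (fun i => swap (e i)); split=> [h|c hc].
  have [c hc] := es (swap h); exists c; rewrite sl.
  by have := jac _ hc; rewrite (rmorB (rmor_swap F)) swapK.
by apply: ei; apply: jac'; rewrite -sl.
Qed.

Lemma milnor_swap (g : plane_arc F) n : milnor (swap_arc g) n <-> milnor g n.
Proof. by split=> /milnor_swap_imp; rewrite ?swap_arcK. Qed.
End Subst.

(** * Primitive arcs with x = s^k and their equations *)

Section Primitive.
Variable F : closedFieldType.
Hypothesis char0 : forall n, n.+1%:R != 0 :> F.
Notation R2 := (fps (fps F)).
Variables (K : nat) (z : F).
Hypothesis prim_z : K.+1.-primitive_root z.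

(** If y is fixed by s -> z^(i+1) s, all exponents in y are divisible by the order [r] of z^(i+1).
    Since [r] divides K+1 and r > 1, the arc factors through s^r. *)
Lemma primitive_distinct (g : plane_arc F) :
  arcx g = fX K.+1 -> primitive g -> distinct_conj K z (arcy g).
Proof.
move=> gx gp i iK; apply/eqP => hc; apply: gp.
pose d := gcdn i.+1 K.+1; pose r := (K.+1 %/ d)%N.
have dK : (d %| K.+1)%N by rewrite dvdn_gcdr.
have d0 : (0 < d)%N by rewrite gcdn_gt0.
have rd : (r * d = K.+1)%N by rewrite divnK.
have r1 : (1 < r)%N.
  rewrite ltn_divRL // mul1n; apply: leq_ltn_trans (dvdn_leq _ (dvdn_gcdl _ _)) _ => //.
have hr n : arcy g n != 0 -> (r %| n)%N.
  move=> yn; have /(congr1 (fun f : fps F => f n)) := hc.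
  rewrite /cjg sc_coef => /eqP; rewrite -subr_eq0 -[X in _ - X]mul1r -mulrBl mulf_eq0.
  rewrite (negbTE yn) orbF subr_eq0 -exprM -(prim_order_dvd prim_z).
  rewrite -{1}rd -[in X in (_ %| X)%N](divnK (dvdn_gcdl i.+1 K.+1 : d %| i.+1)%N).
  rewrite mulnAC dvdn_pmul2r // Gauss_dvdr //.
  rewrite /coprime -(eqn_pmul2r d0) muln_gcdl rd divnK ?mul1n ?dvdn_gcdl //.
  by rewrite gcdnC.
have rS : r.-1.+1 = r by rewrite prednK // ltnW.
have gy : arcy g = bs r.-1 (Fps (fun n => arcy g (n * r)%N)).
  apply: fpsP => n; rewrite bs_coef rS; case: ifP => [/dvdnP[m ->]|/negP rn].
    by rewrite /= mulnK // ltnW.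
  by apply/eqP; apply: contraT => /hr /rn.
have x0 : (fX d : fps F) 0%N = 0 by rewrite fmonoE ltn_eqF.
have y0 : (Fps (fun n => arcy g (n * r)%N)) 0%N = 0 :> F by rewrite /= arcy0.
exists (PlaneArc x0 y0), (fX r); split.
- by rewrite fmonoE ltn_eqF // ltnW.
- by rewrite fmonoE ltn_eqF.
- by rewrite gx /= fcomp_fX ?fXX ?rd // fmonoE ltn_eqF // ltnW.
- by rewrite {1}gy /bs rS.
Qed.

(** In A^l - B^l = (A - B) (...) the second factor has constant term l A(0)^(l-1), which is nonzero
    in characteristic zero. *)
Lemma eq_of_expr_eq (A B : fps F) l : (0 < l)%N -> A 0%N != 0 -> A 0%N = B 0%N ->
  A ^+ l = B ^+ l -> A = B.
Proof.
case: l => // l _ A0 AB; move/eqP; rewrite -subr_eq0 subrXX mulf_eq0 subr_eq0.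
case/orP=> [/eqP //|/eqP/(congr1 (fun f : fps F => f 0%N))].
rewrite fcoef_sum fcoef0 (eq_bigr (fun=> A 0%N ^+ l)) => [|i _]; last first.
  by rewrite fcoefM0 !fcoefX0 -AB -exprD subnK // -ltnS.
rewrite sumr_const card_ord -mulr_natr => /eqP.
by rewrite mulf_eq0 expf_eq0 (negbTE A0) andbF (negbTE (char0 _)).
Qed.

Lemma fps_root_normal (a : fps F) l : ford a l -> (0 < l)%N ->
  exists e : fps F, e 0%N != 0 /\ a = (fX 1 * e) ^+ l.
Proof.
move=> [al alt] l0; have aE := fdropP alt.
have [|e he] := @fps_kth_root _ char0 l (fdrop l a) l0; first by rewrite /= addn0.
exists e; split; last by rewrite exprMn -fX1X he.
have : (e ^+ l) 0%N != 0 by rewrite he /= addn0.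
by rewrite fcoefX0 expf_eq0 l0.
Qed.

Lemma comp_root_expand (e u : fps F) : u 0%N = 0 ->
  fcomp (fX 1 * e) u = u * fcomp e u.
Proof. by move=> u0; rewrite (rmorM (rmor_fcomp u0)) fcomp_X1. Qed.

(* If the arc factors through [u] of order [r > 1], then [s -> z^l s], with
   [l = k / r], fixes [u] because [u] is determined by its leading coefficient and
   by [a(u) = s^k]. *)
Lemma distinct_primitive (g : plane_arc F) :
  arcx g = fX K.+1 -> distinct_conj K z (arcy g) -> primitive g.
Proof.
move=> gx hd [h [u [u0 u1 hx hy]]].
set a := arcx h in hx; have a0 : a 0%N = 0 := arcx0 h.
have fXn0 : (fX K.+1 : fps F) != 0 by apply: fmono_neq0; exact: oner_neq0.
rewrite gx in hx.
have un0 : u != 0.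
  apply: contraNneq fXn0 => u'; rewrite hx u' fcompE feval_zero /= a0.
  by rewrite fconst0.
have an0 : a != 0 by apply: contraNneq fXn0 => a'; rewrite hx a' (rmor0 (rmor_fcomp u0)).
pose l := ordf a; pose r := ordf u.
have l0 : (0 < l)%N.
  by rewrite lt0n; apply/eqP => l0; have := ordf_neq0 an0; rewrite -/l l0 a0 eqxx.
have r1 : (1 < r)%N.
  by apply: ordf_ge => // -[|[|//]] _.
have [e [e0 aE]] := fps_root_normal (ordfP an0) l0; rewrite -/l in aE.
(* [w] is an l-th root of [a] and invertible for composition, so [u] is determined by w(u), which is
   an l-th root of s^(K+1). *)
pose w := fX 1 * e.
have w0 : w 0%N = 0 by rewrite /w fcoef_XM.
have w1 : w 1%N != 0 by rewrite /w fcoef_XM subnn.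
have [v [v0 v1 wv vw]] := comp_inverse w0 w1.
have AE : fcomp w u ^+ l = fX K.+1 by rewrite hx aE (rmorX (rmor_fcomp u0)).
have An0 : fcomp w u != 0.
  by apply: contraNneq fXn0 => A0; rewrite -AE A0 expr0n gtn_eqF.
have ue0 : (fcomp e u) 0%N != 0 by rewrite fcomp_0.
have Aord : ordf (fcomp w u) = r.
  rewrite /w comp_root_expand // ordfM // ?(ordf_unit ue0) ?addn0 //.
  by apply: contraNneq ue0 => ->.
have lr : (l * r = K.+1)%N by rewrite -Aord -ordfX // AE ordf_mono // oner_neq0.
have zl0 : z ^+ l != 0 by rewrite expf_neq0 // (z_neq0 prim_z).
pose u2 := sc (z ^+ l) u.
have u20 : u2 0%N = 0 by rewrite sc_coef u0 mulr0.
have BE : fcomp w u2 ^+ l = fX K.+1.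
  have -> : fcomp w u2 = sc (z ^+ l) (fcomp w u) by rewrite /sc fcompA // fmonoE.
  rewrite -(rmorX (rmor_sc _)) AE; apply: fpsP => n; rewrite sc_coef fmonoE.
  case: eqP => [->|]; last by rewrite mulr0.
  by rewrite -exprM mulnC exprM (prim_expr_order prim_z) expr1n mul1r.
have lowA : forall i, (i < r)%N -> fcomp w u i = 0 by move=> i ir; apply: ordf_lt; rewrite Aord.
have BA : fcomp w u2 = sc (z ^+ l) (fcomp w u) by rewrite /sc fcompA // fmonoE.
have lowB : forall i, (i < r)%N -> fcomp w u2 i = 0.
  by move=> i ir; rewrite BA sc_coef lowA // mulr0.
have AB : fcomp w u = fcomp w u2.
  rewrite (fdropP lowA) (fdropP lowB); congr (_ * _).
  apply: (@eq_of_expr_eq _ _ l) => //.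
  - have := ordf_neq0 An0; rewrite Aord => h0.
    by rewrite -[fdrop _ _ _]/(fcomp w u (r + 0)%N) addn0.
  - rewrite -[LHS]/(fcomp w u (r + 0)%N) -[RHS]/(fcomp w u2 (r + 0)%N) addn0.
    by rewrite BA sc_coef -exprM lr (prim_expr_order prim_z) mul1r.
  have fXl : (fX (l * r) : fps F) != 0 by apply: fmono_neq0; exact: oner_neq0.
  apply: (mulfI fXl); rewrite mulnC -fXX -!exprMn -(fdropP lowA) -(fdropP lowB).
  by rewrite AE BE.
have uu : u = u2.
  have back (t : fps F) : t 0%N = 0 -> fcomp v (fcomp w t) = t.
    by move=> t0; rewrite -fcompA // vw fcomp_X1.
  by rewrite -[u]back // AB back.
have lK : (l.-1 < K)%N by have := r1; move: lr l0; case: (l) => // l' ; nia.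
have := hd _ lK; rewrite prednK //; case/eqP.
rewrite hy /cjg /sc fcompA // ?fmonoE //; congr fcomp; exact: esym uu.
Qed.

Section Monomial.
Variable g : plane_arc F.
Hypothesis gx : arcx g = fX K.+1.
Notation y := (arcy g).

Lemma fsubst_mono (f : R2) : fsubst f g = feval (fmap (bs K) f) y.
Proof. by rewrite fsubstE gx. Qed.

(** Rotating back by z^i turns a coincidence of two conjugates into one of [y] with its conjugate of
    index j - i. *)
Lemma cjg_inj i j : distinct_conj K z y -> (i < j <= K)%N -> cjg z y i != cjg z y j.
Proof.
move=> hd /andP[ij jK]; apply/eqP => e.
have [m mE] : exists m, j = (i + m.+1)%N by exists (j - i).-1; lia.
have mK : (m < K)%N by lia.
have := hd m mK; rewrite -subr_eq0; apply/negP; rewrite negbK.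
have zi : z ^+ i != 0 by rewrite expf_neq0 // (z_neq0 prim_z).
apply: contraT => h; have := sc_neq0 zi h; rewrite (rmorB (rmor_sc _)) /cjg sc_sc -exprD -mE.
by rewrite -/(cjg z y j) -e subrr eqxx.
Qed.

Lemma galois_prod_neq0 : galois_prod K z y != 0.
Proof.
apply/prodf_neq0 => i _; apply/eqP => /(congr1 (fun f : R2 => f 1%N 0%N)).
by rewrite fcoefB !fmonoE /= subr0 => /eqP; rewrite oner_eq0.
Qed.

(** h(s^k, Y) is invariant under s -> z^i s, so with y all its conjugates are roots; as these are
    distinct, their product divides h(s^k, Y). *)
Lemma kernel_galois (h P : R2) : distinct_conj K z y -> fmap (bs K) P = galois_prod K z y ->
  fsubst h g = 0 <-> exists q, h = q * P.
Proof.
move=> hd hP; have y0 := arcy0 g; rewrite fsubst_mono; split=> [h0|[q ->]]; last first.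
  rewrite (rmorM (rmor_fmap (rmor_bs F K))) hP (rmorM (rmor_feval y0)).
  rewrite /galois_prod big_ord_recl (rmorM (rmor_feval y0)) cjg0 feval_Yminus //.
  by rewrite subrr mul0r mulr0.
have hi i : feval (fmap (bs K) h) (cjg z y i) = 0.
  have := sc_feval (z ^+ i) (fmap (bs K) h) y0; rewrite h0 (rmor0 (rmor_sc _)).
  by rewrite (sc_fmap_bs prim_z).
have gen m : (m <= K.+1)%N -> exists q, fmap (bs K) h = q * \prod_(i < m) Yminus (cjg z y i).
  elim: m => [|m IH] mK; first by exists (fmap (bs K) h); rewrite big_ord0 mulr1.
  have [q hq] := IH (ltnW mK).
  have c0 := cjg_0 z m y0; have ev := rmor_feval c0.
  have := hi m; rewrite hq (rmorM ev) (rmor_prod ev) => /eqP; rewrite mulf_eq0.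
  case/orP=> [/eqP qm|/eqP pm]; last first.
    have : \prod_(i < m) feval (Yminus (cjg z y i)) (cjg z y m) != 0.
      apply/prodf_neq0 => -[i im] _ /=; rewrite feval_Yminus // subr_eq0 eq_sym.
      by apply: cjg_inj => //; rewrite im -ltnS.
    by rewrite pm eqxx.
  have [q' ->] := Yminus_dvd c0 qm; exists q'.
  by rewrite big_ord_recr /= [Yminus _ * q']mulrC -!mulrA [Yminus _ * _]mulrC.
have [q hq] := gen _ (leqnn _); rewrite -/(galois_prod K z y) in hq.
(* The quotient lies only over [F[[s, Y]]]. Its coordinate of index 0, which is linear over
   [F[[x, Y]]], is a quotient in [F[[x, Y]]]. *)
exists (pr (ord0 : 'I_K.+1) q); have := congr1 (pr (ord0 : 'I_K.+1)) hq.
rewrite -hP [q * _]mulrC prM mulrC => <-; symmetry.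
have := pr_basis (ord0 : 'I_K.+1) ord0 h.
by rewrite eqxx fX0 mul1r.
Qed.

(** Any reduced equation generates the same ideal as the descended Galois product [P], hence equals
    a unit times [P], and this unit is the factor U of [teissier]. Conversely [P] itself is a
    reduced equation. *)
Lemma milnor_monomial n :
  milnor g n <-> distinct_conj K z y /\ (n + K)%N = diff_ord K z y.
Proof.
have y0 := arcy0 g; have [P hP] := galois_prod_descent prim_z y.
split=> [[gp [f fr fc]]|[hd hn]].
  have hd := primitive_distinct gx gp; split=> //.
  have [a fa] : exists a, f = a * P by apply/(kernel_galois f hd hP)/fr; exists 1; rewrite mul1r.
  have [b Pb] : exists b, P = b * f by apply/fr/(kernel_galois P hd hP); exists 1; rewrite mul1r.
  have Pn0 : P != 0.
    apply: contraNneq galois_prod_neq0 => P0; rewrite -hP P0.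
    exact/eqP/(rmor0 (rmor_fmap (rmor_bs F K))).
  have ab : b * a = 1.
    by apply: (mulIf Pn0); rewrite mul1r -mulrA -fa -Pb.
  have a0 : a 0%N 0%N != 0.
    apply/eqP => a0; have := congr1 (fun f : R2 => f 0%N 0%N) ab.
    by rewrite !fcoefM0 a0 mulr0 /= => /eqP; rewrite eq_sym oner_eq0.
  have [||n' hn' hc'] := @teissier F char0 K z prim_z y f (fmap (bs K) a) y0 hd.
  - by rewrite fa (rmorM (rmor_fmap (rmor_bs F K))) hP.
  - by rewrite -[fmap _ _ _]/(bs K (a 0%N)) bs_0.
  by rewrite (has_codim_uniq fc hc').
split; first exact: distinct_primitive.
exists P; first by move=> h; apply: kernel_galois.
have [||n' hn' hc'] := @teissier F char0 K z prim_z y P 1 y0 hd.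
- by rewrite mul1r.
- by rewrite /= oner_neq0.
by have -> : n = n' by apply/eqP; rewrite -(eqn_add2r K) hn hn'.
Qed.
End Monomial.
End Primitive.

(** * The Milnor number under shears and blow-ups *)

Section MilnorRules.
Variable F : closedFieldType.
Hypothesis char0 : forall n, n.+1%:R != 0 :> F.

Lemma ford_fdrop (x : fps F) k : ford x k -> x = fX k * fdrop k x /\ fdrop k x 0%N != 0.
Proof. by move=> [xk xlt]; split; [exact: fdropP|rewrite /= addn0]. Qed.

Lemma normalize_param (x : fps F) K : ford x K.+1 ->
  exists v : fps F, [/\ v 0%N = 0, v 1%N != 0 & fcomp x v = fX K.+1].
Proof.
move=> hx; have [e [e0 xE]] := fps_root_normal char0 hx (ltn0Sn K).
pose u := fX 1 * e.
have u0 : u 0%N = 0 by rewrite /u fcoef_XM.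
have u1 : u 1%N != 0 by rewrite /u fcoef_XM subnn.
have [v [v0 v1 uv _]] := comp_inverse u0 u1.
by exists v; split=> //; rewrite xE (rmorX (rmor_fcomp v0)) uv fXX mul1n.
Qed.

Fact shear_subproof (c : F) (g : plane_arc F) : (arcy g + fconst c * arcx g) 0%N = 0.
Proof. by rewrite fcoefD fcoef_constM arcx0 arcy0 mulr0 addr0. Qed.
Definition shear_arc c g := PlaneArc (arcx0 g) (shear_subproof c g).
Fact blow_subproof (g : plane_arc F) : (arcx g * arcy g) 0%N = 0.
Proof. by rewrite fcoefM0 arcx0 mul0r. Qed.
Definition blow_arc g := PlaneArc (arcx0 g) (blow_subproof g).

Lemma ford_arcx (g : plane_arc F) k : ford (arcx g) k -> exists K, k = K.+1.
Proof. by case: k => [[]|k _]; [rewrite arcx0 eqxx|exists k]. Qed.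

(** The reparametrisation and the root of unity depend on x only, so one choice serves all arcs with
    the same x. A shear and a blow-up keep x, which makes their Milnor numbers comparable. *)
Lemma milnor_formula (g : plane_arc F) K : ford (arcx g) K.+1 ->
  exists (v : fps F) z, [/\ K.+1.-primitive_root z, v 0%N = 0, fcomp (arcx g) v = fX K.+1 &
   forall h n, arcx h = arcx g -> milnor h n <->
    distinct_conj K z (fcomp (arcy h) v) /\ (n + K)%N = diff_ord K z (fcomp (arcy h) v)].
Proof.
move=> hx; have [v [v0 v1 xv]] := normalize_param hx.
have [z hz] := exists_prim_root char0 (ltn0Sn K).
exists v, z; split=> // h n hg.
rewrite -(milnor_comp h n v0 v1).
by rewrite (milnor_monomial char0 hz (g := arc_comp h v)) //= hg.
Qed.

Lemma milnor_smooth (g : plane_arc F) n : ford (arcx g) 1 -> milnor g n <-> n = 0%N.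
Proof.
move=> /milnor_formula[v [z [_ _ _ h]]]; rewrite (h g n erefl) /diff_ord big_ord0 addn0.
by split=> [[]|->].
Qed.

(** After normalisation the shear adds c s^k, which is fixed by conjugation, so all differences y -
    y_i are unchanged. *)
Lemma milnor_shear c (g : plane_arc F) k n : ford (arcx g) k ->
  milnor (shear_arc c g) n <-> milnor g n.
Proof.
move=> hx; have [K kK] := ford_arcx hx; rewrite kK in hx.
have [v [z [hz v0 xv h]]] := milnor_formula hx.
rewrite (h g n erefl) (h (shear_arc c g) n erefl) /=.
set y := fcomp (arcy g) v.
have -> : fcomp (arcy g + fconst c * arcx g) v = y + fconst c * fX K.+1.
  by rewrite (rmorD (rmor_fcomp v0)) (rmorM (rmor_fcomp v0)) fcomp_const xv.
have cE i : cjg z (y + fconst c * fX K.+1) i = cjg z y i + fconst c * fX K.+1.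
  rewrite /cjg (rmorD (rmor_sc _)) (rmorM (rmor_sc _)) /sc fcomp_const fcomp_fX ?fmonoE //.
  rewrite fmonoX mul1n -exprM mulnC exprM (prim_expr_order hz) expr1n.
  by [].
have dE i : y + fconst c * fX K.+1 - cjg z (y + fconst c * fX K.+1) i = y - cjg z y i.
  by rewrite cE; ring.
have -> : distinct_conj K z (y + fconst c * fX K.+1) <-> distinct_conj K z y.
  by split=> hd i /hd; rewrite cE (inj_eq (addIr _)).
by rewrite /diff_ord; under eq_bigr do rewrite dE.
Qed.

(** After normalisation y is multiplied by s^k, which is fixed by conjugation; hence each of the k -
    1 differences gains order k. *)
Lemma milnor_blowup (g : plane_arc F) k n : ford (arcx g) k ->
  milnor (blow_arc g) n <-> exists2 n', n = (n' + k * (k - 1))%N & milnor g n'.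
Proof.
move=> hx; have [K kK] := ford_arcx hx; rewrite kK in hx *.
have [v [z [hz v0 xv h]]] := milnor_formula hx.
rewrite (h (blow_arc g) n erefl) /=.
set y := fcomp (arcy g) v.
have -> : fcomp (arcx g * arcy g) v = fX K.+1 * y by rewrite (rmorM (rmor_fcomp v0)) xv.
have cE i : cjg z (fX K.+1 * y) i = fX K.+1 * cjg z y i.
  rewrite /cjg (rmorM (rmor_sc _)) /sc fcomp_fX ?fmonoE //.
  by rewrite fmonoX mul1n -exprM mulnC exprM (prim_expr_order hz) expr1n.
have Xn0 : (fX K.+1 : fps F) != 0 by apply: fmono_neq0; exact: oner_neq0.
have dd : distinct_conj K z (fX K.+1 * y) <-> distinct_conj K z y.
  by split=> hd i /hd; rewrite cE (inj_eq (mulfI Xn0)).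
have oE : distinct_conj K z y ->
    diff_ord K z (fX K.+1 * y) = (diff_ord K z y + K.+1 * (K.+1 - 1))%N.
  move=> hd; rewrite /diff_ord (eq_bigr (fun i : 'I_K => (ordf (y - cjg z y i.+1)%R + K.+1)%N)).
    by rewrite big_split /= sum_nat_const card_ord subn1 mulnC.
  move=> i _; rewrite cE -mulrBr ordfM ?Xn0 ?ordf_mono ?oner_neq0 ?[(K.+1 + _)%N]addnC //.
  by rewrite subr_eq0 eq_sym; apply: hd.
rewrite dd; split=> [[hd]|[n' ->]].
  rewrite oE // subn1 => e; have le : (K.+1 * K <= n)%N.
    (* Each of the K differences has positive order since y(0) = 0; this makes the subtraction of k
       (k - 1) from [n] legitimate. *)
    have hK : (K <= diff_ord K z y)%N.
      rewrite /diff_ord -[X in (X <= _)%N]card_ord -sum1_card; apply: leq_sum => i _.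
      apply: ordf_ge; first by rewrite subr_eq0 eq_sym; apply: hd.
      case=> // _; rewrite fcoefB cjg_0 ?subr0 /y ?fcomp_0 ?arcy0 //.
    by lia.
  exists (n - K.+1 * K)%N; first by rewrite /= subnK.
  rewrite (h g _ erefl); split=> //; rewrite -/y; lia.
rewrite (h g _ erefl) -/y => -[hd hn]; split=> //; rewrite oE // -hn; lia.
Qed.
End MilnorRules.

(** * Constructible sets and their classes *)

Local Open Scope classical_set_scope.

Section PolyFun.
Variable F : closedFieldType.

(** Given by closure rules, so that coefficients of products and sums of jets are recognised as
    polynomial without exhibiting polynomials. *)
Inductive polyfun N : ('rV[F]_N -> F) -> Prop :=
| polyfun_const c : polyfun (fun=> c)
| polyfun_coord i : polyfun (fun v => v ord0 i)
| polyfunD f g : polyfun f -> polyfun g -> polyfun (fun v => f v + g v)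
| polyfunM f g : polyfun f -> polyfun g -> polyfun (fun v => f v * g v).

Lemma polyfun_ext N (f g : 'rV[F]_N -> F) : polyfun f -> f =1 g -> polyfun g.
Proof. by move=> hf /funext <-. Qed.
Lemma polyfunX N (f : 'rV[F]_N -> F) n : polyfun f -> polyfun (fun v => f v ^+ n).
Proof.
move=> hf; elim: n => [|n IH]; first exact: polyfun_const.
by apply: polyfun_ext (polyfunM hf IH) _ => v; rewrite exprS.
Qed.
Lemma polyfun_sum N I (r : seq I) (P : pred I) (f : I -> 'rV[F]_N -> F) :
  (forall i, P i -> polyfun (f i)) -> polyfun (fun v => \sum_(i <- r | P i) f i v).
Proof.
move=> h; elim: r => [|i r IH].
  by apply: polyfun_ext (polyfun_const _ 0) _ => v; rewrite big_nil.
case Pi: (P i); last by apply: polyfun_ext IH _ => v; rewrite big_cons Pi.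
by apply: polyfun_ext (polyfunD (h i Pi) IH) _ => v; rewrite big_cons Pi.
Qed.
Lemma polyfun_prod N I (r : seq I) (f : I -> 'rV[F]_N -> F) :
  (forall i, polyfun (f i)) -> polyfun (fun v => \prod_(i <- r) f i v).
Proof.
move=> h; elim: r => [|i r IH].
  by apply: polyfun_ext (polyfun_const _ 1) _ => v; rewrite big_nil.
by apply: polyfun_ext (polyfunM (h i) IH) _ => v; rewrite big_cons.
Qed.
Lemma polyfun_peval N M (p : {mpoly F[M]}) (phi : 'rV[F]_N -> 'rV[F]_M) :
  (forall j, polyfun (fun v => phi v ord0 j)) -> polyfun (fun v => peval p (phi v)).
Proof.
move=> h; apply: polyfun_ext; last by move=> v; rewrite /peval mevalE.
apply: polyfun_sum => m _; apply: polyfunM; first exact: polyfun_const.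
by apply: polyfun_prod => i; apply: polyfunX.
Qed.

Definition hpoly n d (h : 'rV[F]_n -> F) : Prop :=
  exists2 p : {mpoly F[n]}, p \is (@ishomog1 n F d mdeg) & forall v, h v = peval p v.

Lemma hpoly_ext n d (f g : 'rV[F]_n -> F) : hpoly d f -> f =1 g -> hpoly d g.
Proof. by move=> hf /funext <-. Qed.
Lemma hpoly_one n : hpoly 0 (fun _ : 'rV[F]_n => 1).
Proof. by exists 1; [exact: dhomog1|move=> v; rewrite /peval meval1]. Qed.
Lemma hpoly_coord n (i : 'I_n) : hpoly 1 (fun v => v ord0 i).
Proof.
exists 'X_i; first by rewrite dhomogX; apply/eqP/mdeg1.
by move=> v; rewrite /peval mevalXU.
Qed.
Lemma hpoly_zero n d : hpoly d (fun _ : 'rV[F]_n => 0).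
Proof. by exists 0; [exact: dhomog0|move=> v; rewrite /peval meval0]. Qed.
Lemma hpolyD n d (f g : 'rV[F]_n -> F) : hpoly d f -> hpoly d g -> hpoly d (fun v => f v + g v).
Proof.
move=> [p hp fp] [q hq gq]; exists (p + q); first exact: dhomogD.
by move=> v; rewrite fp gq /peval mevalD.
Qed.
Lemma hpolyM n d e (f g : 'rV[F]_n -> F) :
  hpoly d f -> hpoly e g -> hpoly (d + e) (fun v => f v * g v).
Proof.
move=> [p hp fp] [q hq gq]; exists (p * q); first exact: dhomogM.
by move=> v; rewrite fp gq /peval mevalM.
Qed.
Lemma hpolyZ n d c (f : 'rV[F]_n -> F) : hpoly d f -> hpoly d (fun v => c * f v).
Proof.
move=> [p hp fp]; exists (c *: p); first exact: dhomogZ.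
by move=> v; rewrite fp /peval mevalZ.
Qed.
Lemma hpoly_const n c : hpoly 0 (fun _ : 'rV[F]_n => c).
Proof. by apply: hpoly_ext (hpolyZ c (hpoly_one n)) _ => v; rewrite mulr1. Qed.
Lemma hpolyX n d k (f : 'rV[F]_n -> F) : hpoly d f -> hpoly (d * k) (fun v => f v ^+ k).
Proof.
move=> hf; elim: k => [|k IH]; first by rewrite muln0; exact: hpoly_one.
by rewrite mulnS; apply: hpoly_ext (hpolyM hf IH) _ => v; rewrite exprS.
Qed.
Lemma hpolyN n d (f : 'rV[F]_n -> F) : hpoly d f -> hpoly d (fun v => - f v).
Proof. by move=> hf; apply: hpoly_ext (hpolyZ (-1) hf) _ => v; rewrite mulN1r. Qed.
Lemma hpolyB n d (f g : 'rV[F]_n -> F) : hpoly d f -> hpoly d g -> hpoly d (fun v => f v - g v).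
Proof. by move=> hf hg; apply: hpolyD hf (hpolyN hg). Qed.
Lemma hpoly_sum n d (I : eqType) (r : seq I) (f : I -> 'rV[F]_n -> F) :
  (forall i, i \in r -> hpoly d (f i)) -> hpoly d (fun v => \sum_(i <- r) f i v).
Proof.
elim: r => [|i r IH] h.
  by apply: hpoly_ext (hpoly_zero n d) _ => v; rewrite big_nil.
apply: (@hpoly_ext _ _ (fun v => f i v + \sum_(j <- r) f j v)) => [|v]; last by rewrite big_cons.
apply: hpolyD; first by apply: h; rewrite mem_head.
by apply: IH => j jr; apply: h; rewrite in_cons jr orbT.
Qed.
Lemma hpoly_prod n I (r : seq I) (e : I -> nat) (f : I -> 'rV[F]_n -> F) :
  (forall i, hpoly (e i) (f i)) -> hpoly (\sum_(i <- r) e i)%N (fun v => \prod_(i <- r) f i v).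
Proof.
move=> h; elim: r => [|i r IH].
  by rewrite big_nil; apply: hpoly_ext (hpoly_one n) _ => v; rewrite big_nil.
by rewrite big_cons; apply: hpoly_ext (hpolyM (h i) IH) _ => v; rewrite big_cons.
Qed.
Lemma hpoly_comp n m d D (p : {mpoly F[m]}) (phi : 'rV[F]_n -> 'rV[F]_m) :
  p \is (@ishomog1 m F d mdeg) -> (forall j, hpoly D (fun v => phi v ord0 j)) ->
  hpoly (D * d) (fun v => peval p (phi v)).
Proof.
move=> hp hphi; apply: (@hpoly_ext _ _ (fun v =>
    \sum_(a <- msupp p) p@_a * \prod_i phi v ord0 i ^+ a i)) => [|v]; last first.
  by rewrite /peval mevalE.
apply: hpoly_sum => a ap; apply: hpolyZ.
have e : mdeg a = d := dhomog_mf hp ap; rewrite -e mdegE big_distrr /=.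
by apply: hpoly_prod => i; apply: hpolyX.
Qed.
Lemma hpoly_scale n d (h : 'rV[F]_n -> F) c v : hpoly d h -> h (c *: v) = c ^+ d * h v.
Proof.
move=> [p hp hE]; rewrite !hE /peval !mevalE mulr_sumr !big_seq; apply: eq_bigr => a ap.
have e : mdeg a = d := dhomog_mf hp ap; rewrite mulrCA; congr (_ * _); rewrite -e mdegE.
rewrite -prodrXr -big_split /=; apply: eq_bigr => i _.
by rewrite mxE exprMn.
Qed.

Definition v0 N (v : 'rV[F]_(1 + N)) : F := v ord0 (lshift N ord0).
Definition rest N (v : 'rV[F]_(1 + N)) : 'rV[F]_N := (v0 v)^-1 *: rsubmx v.

Lemma homogenize N (f : 'rV[F]_N -> F) : polyfun f ->
  exists d (h : 'rV[F]_(1 + N) -> F), hpoly d h /\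
    forall v, v0 v != 0 -> h v = v0 v ^+ d * f (rest v).
Proof.
have hv0 : hpoly 1 (@v0 N) by apply: hpoly_coord.
elim=> [c|i|f1 f2 _ [d1 [h1 [hh1 e1]]] _ [d2 [h2 [hh2 e2]]]
          |f1 f2 _ [d1 [h1 [hh1 e1]]] _ [d2 [h2 [hh2 e2]]]].
- exists 0%N, (fun=> c); split; first exact: hpoly_const.
  by move=> v _; rewrite mul1r.
- exists 1%N, (fun v => v ord0 (rshift 1 i)); split; first exact: hpoly_coord.
  by move=> v vn0; rewrite expr1 !mxE mulrA mulfV // mul1r.
- exists (d1 + d2)%N, (fun v => v0 v ^+ d2 * h1 v + v0 v ^+ d1 * h2 v); split.
    apply: hpolyD; last by have := hpolyM (hpolyX d1 hv0) hh2; rewrite mul1n.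
    by have := hpolyM (hpolyX d2 hv0) hh1; rewrite mul1n [(d2 + d1)%N]addnC.
  by move=> v vn0; rewrite e1 // e2 // exprD; ring.
- exists (d1 + d2)%N, (fun v => h1 v * h2 v); split; first exact: hpolyM.
  by move=> v vn0; rewrite e1 // e2 // exprD; ring.
Qed.

(** Regular functions on the principal open set q != 0. One fixed denominator, up to powers, keeps
    the class closed under sums and products. *)
Definition fracfun N (q f : 'rV[F]_N -> F) : Prop :=
  exists P e, polyfun P /\ forall v, q v != 0 -> f v = P v / q v ^+ e.

Section Frac.
Variables (N : nat) (q : 'rV[F]_N -> F).
Hypothesis hq : polyfun q.
Lemma fracfun_poly f : polyfun f -> fracfun q f.
Proof. by move=> hf; exists f, 0%N; split=> // v _; rewrite expr0 divr1. Qed.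
Lemma fracfunD f g : fracfun q f -> fracfun q g -> fracfun q (fun v => f v + g v).
Proof.
move=> [P [d [hP fP]]] [Q [e [hQ gQ]]].
exists (fun v => P v * q v ^+ e + Q v * q v ^+ d), (d + e)%N; split.
  by apply: polyfunD; apply: polyfunM => //; apply: polyfunX.
move=> v qv; rewrite fP // gQ // exprD.
have h1 : q v ^+ d != 0 by rewrite expf_neq0.
have h2 : q v ^+ e != 0 by rewrite expf_neq0.
by field; rewrite h1 h2.
Qed.
Lemma fracfunM f g : fracfun q f -> fracfun q g -> fracfun q (fun v => f v * g v).
Proof.
move=> [P [d [hP fP]]] [Q [e [hQ gQ]]].
exists (fun v => P v * Q v), (d + e)%N; split; first exact: polyfunM.
move=> v qv; rewrite fP // gQ // exprD.
have h1 : q v ^+ d != 0 by rewrite expf_neq0.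
have h2 : q v ^+ e != 0 by rewrite expf_neq0.
by field; rewrite h1 h2.
Qed.
Lemma fracfunV f : fracfun q f -> fracfun q (fun v => f v / q v).
Proof.
move=> [P [d [hP fP]]]; exists P, d.+1; split=> // v qv.
have h1 : q v ^+ d != 0 by rewrite expf_neq0.
by rewrite fP // exprS; field; rewrite h1 qv.
Qed.
Lemma fracfun_ext f g : fracfun q f -> (forall v, q v != 0 -> f v = g v) -> fracfun q g.
Proof.
by move=> [P [d [hP fP]]] fg; exists P, d; split=> // v qv; rewrite -fg // fP.
Qed.
Lemma fracfunN f : fracfun q f -> fracfun q (fun v => - f v).
Proof.
move=> hf; apply: fracfun_ext (fracfunM (fracfun_poly (polyfun_const _ (-1))) hf) _ => v _.
by rewrite mulN1r.
Qed.
Lemma fracfun_sum I (r : seq I) (P : pred I) (f : I -> 'rV[F]_N -> F) :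
  (forall i, P i -> fracfun q (f i)) -> fracfun q (fun v => \sum_(i <- r | P i) f i v).
Proof.
move=> h; elim: r => [|i r IH].
  apply: fracfun_ext (fracfun_poly (polyfun_const _ 0)) _ => v _; by rewrite big_nil.
case Pi: (P i); last by apply: fracfun_ext IH _ => v _; rewrite big_cons Pi.
by apply: fracfun_ext (fracfunD (h i Pi) IH) _ => v _; rewrite big_cons Pi.
Qed.
Lemma fracfun_comp M (f : 'rV[F]_M -> F) (phi : 'rV[F]_N -> 'rV[F]_M) :
  polyfun f -> (forall j, fracfun q (fun v => phi v ord0 j)) -> fracfun q (fun v => f (phi v)).
Proof.
move=> hf hphi; elim: hf => [c|i|f1 f2 _ h1 _ h2|f1 f2 _ h1 _ h2].
- exact/fracfun_poly/polyfun_const.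
- exact: hphi.
- exact: fracfunD h1 h2.
- exact: fracfunM h1 h2.
Qed.
End Frac.

(** The Boolean algebra generated by zero sets. It coincides with [constructible], but is closed
    under Boolean operations and preimages by design. *)
Inductive definable N : set 'rV[F]_N -> Prop :=
| definable_zero f : polyfun f -> definable [set v | f v = 0]
| definableC A : definable A -> definable (~` A)
| definableI A B : definable A -> definable B -> definable (A `&` B).

Lemma definableU N (A B : set 'rV[F]_N) : definable A -> definable B -> definable (A `|` B).
Proof.
move=> hA hB; rewrite -[_ `|` _]setCK setCU.
by apply: definableC; apply: definableI; apply: definableC.
Qed.
Lemma definableT N : definable [set: 'rV[F]_N].
Proof.
have -> : [set: 'rV[F]_N] = [set v | (fun=> 0) v = 0 :> F] by apply/seteqP; split.
exact/definable_zero/polyfun_const.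
Qed.
Lemma definable0 N : definable (set0 : set 'rV[F]_N).
Proof. by rewrite -setCT; apply/definableC/definableT. Qed.
Lemma definable_ne N (f : 'rV[F]_N -> F) : polyfun f -> definable [set v | f v != 0].
Proof.
move=> hf; have -> : [set v | f v != 0] = ~` [set v | f v = 0].
  by apply/seteqP; split=> v /= /eqP.
exact/definableC/definable_zero.
Qed.
Lemma definableD N (A B : set 'rV[F]_N) : definable A -> definable B -> definable (A `\` B).
Proof. by move=> hA hB; apply: definableI hA (definableC hB). Qed.
Lemma definable_bigI N (I : eqType) (r : seq I) (A : I -> set 'rV[F]_N) :
  (forall i, definable (A i)) -> definable [set v | forall i, i \in r -> A i v].
Proof.
move=> h; elim: r => [|i r IH].
  rewrite (_ : [set v | _] = setT); first exact: definableT.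
  by apply/seteqP; split.
rewrite (_ : [set v | _] = A i `&` [set v | forall i, i \in r -> A i v]).
  exact: definableI.
apply/seteqP; split=> v /=.
  by move=> hv; split=> [|j jr]; apply: hv; rewrite in_cons ?eqxx // jr orbT.
by move=> [h1 h2] j; rewrite in_cons => /orP[/eqP->|/h2].
Qed.
Lemma definable_bigU N (I : finType) (A : I -> set 'rV[F]_N) :
  (forall i, definable (A i)) -> definable [set v | exists i, A i v].
Proof.
move=> h; rewrite (_ : [set v | _] = ~` [set v | forall i, i \in enum I -> (~` A i) v]).
  by apply/definableC/definable_bigI => i; apply/definableC.
apply/seteqP; split=> v /=; first by move=> [i Ai] /(_ i); rewrite mem_enum; exact.
by apply: contra_notP => hv i _ Ai; apply: hv; exists i.
Qed.

Lemma definable_frac_preim N M (q : 'rV[F]_N -> F) (phi : 'rV[F]_N -> 'rV[F]_M) B :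
  polyfun q -> (forall j, fracfun q (fun v => phi v ord0 j)) -> definable B ->
  definable [set v | q v != 0 /\ B (phi v)].
Proof.
move=> hq hphi; elim=> [f hf|A _ hA|A1 A2 _ h1 _ h2].
- have [P [e [hP fP]]] := fracfun_comp hq hf hphi.
  rewrite (_ : [set v | _] = [set v | q v != 0] `&` [set v | P v = 0]).
    by apply: definableI; [exact: definable_ne|exact: definable_zero].
  apply/seteqP; split=> v /= [qv]; rewrite fP // => h; split=> //.
    move/eqP: h; rewrite mulf_eq0 invr_eq0 expf_eq0 (negbTE qv) andbF orbF => /eqP //.
  by rewrite h mul0r.
- rewrite (_ : [set v | _] = [set v | q v != 0] `\` [set v | q v != 0 /\ A (phi v)]).
    by apply: definableD => //; exact: definable_ne.
  apply/seteqP; split=> v /= [qv h]; split=> //; first by case.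
  by move=> hA'; apply: h.
- rewrite (_ : [set v | _] = [set v | q v != 0 /\ A1 (phi v)] `&`
      [set v | q v != 0 /\ A2 (phi v)]); first exact: definableI.
  by apply/seteqP; split=> v /=; [move=> [? []]|move=> [[? ?] []]].
Qed.
Lemma definable_preim N M (phi : 'rV[F]_N -> 'rV[F]_M) B :
  (forall j, polyfun (fun v => phi v ord0 j)) -> definable B ->
  definable [set v | B (phi v)].
Proof.
move=> hphi hB; rewrite (_ : [set v | _] = [set v | (fun=> 1) v != 0 :> F /\ B (phi v)]).
  apply: definable_frac_preim hB; first exact: polyfun_const.
  by move=> j; apply: fracfun_poly.
by apply/seteqP; split=> v /=; [move=> h; split=> //; exact: oner_neq0|case].
Qed.
End PolyFun.

Section QP.
Variable F : closedFieldType.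

Notation homogeneous n := (fun p : {mpoly F[n]} => p \is (@ishomog n F mdeg)).

Lemma ishomog1W n d (p : {mpoly F[n]}) : p \is (@ishomog1 n F d mdeg) -> p \is (@ishomog n F mdeg).
Proof. by move=> h; apply/homogP; exists d. Qed.

Lemma ishomogM n (p q : {mpoly F[n]}) : p \is (@ishomog n F mdeg) -> q \is (@ishomog n F mdeg) ->
  p * q \is (@ishomog n F mdeg).
Proof.
by move=> /homogP[d hp] /homogP[e hq]; apply/homogP; exists (d + e)%N; exact: dhomogM.
Qed.

Lemma qptsE n (X : qpvar F n) v : qpts X v <->
  [/\ v != 0, forall p, p \in qeqs X -> peval p v = 0 &
      exists2 p, p \in qneqs X & peval p v != 0].
Proof.
split=> [[[vn0 he] hn]|[vn0 he [p pn pv]]].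
  split=> //; apply: contrapT => hex; apply: hn; split=> // p pn.
  by apply/eqP/contraT => pv; case: hex; exists p.
by split=> // -[_ /(_ p pn)]/eqP; apply/negP.
Qed.

Fact qp_eq_homog n (X : qpvar F n) (p : {mpoly F[n]}) (hp : p \is (@ishomog n F mdeg)) :
  all (homogeneous n) (p :: qeqs X).
Proof. by rewrite /= hp qeqs_homog. Qed.
Definition qp_eq n (X : qpvar F n) p hp := QPVar (@qp_eq_homog n X p hp) (qneqs_homog X).
Lemma qp_eqE n (X : qpvar F n) p hp v : qpts (@qp_eq n X p hp) v <-> qpts X v /\ peval p v = 0.
Proof.
rewrite !qptsE /=; split=> [[vn0 h1 h2]|[[vn0 h1 h2] h3]].
  split; last by apply: h1; rewrite mem_head.
  by split=> // q qX; apply: h1; rewrite in_cons qX orbT.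
by split=> // q; rewrite in_cons => /orP[/eqP->|/h1].
Qed.

Fact qp_neqs_homog n (s t : seq {mpoly F[n]}) : all (homogeneous n) s -> all (homogeneous n) t ->
  all (homogeneous n) [seq p * q | p <- s, q <- t].
Proof.
move=> hs ht; apply/allP => r /allpairsP[[p q] /= [ps qt ->]].
by apply: ishomogM; [exact: (allP hs)|exact: (allP ht)].
Qed.
Fact homog_seq1 n (p : {mpoly F[n]}) (hp : p \is (@ishomog n F mdeg)) : all (homogeneous n) [:: p].
Proof. by rewrite /= hp. Qed.
Definition qp_neq n (X : qpvar F n) p hp :=
  QPVar (qeqs_homog X) (qp_neqs_homog (@homog_seq1 n p hp) (qneqs_homog X)).
Lemma qp_neqE n (X : qpvar F n) p hp v : qpts (@qp_neq n X p hp) v <-> qpts X v /\ peval p v != 0.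
Proof.
rewrite !qptsE; split=> [[vn0 h1 [r]]|[[vn0 h1 [q qn qv]] pv]].
  move=> /allpairsP[[p' q] /= []]; rewrite inE => /eqP-> qn ->.
  rewrite /peval mevalM mulf_eq0 negb_or => /andP[pv qv].
  by split=> //; split=> //; exists q.
split=> //; exists (p * q); first by apply/allpairsP; exists (p, q); rewrite /= mem_head.
by rewrite /peval mevalM mulf_neq0.
Qed.

Fact qp_cat_homog n (s t : seq {mpoly F[n]}) : all (homogeneous n) s -> all (homogeneous n) t ->
  all (homogeneous n) (s ++ t).
Proof. by move=> hs ht; rewrite all_cat hs ht. Qed.
Definition qpI n (X Y : qpvar F n) :=
  QPVar (qp_cat_homog (qeqs_homog X) (qeqs_homog Y))
        (qp_neqs_homog (qneqs_homog X) (qneqs_homog Y)).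
Lemma qpIE n (X Y : qpvar F n) : qpts (qpI X Y) = qpts X `&` qpts Y.
Proof.
apply/seteqP; split=> v /=; rewrite /setI /= !qptsE.
  move=> [vn0 h1 [r /allpairsP[[p q] /= [pX qY ->]]]].
  rewrite /peval mevalM mulf_eq0 negb_or => /andP[pv qv].
  split; split=> //; first by move=> s sX; apply: h1; rewrite mem_cat sX.
  - by exists p.
  - by move=> s sX; apply: h1; rewrite mem_cat sX orbT.
  - by exists q.
move=> [[vn0 h1 [p pX pv]] [_ h2 [q qY qv]]]; split=> //.
  by move=> s; rewrite mem_cat => /orP[/h1|/h2].
exists (p * q); last by rewrite /peval mevalM mulf_neq0.
by apply/allpairsP; exists (p, q).
Qed.

Lemma peval_scale n (p : {mpoly F[n]}) c v : p \is (@ishomog n F mdeg) -> c != 0 ->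
  (peval p (c *: v) == 0) = (peval p v == 0).
Proof.
move=> /homogP[d hp] cn0.
rewrite (@hpoly_scale F n d (peval p)); last by exists p.
by rewrite mulf_eq0 expf_eq0 (negbTE cn0) andbF.
Qed.

Lemma qpts_scale n (X : qpvar F n) c v : c != 0 -> qpts X v -> qpts X (c *: v).
Proof.
move=> cn0; rewrite !qptsE => -[vn0 h1 [p pX pv]]; split.
- by rewrite scaler_eq0 negb_or cn0.
- move=> q qX; apply/eqP; rewrite peval_scale ?h1 //; exact: (allP (qeqs_homog X)).
- exists p => //; rewrite peval_scale //; exact: (allP (qneqs_homog X)).
Qed.
Lemma qpts_neq0 n (X : qpvar F n) v : qpts X v -> v != 0.
Proof. by rewrite qptsE => -[]. Qed.

Lemma same_pt_refl n (v : 'rV[F]_n) : same_pt v v.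
Proof. by exists 1; [exact: oner_neq0|rewrite scale1r]. Qed.

Lemma cls_iso n m (X : qpvar F n) (Y : qpvar F m)
    (phi : 'rV[F]_n -> 'rV[F]_m) (psi : 'rV[F]_m -> 'rV[F]_n) d e :
  (forall j, hpoly d (fun v => phi v ord0 j)) -> (forall j, hpoly e (fun w => psi w ord0 j)) ->
  (forall v, qpts X v -> qpts Y (phi v)) -> (forall w, qpts Y w -> qpts X (psi w)) ->
  (forall v, qpts X v -> same_pt (psi (phi v)) v) ->
  (forall w, qpts Y w -> same_pt (phi (psi w)) w) ->
  cls X = cls Y.
Proof.
have reg n' m' (X' : qpvar F n') (Y' : qpvar F m') (f : 'rV[F]_n' -> 'rV[F]_m') k :
    (forall j, hpoly k (fun v => f v ord0 j)) -> (forall v, qpts X' v -> qpts Y' (f v)) ->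
    regular_map X' Y' f.
  move=> hf fXY; split=> // p _.
  have [P hP] := @boolp.choice _ _ (fun j (P : {mpoly F[n']}) =>
    P \is (@ishomog1 n' F k mdeg) /\ forall v, f v ord0 j = peval P v)
    (fun j => match hf j with ex_intro2 P h1 h2 => ex_intro _ P (conj h1 h2) end).
  exists 1, k, P; split.
  - by apply/homogP; exists 0%N; exact: dhomog1.
  - by rewrite /peval meval1 oner_neq0.
  - by move=> j; have [] := hP j.
  - move=> v _ _; rewrite (_ : \row_j _ = f v); first exact: same_pt_refl.
    by apply/rowP => j; rewrite mxE; have [_ ->] := hP j.
move=> hphi hpsi XY YX h1 h2; rewrite !clsE; apply/kpiP/krel_iso; exists phi, psi.
by split=> //; [exact: reg hphi XY|exact: reg hpsi YX].
Qed.

Lemma cls_eq n (X Y : qpvar F n) : qpts X = qpts Y -> cls X = cls Y.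
Proof.
move=> e; apply: (@cls_iso n n X Y id id 1 1); rewrite ?e //; try by move=> j; exact: hpoly_coord.
- by move=> v _; exact: same_pt_refl.
- by move=> v _; exact: same_pt_refl.
Qed.

Lemma cls_scissor n (X Y U : qpvar F n) : rel_closed (qpts X) (qpts Y) ->
  qpts U = qpts X `\` qpts Y -> cls X = cls Y + cls U.
Proof.
move=> h1 h2; rewrite !clsE -kpiD; apply/kpiP; exact: krel_scissor h1 h2.
Qed.

Lemma cls_cut n (X : qpvar F n) p (hp : p \is (@ishomog n F mdeg)) :
  cls X = cls (qp_eq X hp) + cls (qp_neq X hp).
Proof.
apply: cls_scissor.
  exists [:: p]; first by rewrite /= hp.
  apply/seteqP; split=> v /=; rewrite qp_eqE.
    move=> [hX hv]; split=> //; split; first exact: qpts_neq0 hX.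
    by move=> q; rewrite inE => /eqP->.
  by move=> [hX [_ hv]]; split=> //; apply: hv; rewrite mem_head.
apply/seteqP; split=> v /=; rewrite qp_neqE qp_eqE.
  by move=> [hX hv]; split=> // -[_ h]; move: hv; rewrite h eqxx.
move=> [hX hv]; split=> //; apply/eqP => h; exact: hv.
Qed.

Lemma cls_empty n (X : qpvar F n) : qpts X = set0 -> cls X = 0.
Proof.
move=> hX; apply: (addrI (cls X)); rewrite addr0; symmetry; apply: cls_scissor.
  by exists [::] => //; rewrite hX set0I.
by rewrite hX setD0.
Qed.

(** The scissor relation only separates a closed subset from its complement. For a partition into
    locally closed pieces, everything is cut along the polynomials of [ps] one by one; once their
    vanishing pattern is constant on X, each piece is empty or all of X. *)
Lemma cls_partition n (ps : seq {mpoly F[n]}) (X : qpvar F n) (T : finType) (Y : T -> qpvar F n) :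
  all (homogeneous n) ps ->
  (forall v, qpts X v <-> exists t, qpts (Y t) v) ->
  (forall t u, t != u -> qpts (Y t) `&` qpts (Y u) = set0) ->
  (forall t v w, qpts X v -> qpts X w ->
     (forall p, p \in ps -> (peval p v == 0) = (peval p w == 0)) -> qpts (Y t) v -> qpts (Y t) w) ->
  cls X = \sum_t cls (Y t).
Proof.
elim: ps X Y => [|p ps IH] X Y /=.
  move=> _ hX dis hs.
  have [X0|/eqP/set0P[v Xv]] := pselect (qpts X = set0); last first.
  - have [t Yv] := (hX v).1 Xv.
    rewrite (bigD1 t) //= big1 ?addr0 => [|u ut].
      apply: cls_eq; apply/seteqP; split=> w hw; last by apply/hX; exists t.
      exact: hs Yv.
    apply: cls_empty; apply/seteqP; split=> w //= Yw.
    have Xw : qpts X w by apply/hX; exists u.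
    have : (qpts (Y u) `&` qpts (Y t)) w by split=> //; exact: hs Yv.
    by rewrite dis.
  - rewrite cls_empty // big1 // => t _; apply: cls_empty; apply/seteqP; split=> w //= Yw.
    by have : qpts X w by [apply/hX; exists t]; rewrite X0.
move=> /andP[hp hps] hX dis hs.
rewrite (cls_cut X hp) (eq_bigr _ (fun t _ => cls_cut (Y t) hp)) big_split /=.
have disI (A B : T -> qpvar F n) : (forall t v, qpts (A t) v -> qpts (Y t) v) ->
    forall t u, t != u -> qpts (A t) `&` qpts (A u) = set0.
  move=> hA t u tu; apply/seteqP; split=> w //= [/hA h1 /hA h2].
  by have : (qpts (Y t) `&` qpts (Y u)) w by []; rewrite dis.
congr (_ + _); apply: IH => //.
- move=> v; rewrite qp_eqE hX; split=> [[[t Yv] pv]|[t]].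
    by exists t; rewrite qp_eqE.
  by rewrite qp_eqE => -[Yv pv]; split=> //; exists t.
- by apply: disI => // t v; rewrite qp_eqE => -[].
- move=> t v w; rewrite !qp_eqE => -[Xv pv] [Xw pw] hvw [Yv _]; split=> //.
  apply: hs Yv => // q; rewrite in_cons => /orP[/eqP->|/hvw //].
  by rewrite pv pw.
- move=> v; rewrite qp_neqE hX; split=> [[[t Yv] pv]|[t]].
    by exists t; rewrite qp_neqE.
  by rewrite qp_neqE => -[Yv pv]; split=> //; exists t.
- by apply: disI => // t v; rewrite qp_neqE => -[].
- move=> t v w; rewrite !qp_neqE => -[Xv pv] [Xw pw] hvw [Yv _]; split=> //.
  apply: hs Yv => // q; rewrite in_cons => /orP[/eqP->|/hvw //].
  by rewrite (negbTE pv) (negbTE pw).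
Qed.

Lemma cls_cover n (X : qpvar F n) (T : finType) (Y : T -> qpvar F n) :
  (forall v, qpts X v <-> exists t, qpts (Y t) v) ->
  (forall t u, t != u -> qpts (Y t) `&` qpts (Y u) = set0) ->
  cls X = \sum_t cls (Y t).
Proof.
move=> hX dis.
pose ps := flatten [seq qeqs (Y t) ++ qneqs (Y t) | t <- enum T].
have hin t p : p \in qeqs (Y t) ++ qneqs (Y t) -> p \in ps.
  by move=> h; apply/flatten_mapP; exists t; rewrite ?mem_enum.
apply: (@cls_partition n ps) => //.
  apply/allP => p /flatten_mapP[t _]; rewrite mem_cat => /orP[].
    exact: (allP (qeqs_homog (Y t))).
  exact: (allP (qneqs_homog (Y t))).
move=> t v w Xv Xw hvw; rewrite !qptsE => -[vn0 h1 [p pn pv]]; split.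
- exact: qpts_neq0 Xw.
- move=> q qe; apply/eqP; rewrite -hvw; first by rewrite h1.
  by apply: (hin t); rewrite mem_cat qe.
- exists p => //; rewrite -hvw //.
  by apply: (hin t); rewrite mem_cat pn orbT.
Qed.

(** [stratification] on cones, with any finite index type: unions and refinements are then indexed
    by sums and products of types. *)
Definition fstrat N (B : set 'rV[F]_N) (T : finType) (X : T -> qpvar F (1 + N)) : Prop :=
  (forall t u, t != u -> qpts (X t) `&` qpts (X u) = set0) /\
  forall v, (exists t, qpts (X t) v) <-> v0 v != 0 /\ B (rest v).

Lemma row1_v0 N (v : 'rV[F]_N) : v0 (row_mx 1 v) = 1.
Proof. by rewrite /v0 row_mxEl mxE. Qed.
Lemma row1_rest N (v : 'rV[F]_N) : rest (row_mx 1 v) = v.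
Proof. by rewrite /rest row1_v0 invr1 scale1r row_mxKr. Qed.
Lemma v0_rest N (v : 'rV[F]_(1 + N)) : v0 v != 0 -> v = v0 v *: row_mx 1 (rest v).
Proof.
move=> vn0; rewrite scale_row_mx /rest scalerA mulfV // scale1r.
rewrite -{1}[v]hsubmxK; congr row_mx; apply/rowP => j.
by rewrite !mxE !ord1 mulr1.
Qed.

Lemma stratificationP N (B : set 'rV[F]_N) r (X : 'I_r -> qpvar F (1 + N)) :
  stratification B X <-> fstrat B X.
Proof.
split=> [[h1 h2 h3]|[h2 h3]].
  split=> // v; split=> [[t Xv]|[vn0 Bv]].
    have vn0 : v0 v != 0 by apply: h1 Xv.
    split=> //; apply/h3; exists t.
    rewrite -[row_mx _ _](scalerK vn0) -v0_rest //.
    by apply: qpts_scale => //; rewrite invr_eq0.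
  by have [t Xt] := (h3 _).1 Bv; exists t; rewrite (v0_rest vn0); apply: qpts_scale.
split=> // [i v Xv|v].
  by have [] := (h3 v).1 (ex_intro _ i Xv).
have := h3 (row_mx 1 v); rewrite row1_v0 row1_rest => ->.
by split=> [Bv|[]//]; split=> //; exact: oner_neq0.
Qed.

Lemma fstrat_enum N (B : set 'rV[F]_N) (T : finType) (X : T -> qpvar F (1 + N)) :
  fstrat B X -> stratification B (fun i : 'I_#|T| => X (enum_val i)).
Proof.
move=> [h1 h2]; apply/stratificationP; split.
  by move=> i j ij; apply: h1; apply: contra_neq ij => /enum_val_inj.
move=> v; rewrite -h2; split=> [[i Xi]|[t Xt]]; first by exists (enum_val i).
by exists (enum_rank t); rewrite enum_rankK.
Qed.

Lemma fstrat_sum_eq N (B : set 'rV[F]_N) (T U : finType) X (Y : U -> qpvar F (1 + N)) :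
  @fstrat N B T X -> fstrat B Y -> \sum_t cls (X t) = \sum_u cls (Y u).
Proof.
have half (T' U' : finType) (X' : T' -> qpvar F (1 + N)) (Y' : U' -> qpvar F (1 + N)) :
    fstrat B X' -> fstrat B Y' -> \sum_t cls (X' t) = \sum_t \sum_u cls (qpI (X' t) (Y' u)).
  move=> [dX hX] [dY hY]; apply: eq_bigr => t _; apply: cls_cover => [v|u w uw].
    split=> [Xv|[u]]; last by rewrite qpIE => -[].
    have [u Yv] := (hY v).2 ((hX v).1 (ex_intro _ t Xv)).
    by exists u; rewrite qpIE.
  rewrite !qpIE; apply/seteqP; split=> v //= [[_ h1] [_ h2]].
  by have : (qpts (Y' u) `&` qpts (Y' w)) v by []; rewrite dY.
move=> hX hY; apply: etrans (half _ _ _ _ hX hY) _.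
apply: etrans (esym (half _ _ _ _ hY hX)); rewrite exchange_big.
apply: eq_bigr => u _; apply: eq_bigr => t _; apply: cls_eq.
by rewrite !qpIE setIC.
Qed.

Lemma constr_classE N (B : set 'rV[F]_N) (T : finType) (X : T -> qpvar F (1 + N)) :
  fstrat B X -> constr_class B = \sum_t cls (X t).
Proof.
move=> hX; apply: xget_subset1.
  exists #|T|, (fun i => X (enum_val i)); split; first exact: fstrat_enum.
  by rewrite (reindex _ (onW_bij _ (@enum_val_bij T))).
move=> a b [r [Y [hY ->]]] [r' [Y' [hY' ->]]].
exact: fstrat_sum_eq (iffLR (stratificationP _ _) hY) (iffLR (stratificationP _ _) hY').
Qed.

Lemma fstrat_constructible N (B : set 'rV[F]_N) (T : finType) (X : T -> qpvar F (1 + N)) :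
  fstrat B X -> constructible B.
Proof. by move=> h; exists #|T|, (fun i => X (enum_val i)); exact: fstrat_enum. Qed.

Lemma constructible_fstrat N (B : set 'rV[F]_N) : constructible B ->
  exists (T : finType) (X : T -> qpvar F (1 + N)), fstrat B X.
Proof. by move=> [r [X h]]; exists 'I_r, X; exact/stratificationP. Qed.

Lemma strat_exists n (ps : seq {mpoly F[n]}) (X : qpvar F n) (S : set 'rV[F]_n) :
  all (homogeneous n) ps ->
  (forall v w, qpts X v -> qpts X w ->
     (forall p, p \in ps -> (peval p v == 0) = (peval p w == 0)) -> S v -> S w) ->
  exists (T : finType) (Y : T -> qpvar F n),
    (forall t u, t != u -> qpts (Y t) `&` qpts (Y u) = set0) /\
    forall v, (exists t, qpts (Y t) v) <-> qpts X v /\ S v.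
Proof.
elim: ps X => [|p ps IH] X /=.
  move=> _ hs; have [XS0|/eqP/set0P[v [Xv Sv]]] := pselect (qpts X `&` S = set0).
    exists 'I_0, (fun=> X); split=> [[]//|v]; split=> [[[]//]|[Xv Sv]].
    by have : (qpts X `&` S) v by []; rewrite XS0.
  exists unit, (fun=> X); split=> [[] [] //|w].
  split=> [[_ Xw]|[Xw _]]; last by exists tt.
  by split=> //; apply: hs Sv.
move=> /andP[hp hps] hs.
have [|T0 [Y0 [d0 h0]]] := IH (qp_eq X hp) hps.
  move=> v w; rewrite !qp_eqE => -[Xv pv] [Xw pw] hvw; apply: hs => // q.
  by rewrite in_cons => /orP[/eqP->|/hvw //]; rewrite pv pw.
have [|T1 [Y1 [d1 h1]]] := IH (qp_neq X hp) hps.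
  move=> v w; rewrite !qp_neqE => -[Xv pv] [Xw pw] hvw; apply: hs => // q.
  by rewrite in_cons => /orP[/eqP->|/hvw //]; rewrite (negbTE pv) (negbTE pw).
exists (T0 + T1)%type, (fun t => match t with inl t => Y0 t | inr t => Y1 t end).
have cross t u v : qpts (Y0 t) v -> qpts (Y1 u) v -> False.
  move=> Y0v Y1v; have [] := (h0 v).1 (ex_intro _ t Y0v); rewrite qp_eqE => -[_ pv] _.
  have [] := (h1 v).1 (ex_intro _ u Y1v); rewrite qp_neqE => -[_ pv'] _.
  by rewrite pv eqxx in pv'.
split=> [[t|t] [u|u] tu|v].
- by apply: d0; apply: contra_neq tu => ->.
- by apply/seteqP; split=> v //= [h h']; case: (cross t u v).
- by apply/seteqP; split=> v //= [h h']; case: (cross u t v).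
- by apply: d1; apply: contra_neq tu => ->.
split=> [[[t|t] Yv]|[Xv Sv]].
- by have [] := (h0 v).1 (ex_intro _ t Yv); rewrite qp_eqE => -[].
- by have [] := (h1 v).1 (ex_intro _ t Yv); rewrite qp_neqE => -[].
have [pv|pv] := eqVneq (peval p v) 0.
  have [|t Yt] := (h0 v).2; first by rewrite qp_eqE.
  by exists (inl t).
have [|t Yt] := (h1 v).2; first by rewrite qp_neqE.
by exists (inr t).
Qed.

Fact chart_homog N : all (homogeneous (1 + N)) [:: 'X_(lshift N ord0)].
Proof. by rewrite /= andbT; apply/homogP; exists 1%N; rewrite dhomogX; apply/eqP/mdeg1. Qed.
Definition chart N : qpvar F (1 + N) := QPVar (homog_nil F (1 + N)) (chart_homog N).
Lemma chartE N v : qpts (chart N) v <-> v0 v != 0.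
Proof.
rewrite qptsE /=; split=> [[_ _ [p]]|vn0].
  by rewrite inE => /eqP->; rewrite /peval mevalXU.
split=> //; first by apply: contraNneq vn0 => ->; rewrite /v0 mxE.
by exists 'X_(lshift N ord0); rewrite ?mem_head // /peval mevalXU.
Qed.

Lemma definable_constructible N (B : set 'rV[F]_N) : definable B -> constructible B.
Proof.
move=> hB.
(* Membership in [B] depends only on the vanishing pattern of finitely many homogenised polynomials,
   and [strat_exists] turns each pattern into a stratum. *)
have [ps [hps hs]] : exists ps : seq {mpoly F[1 + N]}, all (homogeneous (1 + N)) ps /\
    forall v w, v0 v != 0 -> v0 w != 0 ->
     (forall p, p \in ps -> (peval p v == 0) = (peval p w == 0)) -> B (rest v) -> B (rest w).
  elim: hB => [f hf|A _ [ps [h1 h2]]|A1 A2 _ [ps [h1 h2]] _ [qs [h3 h4]]].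
  - have [d [h [[p hp hE] he]]] := homogenize hf.
    exists [:: p]; split; first by rewrite /= (ishomog1W hp).
    move=> v w vn0 wn0 hvw /= fv; have := hvw p (mem_head _ _).
    rewrite -!hE !he // fv mulr0 eqxx => /esym.
    by rewrite mulf_eq0 expf_eq0 (negbTE wn0) andbF => /eqP.
  - exists ps; split=> // v w vn0 wn0 hvw; apply: contra_not; apply: h2 => // p pp.
    by rewrite hvw.
  - exists (ps ++ qs); split; first by rewrite all_cat h1 h3.
    move=> v w vn0 wn0 hvw [a1 a2]; split.
      by apply: h2 a1 => // p pp; apply: hvw; rewrite mem_cat pp.
    by apply: h4 a2 => // p pp; apply: hvw; rewrite mem_cat pp orbT.
have [|T [Y [hd hY]]] := @strat_exists _ ps (chart N) [set v | B (rest v)] hps.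
  by move=> v w; rewrite !chartE; exact: hs.
apply: (@fstrat_constructible _ _ T Y); split=> // v.
by rewrite hY chartE.
Qed.

Lemma row1_neq0 N (v : 'rV[F]_N) : row_mx 1 v != 0 :> 'rV[F]_(1 + N).
Proof.
apply/eqP => /(congr1 (@v0 F N)); rewrite row1_v0 /v0 mxE => /eqP.
by rewrite oner_eq0.
Qed.

Lemma definable_qpts N (X : qpvar F (1 + N)) : definable [set v : 'rV[F]_N | qpts X (row_mx 1 v)].
Proof.
have pf p : polyfun (fun v : 'rV[F]_N => peval p (row_mx 1 v : 'rV[F]_(1 + N))).
  apply: polyfun_peval => j; case: (split_ordP j) => i ->.
    by apply: polyfun_ext (polyfun_const _ ((1 : 'M_1) ord0 i)) _ => v; rewrite row_mxEl.
  by apply: polyfun_ext (polyfun_coord _ i) _ => v; rewrite row_mxEr.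
have df (s : seq {mpoly F[1 + N]}) : definable [set v : 'rV[F]_N |
    forall p, p \in s -> peval p (row_mx 1 v : 'rV[F]_(1 + N)) = 0].
  exact: (definable_bigI _ (fun p => definable_zero (pf p))).
rewrite (_ : [set v | _] = [set v : 'rV[F]_N |
    forall p, p \in qeqs X -> peval p (row_mx 1 v : 'rV[F]_(1 + N)) = 0] `\`
  [set v : 'rV[F]_N | forall p, p \in qneqs X -> peval p (row_mx 1 v : 'rV[F]_(1 + N)) = 0]).
  exact: definableD.
apply/seteqP; split=> v /=; rewrite qptsE.
  by move=> [_ h1 [p pn pv]]; split=> // /(_ p pn) /eqP; apply/negP.
move=> [h1 h2]; split=> //; first exact: row1_neq0.
apply: contrapT => h; apply: h2 => p pn; apply/eqP/contraT => pv.
by case: h; exists p.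
Qed.

Lemma constructible_definable N (B : set 'rV[F]_N) : constructible B -> definable B.
Proof.
move=> /constructible_fstrat[T [X [_ hX]]].
rewrite (_ : B = [set v | exists t, qpts (X t) (row_mx 1 v)]).
  by apply: definable_bigU => t; exact: definable_qpts.
apply/seteqP; split=> v /=; rewrite hX row1_v0 row1_rest; last by case.
by move=> Bv; split=> //; exact: oner_neq0.
Qed.
End QP.

Section LocallyClosed.
Variable F : closedFieldType.

Definition lcset n (S : set 'rV[F]_n) : Prop := exists X : qpvar F n, qpts X = S.

Lemma lcset_eq n d (S : set 'rV[F]_n) f : lcset S -> hpoly d f ->
  lcset (S `&` [set v | f v = 0]).
Proof.
move=> [X <-] [p hp fE]; exists (qp_eq X (ishomog1W hp)).
by apply/seteqP; split=> v /=; rewrite qp_eqE -fE.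
Qed.

Lemma lcset_eqs n d (S : set 'rV[F]_n) (I : eqType) (r : seq I) f : lcset S ->
  (forall i, hpoly d (f i)) -> lcset (S `&` [set v | forall i, i \in r -> f i v = 0]).
Proof.
move=> hS hf; elim: r => [|i r IH].
  rewrite (_ : [set v | _] = setT) ?setIT //.
  by apply/seteqP; split.
rewrite (_ : _ `&` _ = (S `&` [set v | forall i, i \in r -> f i v = 0]) `&` [set v | f i v = 0]).
  exact: lcset_eq IH (hf i).
apply/seteqP; split=> v /= => [[Sv h]|[[Sv h1] h2]].
  by split; [split=> // j jr|]; apply: h; rewrite in_cons ?eqxx // jr orbT.
by split=> // j; rewrite in_cons => /orP[/eqP->|/h1].
Qed.

(** Being a point of [Y] includes [phi v != 0], an open condition. It is encoded by multiplying the
    inequations with the coordinates of [phi]. *)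
Lemma lcset_pull n m D (Y : qpvar F m) (phi : 'rV[F]_n -> 'rV[F]_m) :
  (forall j, hpoly D (fun v => phi v ord0 j)) ->
  lcset [set v | v != 0 /\ qpts Y (phi v)].
Proof.
move=> hphi.
have hf (p : {mpoly F[m]}) : exists p' : {mpoly F[n]}, p' \is (@ishomog n F mdeg) /\
    (p \is (@ishomog m F mdeg) -> forall v, peval p' v = peval p (phi v)).
  have [/homogP[d hp]|np] := boolP (p \is (@ishomog m F mdeg)).
    have [p' hp' p'E] := hpoly_comp hp hphi.
    by exists p'; split=> [|_ v]; [exact: ishomog1W hp'|rewrite p'E].
  by exists 0; split=> //; apply/homogP; exists 0%N; exact: dhomog0.
have [f fP] := boolp.choice hf.
have [g gP] := @boolp.choice _ _ (fun j (P : {mpoly F[n]}) =>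
    P \is (@ishomog n F mdeg) /\ forall v, phi v ord0 j = peval P v)
    (fun j => match hphi j with ex_intro2 P h1 h2 => ex_intro _ P (conj (ishomog1W h1) h2) end).
have hE : all (fun p : {mpoly F[n]} => p \is (@ishomog n F mdeg)) [seq f p | p <- qeqs Y].
  by apply/allP => r /mapP[p _ ->]; have [] := fP p.
have hN : all (fun p : {mpoly F[n]} => p \is (@ishomog n F mdeg))
    [seq f p * g j | p <- qneqs Y, j <- enum 'I_m].
  by apply/allP => r /allpairsP[[p j] /= [_ _ ->]]; apply: ishomogM; [have [] := fP p|have [] := gP j].
exists (QPVar hE hN); apply/seteqP; split=> v /=; rewrite !qptsE /=.
  move=> [vn0 h1 [r /allpairsP[[p j] /= [pY _ ->]]]].
  rewrite /peval mevalM mulf_eq0 negb_or => /andP[pv gv]; split=> //; split.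
  - apply: contraNneq gv => phi0; have [_] := gP j; rewrite /peval => <-.
    by rewrite phi0 mxE.
  - move=> q qY; have [_ e] := fP q; rewrite -[LHS]/(peval q (phi v)) -e.
      by apply: h1; apply: map_f.
    exact: (allP (qeqs_homog Y)).
  - exists p => //; have [_ e] := fP p; rewrite -[_.@[_]]/(peval p (phi v)) -e; first exact: pv.
    exact: (allP (qneqs_homog Y)).
move=> [vn0 [phin0 h1 [p pY pv]]]; split=> //.
  move=> r /mapP[q qY ->]; have [_ e] := fP q; rewrite e; first exact: h1.
  exact: (allP (qeqs_homog Y)).
have [j hj] : exists j, phi v ord0 j != 0.
  apply: contrapT => h; case/eqP: phin0; apply/rowP => j; rewrite mxE.
  by apply/eqP/contraT => hj; case: h; exists j.
exists (f p * g j); first by apply/allpairsP; exists (p, j); rewrite /= mem_enum.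
rewrite /peval mevalM mulf_neq0 //.
  have [_ e] := fP p; rewrite -[_.@[_]]/(peval (f p) v) e //.
  exact: (allP (qneqs_homog Y)).
by have [_] := gP j; rewrite /peval => <-.
Qed.
End LocallyClosed.

Section PolyMaps.
Variable F : closedFieldType.
Definition fracmap N M (q : 'rV[F]_N -> F) (phi : 'rV[F]_N -> 'rV[F]_M) : Prop :=
  forall j, fracfun q (fun v => phi v ord0 j).
Definition polymap N M (phi : 'rV[F]_N -> 'rV[F]_M) : Prop :=
  forall j, polyfun (fun v => phi v ord0 j).

Lemma polymap_frac N M q (phi : 'rV[F]_N -> 'rV[F]_M) : polymap phi -> fracmap q phi.
Proof. by move=> h j; exact: fracfun_poly. Qed.
Lemma polymap_id N : polymap (fun v : 'rV[F]_N => v).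
Proof. by move=> j; exact: polyfun_coord. Qed.
Lemma polymap_cst N M (w : 'rV[F]_M) : polymap (fun v : 'rV[F]_N => w).
Proof. by move=> j; exact: polyfun_const. Qed.
Lemma polymap_lsub N M1 M2 (phi : 'rV[F]_N -> 'rV[F]_(M1 + M2)) :
  polymap phi -> polymap (fun v => lsubmx (phi v)).
Proof. by move=> h j; apply: polyfun_ext (h (lshift M2 j)) _ => v; rewrite mxE. Qed.
Lemma polymap_rsub N M1 M2 (phi : 'rV[F]_N -> 'rV[F]_(M1 + M2)) :
  polymap phi -> polymap (fun v => rsubmx (phi v)).
Proof. by move=> h j; apply: polyfun_ext (h (rshift M1 j)) _ => v; rewrite mxE. Qed.
Lemma polymap_row N M1 M2 (f : 'rV[F]_N -> 'rV[F]_M1) (g : 'rV[F]_N -> 'rV[F]_M2) :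
  polymap f -> polymap g -> polymap (fun v => row_mx (f v) (g v)).
Proof.
move=> hf hg j; case: (split_ordP j) => i ->.
  by apply: polyfun_ext (hf i) _ => v; rewrite row_mxEl.
by apply: polyfun_ext (hg i) _ => v; rewrite row_mxEr.
Qed.
Lemma fracmap_row N M1 M2 q (f : 'rV[F]_N -> 'rV[F]_M1) (g : 'rV[F]_N -> 'rV[F]_M2) :
  fracmap q f -> fracmap q g -> fracmap q (fun v => row_mx (f v) (g v)).
Proof.
move=> hf hg j; case: (split_ordP j) => i ->.
  by apply: fracfun_ext (hf i) _ => v _; rewrite row_mxEl.
by apply: fracfun_ext (hg i) _ => v _; rewrite row_mxEr.
Qed.

(** A fractional map becomes homogeneous once all coordinates share a denominator: [E] and [D] bound
    the exponents, and spare powers of [v0] and of the homogenised [q] equalise the degrees. The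
    scalar [c] is that common denominator. *)
Lemma frac_lift N M q (phi : 'rV[F]_N -> 'rV[F]_M) : polyfun q -> fracmap q phi ->
  exists D (Phi : 'rV[F]_(1 + N) -> 'rV[F]_(1 + M)),
    (forall j, hpoly D (fun v => Phi v ord0 j)) /\
    forall v, v0 v != 0 -> q (rest v) != 0 ->
      exists2 c, c != 0 & Phi v = c *: row_mx 1 (phi (rest v)).
Proof.
move=> hq hphi.
have [dq [Hq [hHq HqE]]] := homogenize hq.
have hj j : exists x : nat * nat * ('rV[F]_(1 + N) -> F), hpoly x.1.1 x.2 /\
    forall v, v0 v != 0 -> q (rest v) != 0 ->
      x.2 v = v0 v ^+ x.1.1 * (phi (rest v) ord0 j * q (rest v) ^+ x.1.2).
  have [P [e [hP PE]]] := hphi j; have [d [h [hh hE]]] := homogenize hP.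
  exists (d, e, h); split=> // v vn0 qn0 /=; rewrite hE // PE // divfK //.
  by rewrite expf_neq0.
have [x xP] := boolp.choice hj.
pose d j := (x j).1.1; pose e j := (x j).1.2; pose h j := (x j).2.
pose E := (\sum_j e j)%N; pose D := (\sum_j d j)%N.
have dD j : (d j <= D)%N by rewrite /D (bigD1 j) //= leq_addr.
have eE j : (e j <= E)%N by rewrite /E (bigD1 j) //= leq_addr.
have hv0 : hpoly 1 (@v0 F N) by apply: hpoly_coord.
have hpc a b f : a = b -> hpoly a f -> @hpoly F (1 + N) b f by move=> ->.
pose Phi0 v := v0 v ^+ D * Hq v ^+ E.
pose Phi1 j v := h j v * v0 v ^+ (D - d j) * (Hq v ^+ (E - e j) * v0 v ^+ (dq * e j)).
exists (D + dq * E)%N, (fun v => row_mx (\row_(i < 1) Phi0 v) (\row_j Phi1 j v)); split.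
  move=> j; case: (split_ordP j) => i ->.
    apply: (@hpoly_ext _ _ _ Phi0) => [|v]; last by rewrite row_mxEl mxE.
    apply: hpc (hpolyM (hpolyX D hv0) (hpolyX E hHq)); lia.
  apply: (@hpoly_ext _ _ _ (Phi1 i)) => [|v]; last by rewrite row_mxEr mxE.
  have [hi _] := xP i.
  apply: hpc (hpolyM (hpolyM hi (hpolyX (D - d i) hv0))
    (hpolyM (hpolyX (E - e i) hHq) (hpolyX (dq * e i) hv0))).
  rewrite -/(d i); have := dD i; have := eE i => h1 h2.
  rewrite !mul1n addnA subnKC // -addnA; congr (_ + _)%N.
  by rewrite -mulnDr subnK.
move=> v vn0 qn0; exists (v0 v ^+ (D + dq * E) * q (rest v) ^+ E).
  by rewrite mulf_neq0 ?expf_neq0.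
rewrite scale_row_mx; congr row_mx; apply/rowP => j; rewrite !mxE.
  by rewrite ord1 mulr1 /Phi0 HqE // exprMn -exprM exprD; ring.
have [_ hE] := xP j; rewrite /Phi1 /h hE // HqE // -/(d j) -/(e j).
have e1 : v0 v ^+ D = v0 v ^+ d j * v0 v ^+ (D - d j) by rewrite -exprD subnKC.
have e2 : q (rest v) ^+ E = q (rest v) ^+ e j * q (rest v) ^+ (E - e j).
  by rewrite -exprD subnKC.
have e3 : v0 v ^+ (dq * E) = v0 v ^+ (dq * (E - e j)) * v0 v ^+ (dq * e j).
  by rewrite -exprD -mulnDr subnK.
by rewrite exprD e1 e2 e3 exprMn -exprM; ring.
Qed.
End PolyMaps.

(** * Additivity, invariance and products of classes *)

Section Classes.
Variable F : closedFieldType.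
Notation cc B := (constr_class B).

Lemma definable_fstrat N (B : set 'rV[F]_N) : definable B ->
  exists (T : finType) (X : T -> qpvar F (1 + N)), fstrat B X.
Proof. by move=> /definable_constructible/constructible_fstrat. Qed.

Lemma cc0 N : cc (set0 : set 'rV[F]_N) = 0.
Proof.
rewrite (@constr_classE _ _ _ 'I_0 (fun=> chart F N)) ?big_ord0 //.
by split=> [[]//|v]; split=> [[[]]|[]].
Qed.

Lemma ccU N (A B : set 'rV[F]_N) : definable A -> definable B -> A `&` B = set0 ->
  cc (A `|` B) = cc A + cc B.
Proof.
move=> /definable_fstrat[T [X [dX hX]]] /definable_fstrat[U [Y [dY hY]]] AB.
rewrite (constr_classE (conj dX hX)) (constr_classE (conj dY hY)).
rewrite (@constr_classE _ _ _ (T + U)%type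
  (fun t => match t with inl t => X t | inr u => Y u end)) ?big_sumType //.
have cross t u v : qpts (X t) v -> qpts (Y u) v -> False.
  move=> Xv Yv; have [_ Av] := (hX v).1 (ex_intro _ t Xv).
  have [_ Bv] := (hY v).1 (ex_intro _ u Yv).
  by have : (A `&` B) (rest v) by []; rewrite AB.
split=> [[t|t] [u|u] tu|v].
- by apply: dX; apply: contra_neq tu => ->.
- by apply/seteqP; split=> v //= [h h']; case: (cross t u v).
- by apply/seteqP; split=> v //= [h h']; case: (cross u t v).
- by apply: dY; apply: contra_neq tu => ->.
split=> [[[t|t] h]|[vn0 [Av|Bv]]].
- by have [h1 h2] := (hX v).1 (ex_intro _ t h); split=> //; left.
- by have [h1 h2] := (hY v).1 (ex_intro _ t h); split=> //; right.
- by have [t h] := (hX v).2 (conj vn0 Av); exists (inl t).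
- by have [t h] := (hY v).2 (conj vn0 Bv); exists (inr t).
Qed.

(** Strata of [B] need not map to strata of [B']. Cut by the preimages, the piece X_t meeting the
    preimage of Y_u is isomorphic, through the homogeneous lifts, to the piece Y_u meeting the
    preimage of X_t; summing over all pairs gives both classes. *)
Lemma cc_iso N M (B : set 'rV[F]_N) (B' : set 'rV[F]_M) q q' phi psi :
  definable B -> definable B' -> polyfun q -> polyfun q' ->
  fracmap q phi -> fracmap q' psi ->
  (forall v, B v -> [/\ q v != 0, B' (phi v) & psi (phi v) = v]) ->
  (forall w, B' w -> [/\ q' w != 0, B (psi w) & phi (psi w) = w]) ->
  cc B = cc B'.
Proof.
move=> dB dB' hq hq' hphi hpsi h1 h2.
have [T [X hX]] := definable_fstrat dB; have [U [Y hY]] := definable_fstrat dB'.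
have [D [Phi [hPhi PhiE]]] := frac_lift hq hphi.
have [E [Psi [hPsi PsiE]]] := frac_lift hq' hpsi.
rewrite (constr_classE hX) (constr_classE hY); case: hX hY => dX hX [dY hY].
have lift1 t v : qpts (X t) v -> [/\ v0 v != 0, B (rest v) &
    exists2 c, c != 0 & Phi v = c *: row_mx 1 (phi (rest v))].
  move=> Xv; have [vn0 Bv] := (hX v).1 (ex_intro _ t Xv).
  by have [qv _ _] := h1 _ Bv; split=> //; exact: PhiE.
have lift2 u w : qpts (Y u) w -> [/\ v0 w != 0, B' (rest w) &
    exists2 c, c != 0 & Psi w = c *: row_mx 1 (psi (rest w))].
  move=> Yw; have [wn0 Bw] := (hY w).1 (ex_intro _ u Yw).
  by have [qw _ _] := h2 _ Bw; split=> //; exact: PsiE.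
have restZ k c (v : 'rV[F]_k) : c != 0 -> rest (c *: row_mx 1 v) = v.
  move=> c0; rewrite /rest /v0 mxE row_mxEl mxE mulr1 scale_row_mx row_mxKr.
  by rewrite scalerA mulVf ?scale1r.
have v0Z k c (v : 'rV[F]_k) : c != 0 -> v0 (c *: row_mx 1 v) != 0.
  by move=> c0; rewrite /v0 mxE row_mxEl mxE mulr1.
have back1 t v : qpts (X t) v -> same_pt (Psi (Phi v)) v.
  move=> Xv; have [vn0 Bv [c c0 cE]] := lift1 _ _ Xv; have [qv B'v pv] := h1 _ Bv.
  have [qw _ _] := h2 _ B'v.
  have [|| e e0 eE] := PsiE (Phi v); rewrite cE; [exact: v0Z|by rewrite restZ|].
  rewrite -cE eE cE restZ // pv; exists (e / v0 v); first by rewrite mulf_neq0 ?invr_eq0.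
  by rewrite {3}(v0_rest vn0) scalerA divfK.
have back2 u w : qpts (Y u) w -> same_pt (Phi (Psi w)) w.
  move=> Yw; have [wn0 Bw [c c0 cE]] := lift2 _ _ Yw; have [qw Bv pw] := h2 _ Bw.
  have [qv _ _] := h1 _ Bv.
  have [|| e e0 eE] := PhiE (Psi w); rewrite cE; [exact: v0Z|by rewrite restZ|].
  rewrite -cE eE cE restZ // pw; exists (e / v0 w); first by rewrite mulf_neq0 ?invr_eq0.
  by rewrite {3}(v0_rest wn0) scalerA divfK.
have to1 t v : qpts (X t) v -> exists u, qpts (Y u) (Phi v).
  move=> Xv; have [vn0 Bv [c c0 cE]] := lift1 _ _ Xv; have [qv B'v pv] := h1 _ Bv.
  by apply/hY; rewrite cE restZ //; split=> //; exact: v0Z.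
have to2 u w : qpts (Y u) w -> exists t, qpts (X t) (Psi w).
  move=> Yw; have [wn0 Bw [c c0 cE]] := lift2 _ _ Yw; have [qw Bv pw] := h2 _ Bw.
  by apply/hX; rewrite cE restZ //; split=> //; exact: v0Z.
have pt_in k (Z : qpvar F k) v w : same_pt v w -> qpts Z w -> qpts Z v.
  by move=> [c c0 ->]; exact: qpts_scale.
have [PX PXE] := @boolp.choice _ _ (fun u (Z : qpvar F (1 + N)) =>
   qpts Z = [set v | v != 0 /\ qpts (Y u) (Phi v)]%classic) (fun u => lcset_pull (Y u) hPhi).
have [PY PYE] := @boolp.choice _ _ (fun t (Z : qpvar F (1 + M)) =>
   qpts Z = [set v | v != 0 /\ qpts (X t) (Psi v)]%classic) (fun t => lcset_pull (X t) hPsi).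
transitivity (\sum_t \sum_u cls (qpI (X t) (PX u))).
  apply: eq_bigr => t _; apply: cls_cover => [v|u w uw].
    split=> [Xv|[u]]; last by rewrite qpIE => -[].
    have [u Yu] := to1 _ _ Xv; exists u; rewrite qpIE; split=> //.
    by rewrite PXE; split=> //; exact: qpts_neq0 Xv.
  rewrite !qpIE !PXE; apply/seteqP; split=> v //= [[_ [_ a1]] [_ [_ a2]]].
  by have : (qpts (Y u) `&` qpts (Y w)) (Phi v) by []; rewrite dY.
symmetry; transitivity (\sum_u \sum_t cls (qpI (Y u) (PY t))).
  apply: eq_bigr => u _; apply: cls_cover => [v|t w tw].
    split=> [Yv|[t]]; last by rewrite qpIE => -[].
    have [t Xt] := to2 _ _ Yv; exists t; rewrite qpIE; split=> //.
    by rewrite PYE; split=> //; exact: qpts_neq0 Yv.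
  rewrite !qpIE !PYE; apply/seteqP; split=> v //= [[_ [_ a1]] [_ [_ a2]]].
  by have : (qpts (X t) `&` qpts (X w)) (Psi v) by []; rewrite dX.
rewrite exchange_big; apply: eq_bigr => t _; apply: eq_bigr => u _; symmetry.
have inX v : qpts (qpI (X t) (PX u)) v -> qpts (X t) v /\ qpts (Y u) (Phi v).
  by rewrite qpIE PXE => -[? []].
have inY v : qpts (qpI (Y u) (PY t)) v -> qpts (Y u) v /\ qpts (X t) (Psi v).
  by rewrite qpIE PYE => -[? []].
apply: (@cls_iso _ _ _ _ _ Phi Psi D E) => //.
- move=> v /inX[Xv Yv]; rewrite qpIE PYE; split=> //; split; first exact: qpts_neq0 Yv.
  exact: pt_in (back1 _ _ Xv) Xv.
- move=> w /inY[Yw Xw]; rewrite qpIE PXE; split=> //; split; first exact: qpts_neq0 Xw.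
  exact: pt_in (back2 _ _ Yw) Yw.
- by move=> v /inX[Xv _]; exact: back1 Xv.
- by move=> v /inY[Yv _]; exact: back2 Yv.
Qed.

Lemma cc_poly_iso N M (B : set 'rV[F]_N) (B' : set 'rV[F]_M) phi psi :
  definable B -> definable B' -> polymap phi -> polymap psi ->
  (forall v, B v -> B' (phi v) /\ psi (phi v) = v) ->
  (forall w, B' w -> B (psi w) /\ phi (psi w) = w) ->
  cc B = cc B'.
Proof.
move=> dB dB' hphi hpsi h1 h2.
apply: (@cc_iso _ _ _ _ (fun=> 1) (fun=> 1) phi psi) => //; try exact: polyfun_const.
- exact: polymap_frac.
- exact: polymap_frac.
- by move=> v /h1[? ?]; split=> //; exact: oner_neq0.
- by move=> v /h2[? ?]; split=> //; exact: oner_neq0.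
Qed.

Notation L := (cls (affine_line F)).

Definition prod_space N a (B : set 'rV[F]_N) : set 'rV[F]_(N + a) := [set v | B (lsubmx v)].
Arguments prod_space {N} a B.

Lemma definable_prod_space N a (B : set 'rV[F]_N) : definable B -> definable (prod_space a B).
Proof.
by move=> hB; apply: (definable_preim (phi := fun v => lsubmx v)) hB; exact/polymap_lsub/polymap_id.
Qed.

Section Line.
Variable N : nat.
Variable X : qpvar F (1 + N).
Hypothesis Xchart : forall v, qpts X v -> v0 v != 0.

Let i0 : 'I_(1 + N) := lshift N ord0.
Definition drop_last (v : 'rV[F]_(1 + (N + 1))) : 'rV[F]_(1 + N) :=
  row_mx (lsubmx v) (lsubmx (rsubmx v)).
Let lst (v : 'rV[F]_(1 + (N + 1))) : F := v ord0 (rshift 1 (rshift N ord0)).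
Let seg (u : 'rV[F]_((1 + N) * 2)) (i : 'I_(1 + N)) (j : 'I_2) : F := u ord0 (mxvec_index i j).
Let j1 : 'I_2 := lift ord0 ord0.

Lemma affine_lineE w : qpts (affine_line F) w <-> w ord0 ord0 != 0.
Proof.
rewrite qptsE /=; split=> [[_ _ [p]]|w0].
  by rewrite inE => /eqP->; rewrite /peval mevalXU.
split=> //; first by apply: contraNneq w0 => ->; rewrite mxE.
by exists 'X_ord0; rewrite ?mem_head // /peval mevalXU.
Qed.

Let hseg i j : hpoly 1 (fun u => seg u i j). Proof. exact: hpoly_coord. Qed.
Let c0 (u : 'rV[F]_((1 + N) * 2)) : 'rV[F]_(1 + N) := \row_i seg u i ord0.
Let hc0 i : hpoly 1 (fun u => c0 u ord0 i).
Proof. by apply: hpoly_ext (hseg i ord0) _ => u; rewrite mxE. Qed.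

Lemma ord2_cases (j : 'I_2) : j = ord0 \/ j = j1.
Proof. by case: j => -[|[|//]] h; [left|right]; apply: val_inj. Qed.

Lemma mxvec_eq (u : 'rV[F]_((1 + N) * 2)) (A : 'M[F]_(1 + N, 2)) : (forall i j, seg u i j = A i j) -> u = mxvec A.
Proof.
move=> h; rewrite -[u]vec_mxK; congr mxvec; apply/matrixP => i j.
by rewrite -h /seg -[in RHS](vec_mxK u) mxvecE.
Qed.

Lemma seg_mxvec (V : 'rV[F]_(1 + N)) (w : 'rV[F]_2) i j :
  seg (mxvec (V^T *m w)) i j = V ord0 i * w ord0 j.
Proof. by rewrite /seg mxvecE mxE big_ord1 !mxE. Qed.

(** The coordinate [v0] does not vanish on [X], so among the 2 x 2 minors those through the row [i0]
    already cut out the Segre image. *)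
Lemma segre_exists : exists W : qpvar F ((1 + N) * 2), segre X (affine_line F) W.
Proof.
have [i|W hW] := @lcset_eqs F _ 2 _ _ (enum 'I_(1 + N)) (fun i u =>
   seg u i j1 * seg u i0 ord0 - seg u i ord0 * seg u i0 j1) (lcset_pull X hc0).
  by apply: hpolyB; exact: (hpolyM (hseg _ _) (hseg _ _)).
exists W; rewrite /segre hW; apply/seteqP; split=> u /=.
  move=> [[un0 Xc] hu]; have s0 : seg u i0 ord0 != 0.
    by have := Xchart Xc; rewrite /v0 mxE.
  exists (c0 u), (\row_j (seg u i0 j / seg u i0 ord0)); split=> //.
    by apply/affine_lineE; rewrite mxE divff // oner_neq0.
  apply: mxvec_eq => i j; rewrite -mxvecE -/(seg _ i j) seg_mxvec !mxE.
  have [->|->] := ord2_cases j; first by rewrite divff // mulr1.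
  have := hu i; rewrite mem_enum => /(_ isT)/eqP; rewrite subr_eq0 => /eqP h.
  by rewrite mulrA -h mulfK.
move=> [V [w [XV /affine_lineE w0 ->]]].
have cE : c0 (mxvec (V^T *m w)) = w ord0 ord0 *: V.
  by apply/rowP => i; rewrite !mxE seg_mxvec mulrC.
have Xc : qpts X (c0 (mxvec (V^T *m w))) by rewrite cE; apply: qpts_scale.
split; last by move=> i _; rewrite !seg_mxvec; ring.
split=> //; apply: contraTneq (qpts_neq0 Xc) => ->.
by rewrite negbK; apply/eqP/rowP => i; rewrite /c0 /seg !mxE.
Qed.

(** The product relation is stated for Segre images, so the cylinder over [X] inside one chart has
    to be identified with the Segre image of [X] and the line: [phi] selects coordinates, and [psi]
    is quadratic. *)
Lemma cls_line (Z : qpvar F (1 + (N + 1))) :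
  qpts Z = [set v | v != 0 /\ qpts X (drop_last v)]%classic -> cls Z = cls X * L.
Proof.
move=> hZ; have [W hW] := segre_exists.
have -> : cls X * L = cls W.
  by rewrite !clsE -[LHS]kpiM; apply/kpiP/krel_prod.
pose phi (u : 'rV[F]_((1 + N) * 2)) : 'rV[F]_(1 + (N + 1)) :=
  row_mx (\row_(i < 1) seg u i0 ord0)
    (row_mx (\row_(i < N) seg u (rshift 1 i) ord0) (\row_(i < 1) seg u i0 j1)).
(* The last coordinate as a point of the line, homogenised by the same [v0]. *)
pose wv (v : 'rV[F]_(1 + (N + 1))) : 'rV[F]_2 := \row_j (if j == ord0 then v0 v else lst v).
pose psi v := mxvec ((drop_last v)^T *m wv v).
have dphi u : drop_last (phi u) = c0 u.
  rewrite /drop_last /phi row_mxKl row_mxKr row_mxKl; apply/rowP => i.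
  by case: (split_ordP i) => j ->; rewrite ?row_mxEl ?row_mxEr !mxE // ord1.
have v0phi u : v0 (phi u) = seg u i0 ord0 by rewrite /v0 row_mxEl mxE.
have lphi u : lst (phi u) = seg u i0 j1 by rewrite /lst row_mxEr row_mxEr mxE.
have psiE v i j : seg (psi v) i j = drop_last v ord0 i * (if j == ord0 then v0 v else lst v).
  by rewrite seg_mxvec [wv v _ _]mxE.
have drop0 v : drop_last v ord0 i0 = v0 v by rewrite /drop_last row_mxEl mxE.
have dropr v i : drop_last v ord0 (rshift 1 i) = v ord0 (rshift 1 (lshift 1 i)).
  by rewrite /drop_last row_mxEr !mxE.
have psiphi u : qpts W u -> psi (phi u) = seg u i0 ord0 *: u /\ seg u i0 ord0 != 0.
  rewrite hW => -[V [w [XV /affine_lineE w0 ->]]]; split; last first.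
    by rewrite seg_mxvec mulf_neq0 //; exact: Xchart XV.
  have segZ c u' i j : seg (c *: u') i j = c * seg u' i j by rewrite /seg mxE.
  have c0E u' i : c0 u' ord0 i = seg u' i ord0 by rewrite mxE.
  symmetry; apply: mxvec_eq => i j.
  rewrite -[RHS]mxvecE -/(seg _ i j) psiE dphi v0phi lphi segZ c0E !seg_mxvec.
  by have [->|->] := ord2_cases j; rewrite /=; ring.
have phipsi v : phi (psi v) = v0 v *: v.
  apply/rowP => i; case: (split_ordP i) => j ->.
    by rewrite /phi row_mxEl !mxE psiE /= drop0 ord1 /v0; congr (_ * v _ _); apply: val_inj; case: j => -[].
  rewrite /phi row_mxEr; case: (split_ordP j) => l ->.
    by rewrite row_mxEl !mxE psiE /= dropr mulrC.
  by rewrite row_mxEr !mxE psiE /= drop0 /lst [l]ord1.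
symmetry; apply: (@cls_iso _ _ _ W Z phi psi 1 2).
- move=> j; case: (split_ordP j) => i ->.
    by apply: hpoly_ext (hseg i0 ord0) _ => u; rewrite row_mxEl mxE.
  case: (split_ordP i) => l ->.
    by apply: hpoly_ext (hseg (rshift 1 l) ord0) _ => u; rewrite row_mxEr row_mxEl mxE.
  by apply: hpoly_ext (hseg i0 j1) _ => u; rewrite row_mxEr row_mxEr mxE.
- move=> k; case/mxvec_indexP: k => i j.
  apply: (@hpoly_ext _ _ _ (fun v => drop_last v ord0 i * (if j == ord0 then v0 v else lst v))).
    apply: (@hpolyM _ _ 1 1); last by case: (j == ord0); exact: hpoly_coord.
    case: (split_ordP i) => l ->.
      apply: hpoly_ext (hpoly_coord _ (lshift (N + 1) (ord0 : 'I_1))) _ => v.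
      by rewrite [l]ord1 -/i0 drop0.
    by apply: hpoly_ext (hpoly_coord _ (rshift 1 (lshift 1 l))) _ => v; rewrite dropr.
  by move=> v; rewrite -psiE.
- move=> u hu; rewrite hZ; have [_ s0] := psiphi u hu; split.
    by apply: contraNneq s0 => p0; rewrite -v0phi p0 /v0 mxE.
  by move: hu; rewrite dphi hW => -[V [w [XV /affine_lineE w0 ->]]];
    rewrite (_ : c0 _ = w ord0 ord0 *: V); [exact: qpts_scale|apply/rowP => i; rewrite !mxE seg_mxvec mulrC].
- move=> v; rewrite hZ => -[_ Xv]; rewrite hW; exists (drop_last v), (wv v); split=> //.
  by apply/affine_lineE; rewrite mxE /= -drop0; exact: Xchart Xv.
- by move=> u hu; have [-> s0] := psiphi u hu; exists (seg u i0 ord0).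
- move=> v; rewrite hZ => -[_ Xv]; exists (v0 v); last exact: phipsi.
  by rewrite -drop0; exact: Xchart Xv.
Qed.
End Line.

Lemma cc_line N (B : set 'rV[F]_N) : definable B -> cc (prod_space 1 B) = cc B * L.
Proof.
move=> hB; have [T [X [dX hX]]] := definable_fstrat hB.
have Xc t v : qpts (X t) v -> v0 v != 0 by move=> h; have [] := (hX v).1 (ex_intro _ t h).
have hdrop j : hpoly 1 (fun v : 'rV[F]_(1 + (N + 1)) => drop_last v ord0 j).
  case: (split_ordP j) => l ->.
    by apply: hpoly_ext (hpoly_coord _ (lshift (N + 1) l)) _ => v; rewrite /drop_last row_mxEl mxE.
  apply: hpoly_ext (hpoly_coord _ (rshift 1 (lshift 1 l))) _ => v.
  by rewrite /drop_last row_mxEr !mxE.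
have [Z hZ] := @boolp.choice _ _ (fun t (Z : qpvar F (1 + (N + 1))) =>
   qpts Z = [set v | v != 0 /\ qpts (X t) (drop_last v)]%classic)
   (fun t => lcset_pull (X t) hdrop).
rewrite (constr_classE (conj dX hX)) (@constr_classE _ _ _ T Z).
  by rewrite mulr_suml; apply: eq_bigr => t _; exact: cls_line (Xc t) _ (hZ t).
split=> [t u tu|v].
  rewrite !hZ; apply/seteqP; split=> v //= [[_ h1] [_ h2]].
  by have : (qpts (X t) `&` qpts (X u)) (drop_last v) by []; rewrite dX.
have e1 : v0 (drop_last v) = v0 v by rewrite /v0 /drop_last row_mxEl mxE.
have e2 : rest (drop_last v) = lsubmx (rest v).
  by rewrite /rest e1 /drop_last row_mxKr; apply/rowP => i; rewrite !mxE.
have := hX (drop_last v); rewrite e1 e2 => h.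
split=> [[t]|/h[t Xt]]; first by rewrite hZ => -[_ Xt]; apply/h; exists t.
exists t; rewrite hZ; split=> //.
apply: contraTneq (Xc _ _ Xt) => ->; rewrite negbK /drop_last /v0 row_mxEl !mxE.
by [].
Qed.

Lemma cc_prod_space N a (B : set 'rV[F]_N) : definable B -> cc (prod_space a B) = cc B * L ^+ a.
Proof.
elim: a N B => [|a IH] N B hB.
  rewrite expr0 mulr1; apply: (@cc_poly_iso _ _ _ _ (fun v => lsubmx v) (fun w => row_mx w 0)) => //.
  - exact: definable_prod_space.
  - exact/polymap_lsub/polymap_id.
  - by apply: polymap_row; [exact: polymap_id|exact: polymap_cst].
  - by move=> v Bv; split=> //; rewrite -[RHS]hsubmxK; congr row_mx; apply/rowP => -[].
  - by move=> w Bw; rewrite /prod_space /= row_mxKl.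
rewrite exprS mulrA -cc_line // -IH; last exact: definable_prod_space.
pose phi (v : 'rV[F]_(N + (1 + a))) : 'rV[F]_(N + 1 + a) :=
  row_mx (row_mx (lsubmx v) (lsubmx (rsubmx v))) (rsubmx (rsubmx v)).
pose psi (w : 'rV[F]_(N + 1 + a)) : 'rV[F]_(N + (1 + a)) :=
  row_mx (lsubmx (lsubmx w)) (row_mx (rsubmx (lsubmx w)) (rsubmx w)).
have id1 n := @polymap_id F n.
apply: (@cc_poly_iso _ _ _ _ phi psi).
- exact: definable_prod_space.
- exact/definable_prod_space/definable_prod_space.
- apply: polymap_row; last exact/polymap_rsub/polymap_rsub.
  by apply: polymap_row; [exact: polymap_lsub|exact/polymap_lsub/polymap_rsub].
- apply: polymap_row; first exact/polymap_lsub/polymap_lsub.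
  by apply: polymap_row; [exact/polymap_rsub/polymap_lsub|exact: polymap_rsub].
- by move=> v Bv; rewrite /prod_space /phi /psi /= !(row_mxKl, row_mxKr) !hsubmxK.
- by move=> w Bw; rewrite /prod_space /phi /psi /= !(row_mxKl, row_mxKr) !hsubmxK.
Qed.

Definition prod_punctured N (B : set 'rV[F]_N) : set 'rV[F]_(N + 1) :=
  [set v | B (lsubmx v) /\ rsubmx v ord0 ord0 != 0].

Lemma definable_prod_punctured N (B : set 'rV[F]_N) : definable B -> definable (prod_punctured B).
Proof.
move=> hB; apply: definableI; first exact: definable_prod_space.
by apply: (definable_ne (f := fun v => rsubmx v ord0 ord0)); exact/polymap_rsub/polymap_id.
Qed.

Lemma cc_prod_punctured N (B : set 'rV[F]_N) : definable B ->
  cc (prod_punctured B) = cc B * (L - 1).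
Proof.
move=> hB; pose B0 : set 'rV[F]_(N + 1) := [set v | B (lsubmx v) /\ rsubmx v ord0 ord0 = 0].
have dB0 : definable B0.
  apply: definableI; first exact: definable_prod_space.
  by apply: (definable_zero (f := fun v => rsubmx v ord0 ord0)); exact/polymap_rsub/polymap_id.
have e0 : cc B0 = cc B.
  apply: (@cc_poly_iso _ _ _ _ (fun v => lsubmx v) (fun w => row_mx w 0)) => //.
  - exact/polymap_lsub/polymap_id.
  - by apply: polymap_row; [exact: polymap_id|exact: polymap_cst].
  - move=> v [Bv v0]; split=> //; rewrite -[RHS]hsubmxK; congr row_mx.
    by apply/rowP => i; rewrite ord1 v0 mxE.
  - by move=> w Bw; rewrite /B0 /= row_mxKl row_mxKr mxE.
have := cc_line hB; have -> : prod_space 1 B = prod_punctured B `|` B0.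
  apply/seteqP; split=> v /=; last by case=> -[].
  move=> Bv; have [r0|rn0] := eqVneq (rsubmx v ord0 ord0) 0; first by right.
  by left.
have dis : prod_punctured B `&` B0 = set0.
  by apply/seteqP; split=> v // [[_ h] [_ h']]; move: h; rewrite h' eqxx.
rewrite (ccU (definable_prod_punctured hB) dB0 dis) e0 mulrBr mulr1 => <-.
by rewrite addrK.
Qed.

Lemma cc_point : cc [set: 'rV[F]_0] = 1.
Proof.
rewrite (@constr_classE _ _ _ unit (fun=> (point_var F : qpvar F (1 + 0)))).
  by rewrite big_const card_unit /= addr0 clsE -[RHS]/(kone F) koneE; apply/kpiP/krel_point.
split=> [[] []//|v]; split=> [[_]|[vn0 _]].
  rewrite qptsE /= => -[vn0 _ _]; split=> //; apply: contraNneq vn0 => h.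
  by apply/eqP/rowP => i; rewrite mxE -h /v0; congr (v _ _); apply: val_inj; case: i => -[].
exists tt; rewrite qptsE /=; split=> //; first by apply: contraNneq vn0 => ->; rewrite /v0 mxE.
by exists 1; rewrite ?mem_head // /peval meval1 oner_neq0.
Qed.
End Classes.
Arguments prod_space {F N} a B.

(** * The motivic measure on arcs *)

Section Jets.
Variable F : closedFieldType.
Notation L := (cls (affine_line F)).
Notation cc B := (constr_class B).

(** Makes arcs out of arbitrary series in a total way; on series without constant term it is the
    identity. *)
Definition strip0 (f : fps F) : fps F := Fps (fun i => if i == 0%N then 0 else f i).
Lemma strip0E (f : fps F) i : strip0 f i = if i == 0%N then 0 else f i. Proof. by []. Qed.
Lemma strip0_id (f : fps F) : f 0%N = 0 -> strip0 f = f.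
Proof. by move=> f0; apply: fpsP => -[|i]; rewrite strip0E ?f0. Qed.
Lemma strip0_0 (f : fps F) : strip0 f 0%N = 0. Proof. by []. Qed.
Definition mkarc (x y : fps F) : plane_arc F := PlaneArc (strip0_0 x) (strip0_0 y).

Definition seq_of_row n (r : 'rV[F]_n) : fps F :=
  Fps (fun i => if insub i.-1 is Some k then r ord0 k else 0).
Lemma seq_of_rowE n (r : 'rV[F]_n) (k : 'I_n) : seq_of_row r k.+1 = r ord0 k.
Proof. by rewrite /seq_of_row /= valK. Qed.

Definition arc_of_jet n (v : 'rV[F]_(n + n)) : plane_arc F :=
  mkarc (seq_of_row (lsubmx v)) (seq_of_row (rsubmx v)).

Definition agree n (g h : plane_arc F) : Prop :=
  forall i, (i <= n)%N -> arcx g i = arcx h i /\ arcy g i = arcy h i.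

Lemma jetP n g h : jet n g = jet n h <-> agree n g h.
Proof.
split=> [e [|i] ilt|hgh]; first by rewrite !arcx0 !arcy0.
  have := congr1 (fun v => lsubmx v ord0 (Ordinal ilt)) e.
  have := congr1 (fun v => rsubmx v ord0 (Ordinal ilt)) e.
  by rewrite !row_mxKl !row_mxKr !mxE.
by congr row_mx; apply/rowP => i; rewrite !mxE; have [] := hgh _ (ltn_ord i).
Qed.

Lemma arc_of_jetK n (v : 'rV[F]_(n + n)) : jet n (arc_of_jet v) = v.
Proof.
rewrite -[RHS]hsubmxK; congr row_mx; apply/rowP => i; rewrite mxE /=;
  by rewrite -[X in X = _]/(seq_of_row _ i.+1) seq_of_rowE.
Qed.

Lemma agree_trans n g h k : agree n g h -> agree n h k -> agree n g k.
Proof. by move=> e1 e2 i ilt; have [-> ->] := e1 i ilt; exact: e2. Qed.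
Lemma agreeW n m g h : (n <= m)%N -> agree m g h -> agree n g h.
Proof. by move=> nm e i ilt; apply: e; exact: leq_trans nm. Qed.
Lemma agree_jet n g : agree n (arc_of_jet (jet n g)) g.
Proof. by apply/jetP; rewrite arc_of_jetK. Qed.

Definition polyser N (f : 'rV[F]_N -> fps F) : Prop := forall i, polyfun (fun v => f v i).
Definition fracser N q (f : 'rV[F]_N -> fps F) : Prop := forall i, fracfun q (fun v => f v i).

Lemma polyser_strip0 N (f : 'rV[F]_N -> fps F) : polyser f -> polyser (fun v => strip0 (f v)).
Proof. by move=> hf [|i]; [exact: polyfun_const|exact: hf]. Qed.
Lemma fracser_strip0 N q (f : 'rV[F]_N -> fps F) : fracser q f -> fracser q (fun v => strip0 (f v)).
Proof. by move=> hf [|i]; [exact/fracfun_poly/polyfun_const|exact: hf]. Qed.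
Lemma polyser_row N n (phi : 'rV[F]_N -> 'rV[F]_n) : polymap phi ->
  polyser (fun v => seq_of_row (phi v)).
Proof.
move=> h i; rewrite /seq_of_row /=; case: insubP => [k _ _|_]; first exact: h.
exact: polyfun_const.
Qed.
Lemma polyser_jetx N n (phi : 'rV[F]_N -> 'rV[F]_(n + n)) : polymap phi ->
  polyser (fun v => arcx (arc_of_jet (phi v))).
Proof. by move=> h; exact/polyser_strip0/polyser_row/polymap_lsub. Qed.
Lemma polyser_jety N n (phi : 'rV[F]_N -> 'rV[F]_(n + n)) : polymap phi ->
  polyser (fun v => arcy (arc_of_jet (phi v))).
Proof. by move=> h; exact/polyser_strip0/polyser_row/polymap_rsub. Qed.

Lemma polymap_jet N n (T : 'rV[F]_N -> plane_arc F) :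
  polyser (fun v => arcx (T v)) -> polyser (fun v => arcy (T v)) ->
  polymap (fun v => jet n (T v)).
Proof.
move=> hx hy; apply: polymap_row => i.
  by apply: polyfun_ext (hx i.+1) _ => v; rewrite mxE.
by apply: polyfun_ext (hy i.+1) _ => v; rewrite mxE.
Qed.
Lemma fracmap_jet N n q (T : 'rV[F]_N -> plane_arc F) :
  fracser q (fun v => arcx (T v)) -> fracser q (fun v => arcy (T v)) ->
  fracmap q (fun v => jet n (T v)).
Proof.
move=> hx hy; apply: fracmap_row => i.
  by apply: fracfun_ext (hx i.+1) _ => v _; rewrite mxE.
by apply: fracfun_ext (hy i.+1) _ => v _; rewrite mxE.
Qed.

Definition trunc_arc n m (v : 'rV[F]_(m + m)) : 'rV[F]_(n + n) := jet n (arc_of_jet v).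
Lemma polymap_trunc n m : polymap (@trunc_arc n m).
Proof. by apply: polymap_jet; [exact/polyser_jetx/polymap_id|exact/polyser_jety/polymap_id]. Qed.

Definition raise n d (B : set 'rV[F]_(n + n)) : set 'rV[F]_((n + d) + (n + d)) :=
  [set v | B (trunc_arc n v)].
Arguments raise {n} d B.

Lemma definable_raise n d B : definable B -> definable (@raise n d B).
Proof. exact/definable_preim/polymap_trunc. Qed.

Lemma cylinder_raise n d B : cylinder (@raise n d B) = cylinder B.
Proof.
have e g : trunc_arc n (jet (n + d) g) = jet n g.
  by apply/jetP/agreeW/agree_jet/leq_addr.
by apply/seteqP; split=> g; rewrite /cylinder /raise /= e.
Qed.

Definition drop_arc n (g : plane_arc F) : plane_arc F :=
  mkarc (fdrop n (arcx g)) (fdrop n (arcy g)).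
Definition glue n (f g : fps F) : fps F := Fps (fun i => if (i <= n)%N then f i else g (i - n)%N).
Definition glue_arc n (g h : plane_arc F) : plane_arc F :=
  mkarc (glue n (arcx g) (arcx h)) (glue n (arcy g) (arcy h)).

Lemma glue_agree n d A D (g : plane_arc F) : agree n A g -> agree d D (drop_arc n g) ->
  agree (n + d) (glue_arc n A D) g.
Proof.
move=> hA hD i ilt; rewrite /glue_arc /mkarc /=; case: eqP => [->|/eqP i0].
  by rewrite arcx0 arcy0.
case: leqP => iN; first exact: hA.
have [] := hD (i - n)%N; first by lia.
rewrite /= (_ : (i - n == 0)%N = false); last by lia.
by rewrite subnKC ?(ltnW iN) // => -> ->.
Qed.
Lemma glue_parts n d (A D : plane_arc F) :
  agree n (glue_arc n A D) A /\ agree d (drop_arc n (glue_arc n A D)) D.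
Proof.
split=> i ilt; rewrite /glue_arc /drop_arc /mkarc /=.
  by case: eqP => [->|_]; rewrite ?arcx0 ?arcy0 ?ilt.
case: i ilt => [|i] ilt /=; first by rewrite arcx0 arcy0.
rewrite addn_eq0 andbF leqNgt -[X in (X < _)%N]addn0 ltn_add2l /= addKn.
by [].
Qed.
Lemma drop_agree n d (g h : plane_arc F) : agree (n + d) g h -> agree d (drop_arc n g) (drop_arc n h).
Proof.
move=> e i ilt; rewrite /drop_arc /mkarc /=; case: eqP => // _.
by apply: e; rewrite leq_add2l.
Qed.

(** An (n+d)-jet is an n-jet together with d further coefficients of each component. The factor
    L^(2d) cancels against the normalisation, so the measure does not depend on the level. *)
Lemma cc_raise n d (B : set 'rV[F]_(n + n)) : definable B ->
  cc (raise d B) = cc B * L ^+ (d + d).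
Proof.
move=> hB; rewrite -cc_prod_space //.
pose phi (v : 'rV[F]_((n + d) + (n + d))) : 'rV[F]_((n + n) + (d + d)) :=
  row_mx (trunc_arc n v) (jet d (drop_arc n (arc_of_jet v))).
pose psi (w : 'rV[F]_((n + n) + (d + d))) : 'rV[F]_((n + d) + (n + d)) :=
  jet (n + d) (glue_arc n (arc_of_jet (lsubmx w)) (arc_of_jet (rsubmx w))).
have pid k := @polymap_id F k.
have glue_poly N (f g : 'rV[F]_N -> fps F) : polyser f -> polyser g ->
    polyser (fun v => glue n (f v) (g v)).
  by move=> hf hg i; rewrite /glue /=; case: (i <= n)%N.
have drop_poly N (f : 'rV[F]_N -> fps F) : polyser f -> polyser (fun v => fdrop n (f v)).
  by move=> hf i; exact: hf.
apply: (@cc_poly_iso _ _ _ _ _ phi psi).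
- exact: definable_raise.
- exact: definable_prod_space.
- apply: polymap_row; first exact: polymap_trunc.
  by apply: polymap_jet; apply/polyser_strip0/drop_poly; [exact: polyser_jetx|exact: polyser_jety].
- apply: polymap_jet; apply/polyser_strip0/glue_poly.
  + exact/polyser_jetx/polymap_lsub.
  + exact/polyser_jetx/polymap_rsub.
  + exact/polyser_jety/polymap_lsub.
  + exact/polyser_jety/polymap_rsub.
- move=> v Bv; split; first by rewrite /prod_space /phi /= row_mxKl.
  rewrite /psi /phi row_mxKl row_mxKr -[RHS]arc_of_jetK; apply/jetP/glue_agree; exact: agree_jet.
- move=> w Bw; pose A := arc_of_jet (lsubmx w); pose D := arc_of_jet (rsubmx w).
  have [e1 e2] := glue_parts n d A D.
  have e : trunc_arc n (psi w) = lsubmx w.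
    rewrite -[RHS]arc_of_jetK; apply/jetP/agree_trans/e1.
    by apply: agreeW (agree_jet _); exact: leq_addr.
  split; first by rewrite /raise /= e.
  rewrite /phi e -[RHS]hsubmxK; congr row_mx; rewrite -[RHS]arc_of_jetK; apply/jetP.
  apply: agree_trans e2; apply: drop_agree; exact: agree_jet.
Qed.

Lemma LzD i j : Lz F i * Lz F j = Lz F (i + j).
Proof.
have Lzn (n : nat) k : L ^+ n * Lz F k = Lz F (n%:Z + k).
  elim: n => [|n IH]; first by rewrite mul1r add0r.
  by rewrite exprS -mulrA IH LzS -addn1 PoszD -addrA [k + 1]addrC addrA.
have Linvn (n : nat) k : Linv F ^+ n * Lz F k = Lz F (- n%:Z + k).
  elim: n => [|n IH]; first by rewrite mul1r oppr0 add0r.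
  by rewrite exprS -mulrA IH LzP -addn1 PoszD opprD -addrA [k - 1]addrC addrA.
case: i => n; first exact: Lzn.
by rewrite NegzE; exact: Linvn.
Qed.

Lemma cylinder_inj n (B B' : set 'rV[F]_(n + n)) : cylinder B = cylinder B' -> B = B'.
Proof.
move=> e; apply/seteqP; split=> v Bv; rewrite -[v]arc_of_jetK.
  by change (cylinder B' (arc_of_jet v)); rewrite -e /cylinder /= arc_of_jetK.
by change (cylinder B (arc_of_jet v)); rewrite e /cylinder /= arc_of_jetK.
Qed.

Definition jet_measure n (B : set 'rV[F]_(n + n)) : KL F := cc B * Lz F (- (2 * n)%:Z).

Lemma jet_measure_raise n d (B : set 'rV[F]_(n + n)) : definable B ->
  jet_measure (raise d B) = jet_measure B.
Proof.
move=> hB; have e : L ^+ (d + d) = Lz F (d + d)%:Z by [].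
have e2 : (d + d)%:Z + - (2 * (n + d))%:Z = - (2 * n)%:Z by lia.
by rewrite /jet_measure (cc_raise d hB) e -mulrA LzD e2.
Qed.

(** [chi] chooses a presentation. Two of them, at levels n and n', are both raised to level n + n',
    where the jet set is determined by the cylinder. *)
Lemma chiE n (B : set 'rV[F]_(n + n)) : definable B -> chi (cylinder B) = Mcls (jet_measure B).
Proof.
move=> hB; apply: xget_subset1.
  by exists n, B; split=> //; exact: definable_constructible.
suff uniq m : [set m | exists n (B0 : set 'rV[F]_(n + n)), [/\ constructible B0,
    cylinder B = cylinder B0 & m = Mcls (cc B0 * Lz F (- (2 * n)%:Z))]]%classic m ->
    m = Mcls (jet_measure B).
  by move=> a b /uniq-> /uniq->.
move=> [n' [B' [/constructible_definable hB' e ->]]]; rewrite -[_ * _]/(jet_measure B').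
rewrite -(jet_measure_raise n' hB) -(jet_measure_raise n hB').
have := cylinder_raise n' B; rewrite e -(cylinder_raise n B') => {}e.
have gen k k' (A : set 'rV[F]_(k + k)) (A' : set 'rV[F]_(k' + k')) : k = k' ->
    cylinder A = cylinder A' -> jet_measure A = jet_measure A'.
  by move=> kk; case: _ / kk A' => A' /cylinder_inj->.
by rewrite (gen _ _ _ _ (addnC n n') e).
Qed.

Lemma cylindric_def (A : set (plane_arc F)) : cylindric A <->
  exists n (B : set 'rV[F]_(n + n)), definable B /\ A = cylinder B.
Proof.
split=> -[n [B [hB ->]]]; exists n, B; split=> //.
  exact: constructible_definable.
exact: definable_constructible.
Qed.

Lemma cylindric_level (A : set (plane_arc F)) m : cylindric A ->
  exists d (B : set 'rV[F]_((m + d) + (m + d))), definable B /\ A = cylinder B.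
Proof.
move=> /cylindric_def[n [B [hB ->]]]; exists n; rewrite addnC.
by exists (raise m B); rewrite cylinder_raise; split=> //; exact: definable_raise.
Qed.

Lemma MclsD (a b : KL F) : Mcls (a + b) = Mcls a + Mcls b.
Proof.
rewrite /Mcls -mpiD. apply: (congr1 (@Defs.mpi F)); exact: cseqP.
Qed.
Lemma Mcls0 : Mcls (0 : KL F) = 0.
Proof. by apply: (addrI (Mcls 0)); rewrite -MclsD !addr0. Qed.
Lemma MclsZ (r : ZL F) (a : KL F) : r *: Mcls a = Mcls (ZLval r * a).
Proof.
rewrite -[LHS]/(mscale r (Mcls a)) /Mcls -mpiZ; apply: (congr1 (@Defs.mpi F)); exact: cseqP.
Qed.

Lemma cylinder0 n : cylinder (set0 : set 'rV[F]_(n + n)) = set0.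
Proof. by apply/seteqP; split. Qed.
Lemma cylindric0 : cylindric (set0 : set (plane_arc F)).
Proof. by apply/cylindric_def; exists 0%N, set0; rewrite cylinder0; split=> //; exact: definable0. Qed.
Lemma chi0 : chi (set0 : set (plane_arc F)) = 0.
Proof.
rewrite -(cylinder0 0) chiE; last exact: definable0.
by rewrite /jet_measure cc0 mul0r Mcls0.
Qed.

Lemma cylindric_common (A A' : set (plane_arc F)) : cylindric A -> cylindric A' ->
  exists n (B B' : set 'rV[F]_(n + n)), [/\ definable B, definable B', A = cylinder B & A' = cylinder B'].
Proof.
move=> /cylindric_def[n [B [hB ->]]] hA'; have [d [B' [hB' ->]]] := cylindric_level n hA'.
exists (n + d)%N, (raise d B), B'; split=> //; first exact: definable_raise.
by rewrite cylinder_raise.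
Qed.

Lemma cylindricU (A A' : set (plane_arc F)) : cylindric A -> cylindric A' -> cylindric (A `|` A').
Proof.
move=> hA hA'; have [n [B [B' [hB hB' -> ->]]]] := cylindric_common hA hA'.
by apply/cylindric_def; exists n, (B `|` B'); split=> //; exact: definableU.
Qed.

Lemma chiU (A A' : set (plane_arc F)) : cylindric A -> cylindric A' -> A `&` A' = set0 ->
  chi (A `|` A') = chi A + chi A'.
Proof.
move=> hA hA'; have [n [B [B' [hB hB' -> ->]]]] := cylindric_common hA hA' => dis.
have BB' : B `&` B' = set0.
  by apply: cylinder_inj; rewrite cylinder0 -dis.
rewrite -[_ `|` _]/(cylinder (B `|` B')) !chiE //; last exact: definableU.
by rewrite /jet_measure (ccU hB hB' BB') mulrDl MclsD.
Qed.
End Jets.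
Arguments raise {F n} d B.

(** * Swap, blow-up and shear acting on cylinders *)

Section Transforms.
Variable F : closedFieldType.
Notation L := (cls (affine_line F)).
Notation cc B := (constr_class B).

Lemma ZLval_Lpow i : ZLval (Lpow i : ZL F) = Lz F i. Proof. by []. Qed.

Definition swap_set (A : set (plane_arc F)) : set (plane_arc F) := [set g | A (swap_arc g)].

Lemma swap_cylinder n (B : set 'rV[F]_(n + n)) : definable B ->
  exists B' : set 'rV[F]_(n + n), [/\ definable B', swap_set (cylinder B) = cylinder B' & cc B' = cc B].
Proof.
move=> hB; pose sw (v : 'rV[F]_(n + n)) : 'rV[F]_(n + n) := row_mx (rsubmx v) (lsubmx v).
have psw : polymap sw.
  by apply: polymap_row; [exact/polymap_rsub/polymap_id|exact/polymap_lsub/polymap_id].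
have dB : definable [set v | B (sw v)] by exact: definable_preim psw hB.
have swK : involutive sw by move=> v; rewrite /sw row_mxKl row_mxKr hsubmxK.
exists [set v | B (sw v)]; split=> //.
  apply/seteqP; split=> g; rewrite /swap_set /cylinder /=;
    by rewrite (_ : sw (jet n g) = jet n (swap_arc g)) // /sw row_mxKl row_mxKr.
by apply: (@cc_poly_iso _ _ _ _ _ sw sw) => // v; rewrite /= swK.
Qed.

Lemma cylindric_swap (A : set (plane_arc F)) : cylindric A -> cylindric (swap_set A).
Proof.
move=> /cylindric_def[n [B [hB ->]]]; have [B' [hB' -> _]] := swap_cylinder hB.
by apply/cylindric_def; exists n, B'.
Qed.
Lemma chi_swap (A : set (plane_arc F)) : cylindric A -> chi (swap_set A) = chi A.
Proof.
move=> /cylindric_def[n [B [hB ->]]]; have [B' [hB' -> e]] := swap_cylinder hB.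
by rewrite (chiE hB) (chiE hB') /jet_measure e.
Qed.

Lemma fracser_poly N q (f : 'rV[F]_N -> fps F) : polyser f -> fracser q f.
Proof. by move=> h i; exact: fracfun_poly. Qed.
Lemma fracserM N q (f g : 'rV[F]_N -> fps F) : polyfun q ->
  fracser q f -> fracser q g -> fracser q (fun v => f v * g v).
Proof.
move=> hq hf hg i; apply: (@fracfun_ext _ _ _ (fun v => \sum_(j < i.+1) f v j * g v (i - j)%N)) => [|v _ //].
by apply: fracfun_sum => // j _; exact: fracfunM.
Qed.
Lemma polyserM N (f g : 'rV[F]_N -> fps F) : polyser f -> polyser g -> polyser (fun v => f v * g v).
Proof.
move=> hf hg i; apply: (@polyfun_ext _ _ (fun v => \sum_(j < i.+1) f v j * g v (i - j)%N)) => [|v //].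
by apply: polyfun_sum => j _; exact: polyfunM.
Qed.
Lemma polyserD N (f g : 'rV[F]_N -> fps F) : polyser f -> polyser g -> polyser (fun v => f v + g v).
Proof. by move=> hf hg i; exact: polyfunD (hf i) (hg i). Qed.
Lemma fracserD N q (f g : 'rV[F]_N -> fps F) : polyfun q ->
  fracser q f -> fracser q g -> fracser q (fun v => f v + g v).
Proof. by move=> hq hf hg i; exact: fracfunD (hf i) (hg i). Qed.
Lemma fracser_const N q (c : 'rV[F]_N -> F) : fracfun q c -> fracser q (fun v => fconst (c v)).
Proof. by move=> hc [|i]; [exact: hc|exact/fracfun_poly/polyfun_const]. Qed.
Lemma polyser_const N (c : 'rV[F]_N -> F) : polyfun c -> polyser (fun v => fconst (c v)).
Proof. by move=> hc [|i]; [exact: hc|exact: polyfun_const]. Qed.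
Lemma fracserX N q (f : 'rV[F]_N -> fps F) n : polyfun q -> fracser q f -> fracser q (fun v => f v ^+ n).
Proof.
move=> hq hf; elim: n => [|n IH].
  by apply: fracser_poly => i; exact: polyfun_const.
rewrite (_ : (fun v => f v ^+ n.+1) = fun v => f v * f v ^+ n); first exact: fracserM.
by apply: funext => v; rewrite exprS.
Qed.

(** The inverse without the case distinction of [fps_inv], so that its coefficients are visibly
    rational in those of [f], with powers of [f 0] as denominators. *)
Definition dinv (f : fps F) : fps F := fconst (f 0%N)^-1 * fgeom (1 - fconst (f 0%N)^-1 * f).
Lemma dinvP (f : fps F) : f 0%N != 0 -> dinv f * f = 1.
Proof.
move=> f0; rewrite /dinv mulrAC mulrC -{2}[fconst _ * f](subKr 1) fgeomE //.
by rewrite fcoefB fcoef1 fcoef_constM mulVf // subrr.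
Qed.

Lemma fcoef_expr_ext (f g : fps F) n m : (forall i, (i <= n)%N -> f i = g i) ->
  (f ^+ m) n = (g ^+ m) n.
Proof.
elim: m n => [//|m IH] n h; rewrite !exprS; apply: fcoef_mul_ext => // i lin.
by apply: IH => j ji; apply: h; exact: leq_trans lin.
Qed.
Lemma dinv_ext (f g : fps F) n : (forall i, (i <= n)%N -> f i = g i) -> dinv f n = dinv g n.
Proof.
move=> h; apply: fcoef_mul_ext => i lin; first by rewrite h.
rewrite /fgeom; apply: eq_bigr => j _; apply: fcoef_expr_ext => l li.
have ln : (l <= n)%N by exact: leq_trans li lin.
by rewrite !fcoefB !fcoef_constM !h.
Qed.

Lemma fracser_dinv N q (f : 'rV[F]_N -> fps F) : polyfun q -> (forall v, f v 0%N = q v) ->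
  fracser q f -> fracser q (fun v => dinv (f v)).
Proof.
move=> hq f0 hf.
have h1 : fracser q (fun v => fconst (f v 0%N)^-1).
  apply: fracser_const; apply: (@fracfun_ext _ _ _ (fun v => 1 / q v)) => [|v qv].
    by apply: fracfunV; apply: fracfun_poly; exact: polyfun_const.
  by rewrite f0 mul1r.
apply: fracserM => // i.
apply: (@fracfun_ext _ _ _ (fun v => \sum_(j < i.+1)
   ((1 - fconst (f v 0%N)^-1 * f v) ^+ j) i)) => [|v _ //].
apply: fracfun_sum => // j _; apply: fracserX => //.
apply: fracserD => //; first by apply: fracser_poly => l; exact: polyfun_const.
by move=> l; apply: fracfunN => //; apply: fracserM.
Qed.

Definition unblow k (g : plane_arc F) : plane_arc F :=
  mkarc (arcx g) (fdrop k (arcy g) * dinv (fdrop k (arcx g))).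

Lemma arcx_unblow k (g : plane_arc F) : arcx (unblow k g) = arcx g.
Proof. by rewrite [LHS]strip0_id // arcx0. Qed.

(** Dividing y by a series of order k costs k coefficients; hence a cylinder of level n is mapped to
    one of level n + k. *)
Lemma unblow_agree n k (g h : plane_arc F) : agree (n + k) g h -> agree n (unblow k g) (unblow k h).
Proof.
move=> e i ilt; have [ex _] := e i (leq_trans ilt (leq_addr k n)).
split; rewrite [LHS]strip0E [RHS]strip0E; case: eqP => // _.
apply: fcoef_mul_ext => j ji.
  by have [] := e (k + j)%N; first by lia.
by apply: dinv_ext => l lj; have [] := e (k + l)%N; first by lia.
Qed.
Lemma blow_agree n (g h : plane_arc F) : agree n g h -> agree n (blow_arc g) (blow_arc h).
Proof.
move=> e i ilt; split; first by have [] := e i ilt.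
by apply: (@fcoef_mul_ext _ (arcx g) (arcx h) (arcy g) (arcy h)) => j ji;
  have [] := e j (leq_trans ji ilt).
Qed.

Lemma fdrop_XM k (f : fps F) : fdrop k (fX k * f) = f.
Proof. by apply: fpsP => i; rewrite -[LHS]/((fX k * f) (k + i)%N) fcoef_XM leq_addr addKn. Qed.

Lemma unblowK k (g : plane_arc F) : ford (arcx g) k -> unblow k (blow_arc g) = g.
Proof.
move=> hx; have [xE x0] := ford_fdrop hx.
apply: plane_arcP; rewrite /=; first by rewrite strip0_id ?arcx0.
rewrite {1}xE -mulrA fdrop_XM mulrAC [_ * dinv _]mulrC dinvP // mul1r.
by rewrite strip0_id // arcy0.
Qed.

Lemma blowK k (g : plane_arc F) : ford (arcx g) k -> (forall i, (i <= k)%N -> arcy g i = 0) ->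
  blow_arc (unblow k g) = g.
Proof.
move=> hx hy; have [xE x0] := ford_fdrop hx.
have y0 : (fdrop k (arcy g) * dinv (fdrop k (arcx g))) 0%N = 0.
  by rewrite fcoefM0 /= addn0 hy ?mul0r.
apply: plane_arcP; rewrite /= strip0_id ?arcx0 // strip0_id //.
rewrite [X in X * _]xE mulrACA [fdrop k (arcx g) * _]mulrC dinvP // mulr1.
by rewrite -fdropP // => i ik; apply: hy; exact: ltnW.
Qed.

Lemma definable_forall N (I : finType) (A : I -> set 'rV[F]_N) :
  (forall i, definable (A i)) -> definable [set v | forall i, A i v].
Proof.
move=> h; rewrite (_ : [set v | _] = [set v | forall i, i \in enum I -> A i v]).
  exact: definable_bigI.
by apply/seteqP; split=> v hv i; [move=> _; exact: hv|apply: hv; rewrite mem_enum].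
Qed.

Definition blow_set (A : set (plane_arc F)) : set (plane_arc F) :=
  [set h | exists2 g, A g & h = blow_arc g].

(** Trades the existential in [blow_set] for conditions on finitely many coefficients, which are
    definable on jets. *)
Lemma blow_setE k (A : set (plane_arc F)) : (forall g, A g -> ford (arcx g) k) ->
  blow_set A = [set g | arcx g k != 0 /\
    (A (unblow k g) /\ forall i : 'I_k.+1, arcy g i = 0)].
Proof.
move=> hA; apply/seteqP; split=> g /=.
  move=> [h Ah ->]; have hx := hA _ Ah; rewrite unblowK //.
  split; first by case: hx.
  split=> // -[i /=]; rewrite ltnS => ik.
  rewrite -[LHS]/((arcx h * arcy h) i) fcoefM big_ord_recr /= subnn arcy0 mulr0 addr0 big1 // => -[j /= ji] _.
  by case: hx => _ -> //; [rewrite mul0r|exact: leq_trans ji ik].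
move=> [xk [Au hy]]; exists (unblow k g) => //; symmetry; apply: blowK.
  by have := hA _ Au; rewrite arcx_unblow.
by move=> i ik; exact: (hy (Ordinal (ik : i < k.+1)%N)).
Qed.

(** The (n+k)-jet of (x, x y) amounts to the n-jet of (x, y) and k further coefficients of x: in the
    product, coefficients of y beyond n only meet powers of s above n + k. Hence a factor L^k. *)
Lemma blow_cylinder n k (B' : set 'rV[F]_(n + n)) : (k <= n)%N -> definable B' ->
  (forall g, cylinder B' g -> ford (arcx g) k) ->
  exists B : set 'rV[F]_((n + k) + (n + k)),
    [/\ definable B, blow_set (cylinder B') = cylinder B & cc B = cc B' * L ^+ k].
Proof.
move=> kn hB' hA.
pose aj (v : 'rV[F]_((n + k) + (n + k))) := arc_of_jet v.
have kf : (0 < k)%N \/ forall g, ~ cylinder B' g.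
  case: k kn hA @aj => [|k] kn hA aj; last by left.
  by right => g /hA[]; rewrite arcx0 eqxx.
pose q v := arcx (aj v) k.
have hajx : polyser (fun v => arcx (aj v)) by exact/polyser_jetx/polymap_id.
have hajy : polyser (fun v => arcy (aj v)) by exact/polyser_jety/polymap_id.
have hq : polyfun q by exact: hajx.
pose un v := jet n (unblow k (aj v)).
have drop_poly N m (f : 'rV[F]_N -> fps F) : polyser f -> polyser (fun v => fdrop m (f v)).
  by move=> hf i; exact: hf.
have hun : fracmap q un.
  apply: fracmap_jet; apply: fracser_strip0; first exact: fracser_poly.
  apply: fracserM => //; first exact/fracser_poly/drop_poly.
  apply: fracser_dinv => //; last exact/fracser_poly/drop_poly.
  by move=> v; rewrite /= addn0.
pose B := [set v | q v != 0 /\ B' (un v)] `&`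
  [set v | forall i : 'I_k.+1, arcy (aj v) i = 0].
have dB : definable B.
  apply: definableI; first exact: definable_frac_preim.
  by apply: definable_forall => i; exact: definable_zero.
have BE : blow_set (cylinder B') = cylinder B.
  rewrite (blow_setE hA); have e g : agree (n + k) (aj (jet (n + k) g)) g by exact: agree_jet.
  have un_jet g : un (jet (n + k) g) = jet n (unblow k g).
    by apply/jetP/unblow_agree/e.
  have qE g : q (jet (n + k) g) = arcx g k by have [] := e g k (leq_addl n k).
  have yE g i : (i <= k)%N -> arcy (aj (jet (n + k) g)) i = arcy g i.
    by move=> ik; have [] := e g i (leq_trans ik (leq_addl n k)).
  have memB g : B (jet (n + k) g) <-> (q (jet (n + k) g) != 0 /\ B' (un (jet (n + k) g))) /\
      forall i : 'I_k.+1, arcy (aj (jet (n + k) g)) i = 0 by [].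
  apply/seteqP; split=> g; rewrite -[cylinder B g]/(B (jet (n + k) g)) memB un_jet qE.
    by move=> [xk [Bu hy]]; split=> // i; rewrite yE; [exact: hy|rewrite -ltnS].
  by move=> [[xk Bu] hy]; split=> //; split=> // i; rewrite -yE; [exact: hy|rewrite -ltnS].
exists B; split=> //; rewrite -cc_prod_space //.
pose phi v : 'rV[F]_((n + n) + k) := row_mx (un v) (\row_(i < k) arcx (aj v) (n + i.+1)%N).
pose tailx (r : 'rV[F]_k) : fps F := seq_of_row r.
pose back (w : 'rV[F]_((n + n) + k)) : plane_arc F :=
  blow_arc (mkarc (glue n (arcx (arc_of_jet (lsubmx w))) (seq_of_row (rsubmx w)))
                  (arcy (arc_of_jet (lsubmx w)))).
pose psi w : 'rV[F]_((n + k) + (n + k)) := jet (n + k) (back w).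
have pid m := @polymap_id F m.
apply: (@cc_iso _ _ _ _ _ q (fun=> 1) phi psi) => //.
- exact: definable_prod_space.
- exact: polyfun_const.
- apply: fracmap_row => // j.
  by apply: (@fracfun_ext _ _ _ (fun v => arcx (aj v) (n + j.+1)%N)) => [|v _]; [exact/fracfun_poly/hajx|rewrite mxE].
- apply: polymap_frac; have hX : polyser (fun w : 'rV[F]_((n + n) + k) =>
      strip0 (glue n (arcx (arc_of_jet (lsubmx w))) (seq_of_row (rsubmx w)))).
    apply: polyser_strip0 => i; rewrite /glue /=; case: (i <= n)%N.
      exact/polyser_jetx/polymap_lsub.
    exact/polyser_row/polymap_rsub.
  apply: polymap_jet => //; apply: polyserM => //.
  exact/polyser_strip0/polyser_jety/polymap_lsub.
- move=> v [[qv Bv] hy]; split=> //; first by rewrite /prod_space /phi /= row_mxKl.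
  rewrite /psi -[RHS]arc_of_jetK; apply/jetP.
  have hxk : ford (arcx (aj v)) k.
    by have := hA (unblow k (aj v)) Bv; rewrite arcx_unblow.
  have hyk i : (i <= k)%N -> arcy (aj v) i = 0.
    by move=> ik; exact: (hy (Ordinal (ik : i < k.+1)%N)).
  pose X := arcx (mkarc (glue n (arcx (arc_of_jet (un v))) (seq_of_row (\row_(i < k) arcx (aj v) (n + i.+1)%N)))
     (arcy (arc_of_jet (un v)))).
  have un_ag : agree n (arc_of_jet (un v)) (unblow k (aj v)) by exact: agree_jet.
  have XE i : (i <= n + k)%N -> X i = arcx (aj v) i.
    move=> ilt; rewrite -[X i]/(if i == 0%N then 0 else if (i <= n)%N
      then arcx (arc_of_jet (un v)) i
      else seq_of_row (\row_(i < k) arcx (aj v) (n + i.+1)%N) (i - n)%N).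
    case: eqP => [->|/eqP i0]; first by rewrite arcx0.
    case: leqP => iN.
      by have [-> _] := un_ag i iN; rewrite arcx_unblow.
    have hi : ((i - n).-1 < k)%N by lia.
    rewrite (_ : (i - n)%N = (Ordinal hi).+1); last by rewrite /=; lia.
    rewrite seq_of_rowE mxE; suff -> : (n + (Ordinal hi).+1)%N = i by [].
    by rewrite /=; lia.
  move=> i ilt; rewrite /back /phi row_mxKl row_mxKr; split; first exact: XE.
  rewrite -[X in _ = arcy X i](blowK hxk hyk).
  pose Y := strip0 (arcy (arc_of_jet (un v))).
  have YE : Y = arcy (arc_of_jet (un v)) by rewrite /Y strip0_id // arcy0.
  rewrite -[LHS]/((X * Y) i) -[RHS]/((arcx (unblow k (aj v)) * arcy (unblow k (aj v))) i).
  rewrite !fcoefM arcx_unblow YE; apply: eq_bigr => j _; have ji := ltn_ord j.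
  have jn : (j <= n + k)%N by lia.
  (* Only j >= k contributes, and then i - j <= n, where the n-jet of the source is known. *)
  rewrite XE //; have [jk|kj] := ltnP j k; first by case: hxk => _ ->; rewrite ?mul0r.
  have ij : (i - j <= n)%N by lia.
  by have [_ <-] := un_ag _ ij.
move=> w Bw; pose h := arc_of_jet (lsubmx w).
have hw : cylinder B' h by rewrite /cylinder /= arc_of_jetK.
have hxk := hA _ hw.
pose X := strip0 (glue n (arcx h) (seq_of_row (rsubmx w))).
pose h1 := mkarc (glue n (arcx h) (seq_of_row (rsubmx w))) (arcy h).
have X_eq i : (i <= n)%N -> arcx h1 i = arcx h i.
  move=> ilt; rewrite -[LHS]/(if i == 0%N then 0 else if (i <= n)%N then arcx h i
    else seq_of_row (rsubmx w) (i - n)%N) ilt.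
  by case: eqP => // ->; rewrite arcx0.
have Y_eq : arcy h1 = arcy h by rewrite [LHS]strip0_id // arcy0.
have h1k : ford (arcx h1) k.
  case: hxk => h2 h3; split; first by rewrite X_eq.
  by move=> i ik; rewrite X_eq ?h3 // (leq_trans (ltnW ik)).
have h1h : agree n h1 h by move=> i ilt; rewrite X_eq // Y_eq.
have ag : agree (n + k) (aj (psi w)) (blow_arc h1) by exact: agree_jet.
have unE : un (psi w) = lsubmx w.
  rewrite -[RHS]arc_of_jetK; apply/jetP; apply: agree_trans h1h.
  have := unblow_agree ag; rewrite unblowK //.
have qE : q (psi w) = arcx h1 k by have [] := ag k (leq_addl n k).
have blow0 (i : 'I_k.+1) : arcy (blow_arc h1) i = 0.
  have : blow_set (cylinder B') (blow_arc h).
    by exists h.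
  rewrite (blow_setE hA) => -[_ [_ /(_ i)]] <-.
  have ik : (i <= n)%N by rewrite (leq_trans _ kn) // -ltnS.
  by have [] := blow_agree h1h ik.
split; first exact: oner_neq0.
  split; first by split; [rewrite qE; case: h1k|rewrite unE].
  move=> i; have ik : (i <= n + k)%N by rewrite (leq_trans _ (leq_addl n k)) // -ltnS.
  by have [_ ->] := ag _ ik; exact: blow0.
rewrite /phi unE -[RHS]hsubmxK; congr row_mx; apply/rowP => i; rewrite mxE.
have ik : (n + i.+1 <= n + k)%N by rewrite leq_add2l.
have [-> _] := ag _ ik.
rewrite -[LHS]/(if (n + i.+1)%N == 0%N then 0 else if (n + i.+1 <= n)%N then arcx h (n + i.+1)%N
    else seq_of_row (rsubmx w) (n + i.+1 - n)%N).
have e1 : (n + i.+1 == 0)%N = false by lia.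
have e2 : (n + i.+1 <= n)%N = false by lia.
by rewrite e1 e2 addKn seq_of_rowE.
Qed.

Lemma blow_meas (A : set (plane_arc F)) k : cylindric A -> (forall g, A g -> ford (arcx g) k) ->
  cylindric (blow_set A) /\ chi (blow_set A) = Lpow (- k%:Z) *: chi A.
Proof.
move=> /(cylindric_level k)[d [B' [hB' ->]]] hA.
have [B [hB -> e]] := blow_cylinder (leq_addr d k) hB' hA.
split; first by apply/cylindric_def; exists (k + d + k)%N, B.
rewrite (chiE hB) (chiE hB') MclsZ ZLval_Lpow /jet_measure e.
have eL : L ^+ k = Lz F k%:Z by [].
(* The level grew by k, so the normalisation costs L^(-2k), of which the k free coefficients of x
   restore L^k. *)
have e2 : k%:Z + - (2 * (k + d + k))%:Z = - k%:Z + - (2 * (k + d))%:Z by lia.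
by rewrite eL -mulrA LzD e2 (mulrCA (Lz F (- k%:Z))) LzD.
Qed.

Definition shear_set (A : set (plane_arc F)) : set (plane_arc F) :=
  [set h | exists c g, [/\ c != 0, A g & h = shear_arc c g]].

Lemma shearK c (g : plane_arc F) : shear_arc (- c) (shear_arc c g) = g.
Proof. by apply: plane_arcP => //=; rewrite fconstN mulNr addrK. Qed.
Lemma shearNK c (g : plane_arc F) : shear_arc c (shear_arc (- c) g) = g.
Proof. by rewrite -{1}[c]opprK shearK. Qed.
Lemma shear_agree c n (g h : plane_arc F) : agree n g h -> agree n (shear_arc c g) (shear_arc c h).
Proof.
move=> e i ilt; have [e1 e2] := e i ilt; split=> //.
by rewrite -[LHS]/((arcy g + fconst c * arcx g) i) -[RHS]/((arcy h + fconst c * arcx h) i)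
  !fcoefD !fcoef_constM e1 e2.
Qed.

(** The ratio of leading coefficients recovers the shear parameter, because y of the source vanishes
    in degree k. *)
Definition slope k (g : plane_arc F) : F := arcy g k / arcx g k.

Lemma shear_slope k c (g : plane_arc F) : ford (arcx g) k -> arcy g k = 0 ->
  slope k (shear_arc c g) = c.
Proof.
move=> [xk _] yk; rewrite /slope -[arcy _ k]/((arcy g + fconst c * arcx g) k).
by rewrite fcoefD fcoef_constM yk add0r mulfK.
Qed.

Lemma shear_setE k (A : set (plane_arc F)) :
  (forall g, A g -> ford (arcx g) k /\ arcy g k = 0) ->
  shear_set A = [set g | arcx g k * arcy g k != 0 /\ A (shear_arc (- slope k g) g)].
Proof.
move=> hA; apply/seteqP; split=> g.
  move=> [c [h [c0 Ah ->]]]; have [hx hy] := hA _ Ah.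
  split; last by rewrite shear_slope // shearK.
  have := shear_slope c hx hy; rewrite /slope => e.
  have xk : arcx (shear_arc c h) k != 0 by case: hx.
  rewrite mulf_neq0 //; apply: contra_neq c0 => yk; rewrite -e yk mul0r.
  by [].
move=> [xyk As]; exists (slope k g), (shear_arc (- slope k g) g).
move: xyk; rewrite mulf_eq0 negb_or => /andP[xk yk]; split=> //.
  by rewrite mulf_neq0 // invr_eq0.
by rewrite shearNK.
Qed.

(** The level does not change, and [slope] trivialises the family: the image is the product of [B']
    with the punctured line of parameters c. *)
Lemma shear_cylinder n k (B' : set 'rV[F]_(n + n)) : (k <= n)%N -> definable B' ->
  (forall g, cylinder B' g -> ford (arcx g) k /\ arcy g k = 0) ->
  exists B : set 'rV[F]_(n + n),
    [/\ definable B, shear_set (cylinder B') = cylinder B & cc B = cc B' * (L - 1)].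
Proof.
move=> kn hB' hA.
pose aj (v : 'rV[F]_(n + n)) := arc_of_jet v.
have hajx : polyser (fun v => arcx (aj v)) by exact/polyser_jetx/polymap_id.
have hajy : polyser (fun v => arcy (aj v)) by exact/polyser_jety/polymap_id.
pose q v := arcx (aj v) k * arcy (aj v) k.
have hq : polyfun q by apply: polyfunM; [exact: hajx|exact: hajy].
have hslope : fracfun q (fun v => slope k (aj v)).
  (* The slope y_k / x_k rewritten as y_k^2 / (x_k y_k), over the denominator [q]. *)
  apply: (@fracfun_ext _ _ _ (fun v => arcy (aj v) k * arcy (aj v) k / q v)) => [|v].
    by apply: fracfunV; apply: fracfun_poly; apply: polyfunM; exact: hajy.
  rewrite /q /slope mulf_eq0 negb_or => /andP[xk yk].
  by field; rewrite xk yk.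
pose un v := jet n (shear_arc (- slope k (aj v)) (aj v)).
have hun : fracmap q un.
  apply: fracmap_jet; first exact: fracser_poly.
  apply: fracserD => //; first exact: fracser_poly.
  apply: fracserM => //; last exact: fracser_poly.
  by apply: fracser_const; apply: fracfunN.
pose B := [set v | q v != 0 /\ B' (un v)].
have dB : definable B by exact: definable_frac_preim.
have e g : agree n (aj (jet n g)) g by exact: agree_jet.
have slE g : slope k (aj (jet n g)) = slope k g.
  by rewrite /slope; have [-> ->] := e g k kn.
have BE : shear_set (cylinder B') = cylinder B.
  rewrite (shear_setE hA).
  have unE g : un (jet n g) = jet n (shear_arc (- slope k g) g).
    by rewrite /un slE; apply/jetP/shear_agree/e.
  have qE g : q (jet n g) = arcx g k * arcy g k by rewrite /q; have [-> ->] := e g k kn.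
  by apply/seteqP; split=> g; rewrite -[cylinder B g]/(q (jet n g) != 0 /\ B' (un (jet n g))) unE qE.
exists B; split=> //; rewrite -(cc_prod_punctured hB').
pose phi v : 'rV[F]_((n + n) + 1) := row_mx (un v) (\row_(i < 1) slope k (aj v)).
pose psi (w : 'rV[F]_((n + n) + 1)) : 'rV[F]_(n + n) :=
  jet n (shear_arc (rsubmx w ord0 ord0) (arc_of_jet (lsubmx w))).
have pid m := @polymap_id F m.
apply: (@cc_iso _ _ _ _ _ q (fun=> 1) phi psi) => //.
- exact: definable_prod_punctured.
- exact: polyfun_const.
- apply: fracmap_row => // j.
  by apply: fracfun_ext hslope _ => v _; rewrite mxE.
- apply: polymap_frac; apply: polymap_jet; first exact/polyser_jetx/polymap_lsub.
  apply: polyserD; first exact/polyser_jety/polymap_lsub.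
  apply: polyserM; last exact/polyser_jetx/polymap_lsub.
  by apply: polyser_const; exact/polymap_rsub.
- move=> v [qv Bv]; have [xk yk] : arcx (aj v) k != 0 /\ arcy (aj v) k != 0.
    by apply/andP; move: qv; rewrite /q mulf_eq0 negb_or.
  split=> //.
    split; rewrite /phi ?row_mxKl ?row_mxKr // mxE mulf_neq0 // invr_eq0 //.
  rewrite /psi /phi row_mxKl row_mxKr mxE -[RHS]arc_of_jetK; apply/jetP.
  have h1 : agree n (arc_of_jet (un v)) (shear_arc (- slope k (aj v)) (aj v)) by exact: agree_jet.
  have := shear_agree (slope k (aj v)) h1.
  by rewrite shearNK.
move=> w [Bw w0]; pose h := arc_of_jet (lsubmx w); pose c := rsubmx w ord0 ord0.
have hw : cylinder B' h by rewrite /cylinder /= arc_of_jetK.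
have [hx hy] := hA _ hw.
have sE : slope k (aj (psi w)) = c by rewrite slE shear_slope.
have unE : un (psi w) = lsubmx w.
  rewrite /un sE -[RHS]arc_of_jetK; apply/jetP.
  by have := shear_agree (- c) (e (shear_arc c h)); rewrite shearK.
split; first exact: oner_neq0.
  split; last by rewrite unE.
  have : shear_set (cylinder B') (shear_arc c h) by exists c, h.
  by rewrite (shear_setE hA) /q => -[qh _]; have [-> ->] := e (shear_arc c h) k kn.
rewrite /phi unE -[RHS]hsubmxK sE; congr row_mx; apply/rowP => i.
by rewrite mxE ord1.
Qed.

Lemma shear_meas (A : set (plane_arc F)) k : cylindric A ->
  (forall g, A g -> ford (arcx g) k /\ arcy g k = 0) ->
  cylindric (shear_set A) /\ chi (shear_set A) = (Lpow 1 - 1) *: chi A.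
Proof.
move=> /(cylindric_level k)[d [B' [hB' ->]]] hA.
have [B [hB -> e]] := shear_cylinder (leq_addr d k) hB' hA.
split; first by apply/cylindric_def; exists (k + d)%N, B.
rewrite (chiE hB) (chiE hB') MclsZ /jet_measure e.
by rewrite mulrAC mulrC.
Qed.
End Transforms.

Section CylindricAlgebra.
Variable F : closedFieldType.

Lemma cylindricI (A A' : set (plane_arc F)) : cylindric A -> cylindric A' -> cylindric (A `&` A').
Proof.
move=> hA hA'; have [n [B [B' [hB hB' -> ->]]]] := cylindric_common hA hA'.
by apply/cylindric_def; exists n, (B `&` B'); split=> //; exact: definableI.
Qed.
Lemma cylindricC (A : set (plane_arc F)) : cylindric A -> cylindric (~` A).
Proof.
move=> /cylindric_def[n [B [hB ->]]].
by apply/cylindric_def; exists n, (~` B); split=> //; exact: definableC.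
Qed.
Lemma cylindric_y0 i : cylindric [set g : plane_arc F | arcy g i = 0].
Proof.
apply/cylindric_def; exists i, [set v | arcy (arc_of_jet v) i = 0]; split.
  apply: (definable_zero (f := fun v => arcy (arc_of_jet v) i)).
  exact: (polyser_jety (@polymap_id F _)).
have e g : arcy (arc_of_jet (jet i g)) i = arcy g i by have [_ ->] := agree_jet g (leqnn i).
by apply/seteqP; split=> g;
  rewrite -[cylinder _ g]/(arcy (arc_of_jet (jet i g)) i = 0) e.
Qed.
Lemma cylindricT : cylindric [set: plane_arc F].
Proof. by rewrite -setC0; apply/cylindricC/cylindric0. Qed.
Lemma cylindric_forall (A : nat -> set (plane_arc F)) k : (forall i, cylindric (A i)) ->
  cylindric [set g | forall i, (i < k)%N -> A i g].
Proof.
move=> hA; elim: k => [|k IH].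
  by rewrite (_ : [set g | _] = setT); [exact: cylindricT|apply/seteqP; split].
rewrite (_ : [set g | _] = [set g | forall i, (i < k)%N -> A i g] `&` A k).
  exact: cylindricI.
apply/seteqP; split=> g; first by move=> h; split=> [i ik|]; apply: h => //; exact: ltnW.
by move=> [h hk] i; rewrite ltnS leq_eqVlt => /orP[/eqP->|/h].
Qed.
Lemma cylindric_ordy m : cylindric [set g : plane_arc F | ford (arcy g) m].
Proof.
rewrite (_ : [set g | _] = ~` [set g : plane_arc F | arcy g m = 0] `&`
  [set g | forall i, (i < m)%N -> arcy g i = 0]).
  apply: cylindricI; first exact/cylindricC/cylindric_y0.
  by apply: cylindric_forall => i; exact: cylindric_y0.
apply/seteqP; split=> g; first by move=> [h1 h2]; split=> //; exact/eqP.
by move=> [h1 h2]; split=> //; exact/eqP.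
Qed.
Lemma cylindric_ordx m : cylindric [set g : plane_arc F | ford (arcx g) m].
Proof. exact: (cylindric_swap (cylindric_ordy m)). Qed.
End CylindricAlgebra.

(** * The level sets of the Milnor number *)

Section Levels.
Variable F : closedFieldType.
Hypothesis char0 : forall n, n.+1%:R != 0 :> F.

Lemma mu_level_swap k m n : mu_level F m k n = swap_set (mu_level F k m n).
Proof.
by apply/seteqP; split=> g -[h1 h2 h3]; split=> //; apply/milnor_swap.
Qed.

Lemma ford_blow (g : plane_arc F) k m : ford (arcx g) k ->
  ford (arcy (blow_arc g)) (k + m) <-> ford (arcy g) m.
Proof.
move=> hx; split=> [hy|]; last exact: fordM.
have y0 : arcy g != 0.
  apply/eqP => y0; have := ford_neq0 hy.
  by rewrite -[arcy _]/(arcx g * arcy g) y0 mulr0 eqxx.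
have := ford_ordf hy; rewrite ordfM ?(ford_neq0 hx) // (ford_ordf hx).
by move/addnI => <-; exact: ordfP.
Qed.

Lemma mu_level_blow k m n : (k < m)%N ->
  mu_level F k m n = if (k * (k - 1) <= n)%N
    then blow_set (mu_level F k (m - k) (n - k * (k - 1))) else set0.
Proof.
move=> km; have mE : m = (k + (m - k))%N by rewrite subnKC // ltnW.
have fwd g : mu_level F k m n g -> exists n', [/\ n = (n' + k * (k - 1))%N,
    mu_level F k (m - k) n' (unblow k g) & g = blow_arc (unblow k g)].
  move=> [hx hy hn]; have gE : blow_arc (unblow k g) = g.
    by apply: blowK => // i ik; case: hy => _ -> //; exact: leq_ltn_trans km.
  have hx' : ford (arcx (unblow k g)) k by rewrite arcx_unblow.
  move: hn hy; rewrite -{1 2}gE mE => /(milnor_blowup char0 _ hx')[n' -> hn'] /(ford_blow _ hx') hy.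
  by exists n'; rewrite -mE; split.
apply/seteqP; split=> g.
  move=> /fwd[n' [-> h1 h2]]; rewrite leq_addl addnK.
  by exists (unblow k g).
case: leqP => // kn [h [hx hy hn] ->]; split=> //.
  by rewrite mE; apply/ford_blow.
apply/(milnor_blowup char0 _ hx); exists (n - k * (k - 1))%N => //.
by rewrite subnK.
Qed.

(** Arcs with ord y > M, including y = 0 where that is primitive. For M = k this is a level of the
    set T, and the remainders of the sum over m have the same form. *)
Definition tail k M n : set (plane_arc F) :=
  [set g | [/\ ford (arcx g) k, forall i, (i <= M)%N -> arcy g i = 0 & milnor g n]].

Lemma tailS k M n : tail k M n = mu_level F k M.+1 n `|` tail k M.+1 n.
Proof.
apply/seteqP; split=> g.
  move=> [hx hy hn]; have [yM|yM] := eqVneq (arcy g M.+1) 0.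
    by right; split=> // i; rewrite leq_eqVlt => /orP[/eqP->|/hy].
  by left; split.
move=> [[hx [_ hy] hn]|[hx hy hn]]; split=> // i ilt; apply: hy => //.
exact: leqW.
Qed.
Lemma tail_disjoint k M n : mu_level F k M.+1 n `&` tail k M.+1 n = set0.
Proof. by apply/seteqP; split=> g // [[_ [h _] _] [_ h' _]]; move: h; rewrite h' ?eqxx. Qed.

Lemma mu_level_diag k n : mu_level F k k n = shear_set (tail k k n).
Proof.
apply/seteqP; split=> g.
  move=> [hx hy hn]; exists (slope k g), (shear_arc (- slope k g) g).
  have [xk xl] := hx; have [yk yl] := hy.
  split; first by rewrite mulf_neq0 // invr_eq0.
    split=> //; last by apply/(milnor_shear char0 _ _ hx).
    move=> i; rewrite -[X in _ -> X = _]/((arcy g + fconst (- slope k g) * arcx g) i).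
    rewrite fcoefD fcoef_constM leq_eqVlt => /orP[/eqP->|ik].
      by rewrite mulNr divfK // subrr.
    by rewrite xl // yl // mulr0 addr0.
  by rewrite shearNK.
move=> [c [h [c0 [hx hy hn] ->]]]; split=> //; last by apply/(milnor_shear char0 _ _ hx).
have [xk xl] := hx.
split=> [|i ik].
  rewrite -[X in X != _]/((arcy h + fconst c * arcx h) k) fcoefD fcoef_constM hy // add0r.
  exact: mulf_neq0.
rewrite -[LHS]/((arcy h + fconst c * arcx h) i) fcoefD fcoef_constM hy ?(ltnW ik) //.
by rewrite xl // mulr0 addr0.
Qed.

(** Each blow-up consumes k from [m] and k (k - 1) >= 1 from [n], so [n] is exhausted first when m >
    k (n + 1). *)
Lemma mu_level_empty k m n : (2 <= k)%N -> (k * n.+1 < m)%N -> mu_level F k m n = set0.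
Proof.
move=> k2; elim/ltn_ind: n m => n IH m hm.
have kk : (0 < k * (k - 1))%N by rewrite muln_gt0 subn_gt0 k2 andbT ltnW.
have km : (k < m)%N by apply: leq_ltn_trans hm; rewrite leq_pmulr.
rewrite mu_level_blow //; case: leqP => // kn.
rewrite IH; first by apply/seteqP; split=> g // -[].
  by rewrite -{2}[n]subn0 ltn_sub2l // (leq_trans kk).
have := leq_mul (leqnn k) (leq_trans kk kn); move: hm kn; rewrite mulnS => hm kn _.
have : (k * (n - k * (k - 1)).+1 <= k * n)%N by rewrite leq_mul2l; lia.
lia.
Qed.

Lemma tail_empty k M n : (2 <= k)%N -> (k * n.+1 <= M)%N -> tail k M n = set0.
Proof.
move=> k2 hM; apply/seteqP; split=> // g [hx hy hn].
have [y0|/ordfP hm] := eqVneq (arcy g) 0; last first.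
  suff : mu_level F k (ordf (arcy g)) n g by rewrite mu_level_empty // (leq_ltn_trans hM) // ltnNge; apply/negP => /hy /eqP; case: hm => /negP.
  by split.
(* For y = 0 the arc is (s, 0) composed with x(s), and ord x >= 2 contradicts primitivity. *)
case: hn => -[]; have X0 : (fX 1 : fps F) 0%N = 0 by [].
have Z0 : (0 : fps F) 0%N = 0 by [].
exists (PlaneArc X0 Z0), (arcx g); split.
- exact: arcx0.
- by case: hx => _ ->.
- by rewrite /= fcomp_X1 // arcx0.
- by rewrite y0 /= (rmor0 (rmor_fcomp (arcx0 g))).
Qed.

Lemma mu_level_smooth m n : (0 < m)%N -> mu_level F 1 m n =
  if n == 0%N then [set g | ford (arcx g) 1 /\ ford (arcy g) m] else set0.
Proof.
move=> m0; apply/seteqP; split=> g.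
  by move=> [hx hy]; rewrite (milnor_smooth char0 _ hx) => ->.
case: eqP => // -> [hx hy]; split=> //; exact/(milnor_smooth char0 _ hx).
Qed.
Lemma tail_smooth M n : tail 1 M n =
  if n == 0%N then [set g | ford (arcx g) 1 /\ forall i, (i < M.+1)%N -> arcy g i = 0] else set0.
Proof.
apply/seteqP; split=> g.
  by move=> [hx hy]; rewrite (milnor_smooth char0 _ hx) => ->.
case: eqP => // -> [hx hy]; split=> //; exact/(milnor_smooth char0 _ hx).
Qed.

(** Descending induction from M = k (n + 1), where the tail is empty: at fixed [n] it is a finite
    union of levels. *)
Lemma tail_cylindric_above k n : (2 <= k)%N ->
  (forall m, (k < m)%N -> cylindric (mu_level F k m n)) ->
  forall M, (k <= M)%N -> cylindric (tail k M n).
Proof.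
move=> k2 h M kM; have [d] := ubnP (k * n.+1 - M)%N; elim: d M kM => // d IH M kM hd.
have [hM|hM] := leqP (k * n.+1) M; first by rewrite tail_empty //; exact: cylindric0.
by rewrite tailS; apply: cylindricU; [apply: h; rewrite ltnS|apply: IH; [exact: leqW|lia]].
Qed.

Lemma mu_level_above n :
  (forall n', (n' < n)%N -> forall k m, (0 < k)%N -> (0 < m)%N -> cylindric (mu_level F k m n')) ->
  forall k m, (2 <= k)%N -> (k < m)%N -> cylindric (mu_level F k m n).
Proof.
move=> IH k m k2 km; rewrite mu_level_blow //; case: leqP => kn; last exact: cylindric0.
have k0 : (0 < k)%N by exact: ltnW.
have kk : (0 < k * (k - 1))%N by rewrite muln_gt0 subn_gt0 k2 k0.
have c : cylindric (mu_level F k (m - k) (n - k * (k - 1))).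
  by apply: IH; rewrite ?subn_gt0 // -{2}[n]subn0 ltn_sub2l // (leq_trans kk).
by have [] := @blow_meas F _ k c (fun g h => let: And3 a _ _ := h in a).
Qed.

Lemma shear_tail k n : cylindric (tail k k n) ->
  cylindric (mu_level F k k n) /\
  chi (mu_level F k k n) = (Lpow 1 - 1) *: chi (tail k k n).
Proof.
move=> c; rewrite mu_level_diag; apply: (@shear_meas F _ k c) => g [hx hy _].
by split=> //; exact: hy.
Qed.

(** The induction is on [n], not on k + m: a diagonal level is sheared from a tail, a finite union
    of levels above the diagonal with the same [n], and for k >= 2 those come by blow-up from levels
    with smaller [n]. *)
Lemma mu_level_cylindric k m n : (0 < k)%N -> (0 < m)%N -> cylindric (mu_level F k m n).
Proof.
elim/ltn_ind: n k m => n IH.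
have smooth m : (0 < m)%N -> cylindric (mu_level F 1 m n).
  move=> m0; rewrite mu_level_smooth //; case: eqP => _; last exact: cylindric0.
  exact: cylindricI (cylindric_ordx F 1) (cylindric_ordy F m).
have above := mu_level_above IH.
have half k m : (0 < k)%N -> (k <= m)%N -> cylindric (mu_level F k m n).
  case: k => [//|[|k]] _ km; first exact: smooth.
  move: km; rewrite leq_eqVlt => /orP[/eqP<-|]; last exact: above.
  have [] // := @shear_tail k.+2 n; apply: tail_cylindric_above => // m'.
  exact: above.
move=> k m k0 m0; have [km|mk] := leqP k m; first exact: half.
by rewrite mu_level_swap; apply/cylindric_swap/half => //; exact: ltnW.
Qed.

Lemma tail_cylindric k M n : (0 < k)%N -> (k <= M)%N -> cylindric (tail k M n).
Proof.
case: k => [//|[|k]] _ kM; last first.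
  apply: tail_cylindric_above => // m km; apply: mu_level_cylindric => //.
  exact: leq_trans km.
rewrite tail_smooth; case: eqP => _; last exact: cylindric0.
apply: cylindricI (cylindric_ordx F 1) _.
by apply: cylindric_forall => i; exact: cylindric_y0.
Qed.

Lemma chi_blow_level k m n : (0 < k)%N -> (k < m)%N -> chi (mu_level F k m n) =
  if (k * (k - 1) <= n)%N then Lpow (- k%:Z) *: chi (mu_level F k (m - k) (n - k * (k - 1))) else 0.
Proof.
move=> k0 km; rewrite mu_level_blow //; case: leqP => _; last exact: chi0.
have c : cylindric (mu_level F k (m - k) (n - k * (k - 1))).
  by apply: mu_level_cylindric => //; rewrite subn_gt0.
by have [_] := @blow_meas F _ k c (fun g h => let: And3 a _ _ := h in a).
Qed.

Lemma chi_swap_level k m n : (0 < k)%N -> (0 < m)%N ->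
  chi (mu_level F m k n) = chi (mu_level F k m n).
Proof. by move=> k0 m0; rewrite mu_level_swap chi_swap //; exact: mu_level_cylindric. Qed.

(** Below the diagonal the missing orders are added one at a time. The case M = 0, all arcs with ord
    x = k, is the source of the blow-up onto T. *)
Lemma tail_cylindric_all k M n : (0 < k)%N -> cylindric (tail k M n).
Proof.
move=> k0; have [d] := ubnP (k - M)%N; elim: d M => // d IH M hd.
have [kM|Mk] := leqP k M; first exact: tail_cylindric.
rewrite tailS; apply: cylindricU; first exact: mu_level_cylindric.
by apply: IH; lia.
Qed.

(** Only finite additivity is available, so the remainder is kept explicitly; convergence amounts to
    its tending to 0. *)
Lemma chi_tail_sum k M n N : (0 < k)%N ->
  chi (tail k M n) = \sum_(i < N) chi (mu_level F k (M + i.+1) n) + chi (tail k (M + N) n).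
Proof.
move=> k0; elim: N => [|N IH]; first by rewrite big_ord0 add0r addn0.
rewrite IH big_ord_recr -addrA; congr (_ + _).
rewrite [in LHS]tailS chiU ?addnS //.
- exact: mu_level_cylindric.
- exact: tail_cylindric_all.
- exact: tail_disjoint.
Qed.

Lemma blow_tail (g : plane_arc F) k M : ford (arcx g) k ->
  (forall i, (i <= k + M)%N -> arcy (blow_arc g) i = 0) <->
  (forall i, (i <= M)%N -> arcy g i = 0).
Proof.
move=> hx; split=> hy i ilt.
  have [->//|/ordfP hd] := eqVneq (arcy g) 0.
  have [hi|hi] := ltnP i (ordf (arcy g)); first by case: hd => _; apply.
  have [/eqP h _] := fordM hx hd; case: h; apply: hy.
  by rewrite leq_add2l (leq_trans hi).
rewrite -[LHS]/((arcx g * arcy g) i) fcoefM big1 // => -[j /= ji] _.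
have [jk|kj] := ltnP j k; first by case: hx => _ ->; rewrite ?mul0r.
by rewrite hy ?mulr0 //; lia.
Qed.

Lemma tail_blow k M n : tail k (k + M) n =
  if (k * (k - 1) <= n)%N then blow_set (tail k M (n - k * (k - 1))) else set0.
Proof.
apply/seteqP; split=> g.
  move=> [hx hy hn]; have gE : blow_arc (unblow k g) = g.
    by apply: blowK => // i ik; apply: hy; exact: leq_trans ik (leq_addr _ _).
  have hx' : ford (arcx (unblow k g)) k by rewrite arcx_unblow.
  move: hn hy; rewrite -{1 2}gE.
  move=> /(milnor_blowup char0 _ hx')[n' -> hn'] /(blow_tail _ hx') hy.
  by rewrite leq_addl addnK; exists (unblow k g).
case: leqP => // kn [h [hx hy hn] ->]; split=> //.
  exact/(blow_tail _ hx).
apply/(milnor_blowup char0 _ hx); exists (n - k * (k - 1))%N => //.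
by rewrite subnK.
Qed.

Lemma chi_tail_blow k M n : (0 < k)%N -> chi (tail k (k + M) n) =
  if (k * (k - 1) <= n)%N then Lpow (- k%:Z) *: chi (tail k M (n - k * (k - 1))) else 0.
Proof.
move=> k0; rewrite tail_blow; case: leqP => _; last exact: chi0.
have c : cylindric (tail k M (n - k * (k - 1))) by exact: tail_cylindric_all.
by have [_] := @blow_meas F _ k c (fun g h => let: And3 a _ _ := h in a).
Qed.
End Levels.

(** * The generating series *)

Section FpsScale.
Variables (R : comPzRingType) (V : lmodType R).
Implicit Types f : fps V.

Lemma fcoefZ (a : fps R) f n : (a *: f) n = \sum_(i < n.+1) a i *: f (n - i)%N.
Proof. by []. Qed.
Lemma fcoef_monoZ (c : R) k f n :
  (fmono c k *: f) n = if (k <= n)%N then c *: f (n - k)%N else 0.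
Proof.
rewrite fcoefZ; case: leqP => kn.
  have h : (k < n.+1)%N by [].
  rewrite (bigD1 (Ordinal h)) //= big1 ?addr0 ?eqxx // => -[i /= ik] hi.
  by rewrite ifN ?scale0r //; move: hi; rewrite -val_eqE.
rewrite big1 // => -[i /= ik] _; rewrite ifN ?scale0r //.
by apply: contraTneq kn => <-; rewrite -leqNgt.
Qed.
Lemma fcoef_constZ (c : R) f n : (fconst c *: f) n = c *: f n.
Proof. by rewrite fcoef_monoZ subn0. Qed.
End FpsScale.

(** * Convergence in the completion *)

Section Completion.
Variable F : closedFieldType.

(** A point has dimension 0: a nonempty closed subset of P^0 is everything, so strict chains have
    length 0. *)
Lemma filt_Lz k (m : int) : k <= m -> filt k (Lz F (- m)).
Proof.
move=> km; have -> : Lz F (- m) = cls (point_var F) * Lz F (- m).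
  by rewrite clsE (_ : kpi _ = 1) ?mul1r // -[RHS]/(kone F) koneE; apply/kpiP/krel_point.
apply: filt_gen => d Z irr str.
have full i : (i <= d)%N -> Z i = qpts (point_var F).
  move=> /irr[[s hs ->] [v [Xv [_ hv]]] _].
  apply/seteqP; split=> w; first by case.
  move=> Xw; split=> //; split; first exact: qpts_neq0 Xw.
  have v0 : v ord0 ord0 != 0.
    apply: contra_neq (qpts_neq0 Xv) => h; apply/rowP => j.
    by rewrite ord1 h mxE.
  have wE : w = (w ord0 ord0 / v ord0 ord0) *: v.
    by apply/rowP => j; rewrite ord1 mxE divfK.
  have w0 : w ord0 ord0 / v ord0 ord0 != 0.
    apply: contra_neq (qpts_neq0 Xw) => h; by rewrite wE h scale0r.
  by move=> p ps; apply/eqP; rewrite wE (peval_scale _ (allP hs _ ps) w0); apply/eqP/hv.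
case: d irr str full => [|d] _ str full; first by rewrite subr_ge0.
have [_ []] := str 0%N isT.
by rewrite (full 0%N) // (full 1%N).
Qed.

Lemma Mfilt_Mcls k a : filt k a -> @Mfilt F k (Mcls a).
Proof.
move=> ha; have /mpiP/asboolP/(_ k)[N hN] : Defs.mpi (mrepr (Mcls a)) = Mcls a by exact: mreprK.
exists N => i /hN h; rewrite -[cval _ i](subrK a); exact: filtD h ha.
Qed.

Lemma Mfilt0 k : @Mfilt F k (0 : Mhat F).
Proof. rewrite -Mcls0; apply: Mfilt_Mcls; exact: filt0. Qed.

(** Multiplication by [a] shifts the filtration by a constant, while L^(-n) lies arbitrarily deep in
    it. *)
Lemma Mcls_geometric (a : KL F) (k : int) : laurent a ->
  exists N, forall n, (N <= n)%N -> @Mfilt F k (Mcls (Lz F (- n%:Z) * a)).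
Proof.
move=> /laurent_filt[c hc]; exists `|(k + c)%R|%N => n hn.
rewrite mulrC; apply/Mfilt_Mcls/hc/filt_Lz; lia.
Qed.
End Completion.

Section Identities.
Variable F : closedFieldType.
Hypothesis char0 : forall n, n.+1%:R != 0 :> F.
Notation L := (cls (affine_line F)).
Notation G k m := (G_mu F k m).

Lemma LpowD i j : Lpow i * Lpow j = Lpow (i + j) :> ZL F.
Proof. apply: val_inj; exact: LzD. Qed.
Lemma Lpow0 : Lpow 0 = 1 :> ZL F.
Proof. exact: val_inj. Qed.

Lemma G_swap k m : (0 < k)%N -> (0 < m)%N -> G k m = G m k.
Proof. by move=> k0 m0; apply: fpsP => n; exact: (chi_swap_level char0). Qed.

Lemma G_blow k m : (0 < k)%N -> (k < m)%N ->
  G k m = fmono (Lpow (- k%:Z)) (k * (k - 1)) *: G k (m - k)%N.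
Proof.
move=> k0 km; apply: fpsP => n; rewrite fcoef_monoZ; exact: (chi_blow_level char0 n k0 km).
Qed.

Definition G_tail k : fps (Mhat F) := Fps (fun n => chi (tail k k n)).

Lemma G_diag k : (0 < k)%N -> G k k = fconst (Lpow 1 - 1) *: G_tail k.
Proof.
move=> k0; apply: fpsP => n; rewrite fcoef_constZ.
by have [] := shear_tail char0 (tail_cylindric char0 n k0 (leqnn k)).
Qed.

(** T is the blow-up of all arcs with ord x = k, which are split according to ord y < k, ord y = k
    and ord y > k. *)
Lemma G_tailE k : (0 < k)%N -> G_tail k = fmono (Lpow (- k%:Z)) (k * (k - 1)) *:
  (\sum_(1 <= m < k) G k m + G k k + G_tail k).
Proof.
move=> k0; apply: fpsP => n; rewrite fcoef_monoZ.
have := chi_tail_blow char0 0 n k0; rewrite addn0 => e.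
rewrite -[LHS]/(chi (tail k k n)) e; case: leqP => // _; congr (_ *: _).
rewrite (chi_tail_sum char0 0 _ k k0) add0n !fcoefD fcoef_sum -/(G_tail k); congr (_ + _).
by rewrite -(big_nat_recr k 1 (fun m => G k m (n - k * (k - 1))%N)) // big_add1 /= big_mkord.
Qed.

(** For k = 1 the Milnor number vanishes, so this is the cylinder x_1 != 0 over the 1-jets; it
    starts the geometric sequence of [chi_tail1]. *)
Lemma chi_x1 : chi (tail 1 0 0 : set (plane_arc F)) = Mcls ((L - 1) * L * Lz F (- 2%:Z)).
Proof.
pose B : set 'rV[F]_(1 + 1) := prod_space 1 [set v : 'rV[F]_1 | v ord0 ord0 != 0].
have pid m := @polymap_id F m.
have d0 : definable [set v : 'rV[F]_1 | v ord0 ord0 != 0].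
  by apply: (definable_ne (f := fun v : 'rV[F]_1 => v ord0 ord0)); exact: pid.
have d2 : definable B by exact: definable_prod_space.
have d1 : definable (prod_punctured [set: 'rV[F]_0]) by apply/definable_prod_punctured/definableT.
have e0 : constr_class [set v : 'rV[F]_1 | v ord0 ord0 != 0] = L - 1.
  have <- : constr_class (prod_punctured [set: 'rV[F]_0]) = L - 1.
    by rewrite (cc_prod_punctured (@definableT F 0)) cc_point mul1r.
  apply: (@cc_poly_iso _ _ _ _ _ (fun v => row_mx 0 v) (fun w => rsubmx w)) => //.
  - by apply: polymap_row => //; exact: polymap_cst.
  - exact: polymap_rsub.
  - by move=> v hv; split; rewrite ?row_mxKr //; split=> //=; rewrite row_mxKr.
  - move=> w [_ hw]; split=> //; rewrite -[RHS]hsubmxK; congr row_mx.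
    by apply/rowP => -[].
have -> : tail 1 0 0 = cylinder B.
  rewrite tail_smooth // eqxx; apply/seteqP; split=> g;
    rewrite -[cylinder B g]/(is_true (lsubmx (jet 1 g) ord0 ord0 != 0)) /jet row_mxKl mxE.
    by move=> [[]].
  move=> x1; split; first by split=> // -[|//] _; exact: arcx0.
  by move=> [|//] _; exact: arcy0.
by rewrite (chiE d2) /jet_measure (cc_prod_space 1 d0) e0 expr1.
Qed.

Lemma chi_tail1 M : chi (tail 1 M 0 : set (plane_arc F)) =
  Mcls (Lz F (- M%:Z) * ((L - 1) * L * Lz F (- 2%:Z))).
Proof.
elim: M => [|M IH]; first by rewrite chi_x1 oppr0 mul1r.
have := chi_tail_blow char0 M 0 (ltn0Sn 0); rewrite add1n => ->.
rewrite leqnn subn0 IH MclsZ ZLval_Lpow mulrA LzD.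
have -> : - 1%:Z + - M%:Z = - M.+1%:Z by lia.
reflexivity.
Qed.

Lemma G11 : G 1 1 = fconst (Mcls ((Lz F 1 - 1) ^+ 2 * Lz F (- 2%:Z))).
Proof.
rewrite G_diag //; apply: fpsP => n; rewrite fcoef_constZ.
rewrite -[RHS]/(if n == 0%N then _ else 0).
rewrite -[G_tail 1 n]/(chi (tail 1 1 n)); case: eqP => [->|/eqP n0]; last first.
  by rewrite tail_smooth // (negbTE n0) chi0 scaler0.
rewrite chi_tail1 MclsZ.
suff -> : Lz F (- 1%:Z) * ((L - 1) * L * Lz F (- 2%:Z)) = (L - 1) * Lz F (- 2%:Z).
  have e0 : Lz F 1 = L by exact: expr1.
  have eZ : ZLval (Lpow 1 - 1 : ZL F) = L - 1 by rewrite -e0; exact: erefl.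
  rewrite eZ e0 mulrA -expr2; reflexivity.
have eL i : L * Lz F i = Lz F (1 + i) by rewrite LzS addrC.
have e1 : - 1%:Z + (1 + - 2%:Z) = - 2%:Z by lia.
rewrite -mulrA eL mulrCA LzD e1; reflexivity.
Qed.

(** For k >= 2 the remainder is empty in each degree from some point on. For k = 1 only degree 0
    matters, and the remainder there is a constant times L^(-N). *)
Lemma G_tail_sum k : (0 < k)%N -> fps_sum_to (fun i => G k (k + i.+1)%N) (G_tail k).
Proof.
move=> k0 n c.
have rem N : G_tail k n - \sum_(i < N) G k (k + i.+1)%N n = chi (tail k (k + N) n).
  by rewrite -[G_tail k n]/(chi (tail k k n)) (chi_tail_sum char0 k n N k0) addrAC subrr add0r.
case: k k0 rem => [//|[|k]] k0 rem; last first.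
  exists (k.+2 * n.+1)%N => N hN; rewrite rem tail_empty ?chi0 //; first exact: Mfilt0.
  exact: leq_trans hN (leq_addl _ _).
have [n0|n0] := eqVneq n 0%N; last first.
  by exists 0%N => N _; rewrite rem tail_smooth // (negbTE n0) chi0; exact: Mfilt0.
have la : laurent ((L - 1) * L * Lz F (- 2%:Z)).
  apply: laurentM; last exact/asboolP/laurent_Lz.
  by apply: laurentM; [apply: laurentB; [exact: laurentL|exact: laurent1]|exact: laurentL].
have [N hN] := Mcls_geometric c la.
exists N => N' hN'; rewrite rem n0 chi_tail1; apply: hN.
exact: leq_trans hN' (leq_addl _ _).
Qed.

Lemma fmono_split k a : fmono (Lpow (1 - k%:Z)) a = fconst (Lpow 1) * fmono (Lpow (- k%:Z)) a :> fps (ZL F).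
Proof. by rewrite fmonoM LpowD add0n. Qed.

Lemma fconstL1 : fconst (Lpow 1 - 1) = fconst (Lpow 1) - 1 :> fps (ZL F).
Proof. by rewrite fconstD fconstN. Qed.

(** Inserting G_(k,k) = (L - 1) S into the equation for S turns G_(k,k) + S into L S, whence the
    exponent 1 - k. *)
Lemma G_tail_eq k : (0 < k)%N ->
  (1 - fmono (Lpow (1 - k%:Z)) (k * (k - 1))) *: G_tail k =
  fmono (Lpow (- k%:Z)) (k * (k - 1)) *: \sum_(1 <= m < k) G k m.
Proof.
move=> k0; rewrite scalerBl scale1r {1}(G_tailE k0) (G_diag k0) -addrA fconstL1.
rewrite scalerBl scale1r subrK scalerDr scalerA fmono_split.
by rewrite [fmono _ _ * fconst _]mulrC addrK.
Qed.

(** For k >= 2 the exponent k (k - 1) is positive, so 1 - t^(k(k-1)) L^(1-k) is invertible as a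
    series; for k = 1 it would be 0. *)
Lemma G_diag_sum k : (2 <= k)%N -> G k k =
  (fconst (Lpow 1 - 1) * fmono (Lpow (- k%:Z)) (k * (k - 1))
     * fgeom (fmono (Lpow (1 - k%:Z)) (k * (k - 1)))) *: \sum_(1 <= m < k) G k m.
Proof.
move=> k2; have k0 : (0 < k)%N by exact: ltnW.
have a0 : (0 == k * (k - 1))%N = false.
  by apply/negbTE; rewrite eq_sym muln_eq0 negb_or -!lt0n subn_gt0 k0.
rewrite (G_diag k0) -mulrA -scalerA [fmono _ _ * _]mulrC; congr (_ *: _).
by rewrite -scalerA -(G_tail_eq k0) scalerA fgeomE ?scale1r // fmonoE a0.
Qed.
End Identities.

Local Close Scope classical_set_scope.

(** * Rationality in L and t *)

Section Rational.
Variable F : closedFieldType.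
Hypothesis char0 : forall n, n.+1%:R != 0 :> F.
Notation G k m := (G_mu F k m).

Definition evL (p : {poly int}) : ZL F := \sum_(i < size p) Lpow i *~ p`_i.

Lemma evL_widen (p : {poly int}) n : (size p <= n)%N -> evL p = \sum_(i < n) Lpow i *~ p`_i.
Proof.
move=> pn; rewrite /evL (big_ord_widen n (fun i => Lpow i *~ p`_i)) // big_mkcond.
by apply: eq_bigr => i _; case: ltnP => // h; rewrite nth_default.
Qed.
Lemma evLD p q : evL (p + q) = evL p + evL q.
Proof.
have pn := size_polyD p q; set n := maxn _ _ in pn.
rewrite (evL_widen pn) (@evL_widen p n) ?leq_maxl // (@evL_widen q n) ?leq_maxr //.
by rewrite -big_split; apply: eq_bigr => i _; rewrite coefD mulrzDr.
Qed.
Lemma evL0 : evL 0 = 0.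
Proof. by rewrite /evL size_poly0 big_ord0. Qed.
Lemma evLN p : evL (- p) = - evL p.
Proof. by apply: (addrI (evL p)); rewrite -evLD !subrr evL0. Qed.
Lemma evLC (c : int) : evL c%:P = c%:~R.
Proof. by rewrite (evL_widen (size_polyC_leq1 c)) big_ord1 coefC eqxx Lpow0. Qed.
Lemma evLMX p : evL (p * 'X) = Lpow 1 * evL p.
Proof.
rewrite (@evL_widen _ (size p).+1) ?size_polyMleq ?size_polyX; last first.
  by rewrite (leq_trans (size_polyMleq _ _)) // size_polyX addn2.
rewrite big_ord_recl coefMX mulr0z add0r /evL mulr_sumr; apply: eq_bigr => i _.
by rewrite coefMX /= mulrzAr LpowD -PoszD add1n.
Qed.
Lemma evLM p q : evL (p * q) = evL p * evL q.
Proof.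
elim/poly_ind: p => [|p c IH]; first by rewrite mul0r evL0 mul0r.
have evLCM r : evL (c%:P * r) = c%:~R * evL r.
  rewrite (@evL_widen _ (size r)); last by rewrite mul_polyC size_scale_leq.
  rewrite /evL mulr_sumr; apply: eq_bigr => i _.
  by rewrite coefCM mulrzl -mulrzA mulrC.
rewrite mulrDl evLD evLCM mulrAC evLMX IH evLD evLMX evLC mulrDl mulrA.
reflexivity.
Qed.
Lemma evLX : evL 'X = Lpow 1.
Proof. by rewrite -['X]mul1r evLMX (evLC 1) mulr1. Qed.
Lemma evLXn k : evL ('X ^+ k) = Lpow k.
Proof.
elim: k => [|k IH]; first by rewrite (evLC 1) Lpow0.
by rewrite exprSr evLMX IH LpowD -PoszD add1n.
Qed.

Lemma fpsLE (p : {poly {poly int}}) n : fpsL F p n = evL p`_n.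
Proof. by []. Qed.
Lemma fpsLD p q : fpsL F (p + q) = fpsL F p + fpsL F q.
Proof. by apply: fpsP => n; rewrite fcoefD !fpsLE coefD evLD. Qed.
Lemma fpsLN p : fpsL F (- p) = - fpsL F p.
Proof. by apply: fpsP => n; rewrite fcoefN !fpsLE coefN evLN. Qed.
Lemma fpsLM p q : fpsL F (p * q) = fpsL F p * fpsL F q.
Proof.
have evL_sum I r (f : I -> {poly int}) : evL (\sum_(i <- r) f i) = \sum_(i <- r) evL (f i).
  by elim: r => [|i r IH]; rewrite ?big_nil ?evL0 // !big_cons evLD IH.
apply: fpsP => n; rewrite fcoefM fpsLE coefM evL_sum.
by apply: eq_bigr => i _; rewrite evLM.
Qed.
Lemma fpsL_mono p a : fpsL F (p%:P * 'X^a) = fmono (evL p) a.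
Proof.
apply: fpsP => n; rewrite fpsLE coefCM coefXn fmonoE.
by case: eqP => _; rewrite ?mulr1 ?mulr0 ?evL0.
Qed.
Lemma fpsLC p : fpsL F p%:P = fconst (evL p).
Proof. by have := fpsL_mono p 0; rewrite expr0 mulr1. Qed.

Lemma Lpow_bij k (V : lmodType (ZL F)) : bijective (fun x : V => Lpow k *: x).
Proof.
by exists (fun x => Lpow (- k) *: x) => x; rewrite scalerA LpowD ?addNr ?subrr Lpow0 scale1r.
Qed.

Notation rat f := (@rational_in_L_t F f).

(** Rationality passes along a linear relation Q f = P g. Only the action of Z[L, L^-1] on the
    completion is involved, so denominators are multiplied instead of inverted. *)
Lemma rat_rel (Q P : {poly {poly int}}) (f g : fps (Mhat F)) :
  bijective (fun x : Mhat F => fpsL F Q 0%N *: x) ->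
  fpsL F Q *: f = fpsL F P *: g -> rat g -> rat f.
Proof.
move=> bQ e [P' [Q' [bQ' e']]]; exists (P * P'), (Q' * Q); split.
  apply: (eq_bij (bij_comp bQ' bQ)) => x.
  by rewrite fpsLM fcoefM0; exact: scalerA.
by rewrite !fpsLM -!scalerA e -e' !scalerA [fpsL F Q' * _]mulrC.
Qed.

Lemma rat0 : rat 0.
Proof.
exists 0, 1; have e1 : fpsL F 1 = 1 by rewrite (fpsLC 1) (evLC 1).
have e0 : fpsL F 0 = 0 by apply: (addrI (fpsL F 0)); rewrite -fpsLD !addr0.
rewrite e1 e0; split; last by rewrite scaler0 scale0r.
by exists id => x; rewrite scale1r.
Qed.

Lemma ratD f g : rat f -> rat g -> rat (f + g).
Proof.
move=> [P [Q [bQ e]]] [P' [Q' [bQ' e']]]; exists (P * Q' + P' * Q), (Q * Q'); split.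
  apply: (eq_bij (bij_comp bQ bQ')) => x.
  by rewrite fpsLM fcoefM0; exact: scalerA.
rewrite fpsLD !fpsLM scalerDr scalerDl; congr (_ + _).
  rewrite [fpsL F P * _]mulrC -!scalerA -e !scalerA mulrC; reflexivity.
rewrite [fpsL F P' * _]mulrC -!scalerA -e'; reflexivity.
Qed.

Lemma rat_sum (r : seq nat) (f : nat -> fps (Mhat F)) :
  (forall m, m \in r -> rat (f m)) -> rat (\sum_(m <- r) f m).
Proof.
elim: r => [|m r IH] h; first by rewrite big_nil; exact: rat0.
rewrite big_cons; apply: ratD; first by apply: h; rewrite mem_head.
by apply: IH => i ir; apply: h; rewrite inE ir orbT.
Qed.

Lemma G11_rational : rat (G 1 1).
Proof.
(* Numerator and denominator are polynomials in L, so L^(-2) is moved into the denominator as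
   L^2. *)
exists ((('X - 1) ^+ 2)%:P), (('X^2)%:P); rewrite !fpsLC evLXn; split; first exact: Lpow_bij.
have fconstZ (c : ZL F) (x : Mhat F) : fconst c *: fconst x = fconst (c *: x).
  apply: fpsP => n; rewrite fcoef_constZ.
  by rewrite -[RHS]/(if n == 0%N then c *: x else 0); case: eqP => [->|/eqP/negbTE n0] //=;
    rewrite n0 scaler0.
have e1 : evL (('X - 1) ^+ 2) = (Lpow 1 - 1) * (Lpow 1 - 1).
  by rewrite expr2 evLM evLD evLN evLX (evLC 1).
have e2 : ZLval ((Lpow 1 - 1) * (Lpow 1 - 1) : ZL F) = (Lz F 1 - 1) ^+ 2 by exact: erefl.
have e3 (x : KL F) : Lz F 2 * (x * Lz F (- 2%:Z)) = x.
  rewrite mulrCA LzD -[RHS]mulr1; reflexivity.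
rewrite (G11 char0) (fconstZ (Lpow 2)) (fconstZ (evL _)) e1; apply: (congr1 (@fconst _)).
apply: (etrans (MclsZ (Lpow 2) _)); apply: (etrans (congr1 (@Mcls F) (e3 _))).
by apply: esym; apply: (etrans (MclsZ _ _)); apply: (congr1 (@Mcls F)); rewrite mulr1.
Qed.

(** Blow-up above the diagonal, the summation formula on it and the swap below it all lead to
    smaller k + m; only (1, 1) is computed directly. *)
Lemma G_rational k m : (0 < k)%N -> (0 < m)%N -> rat (G k m).
Proof.
have [n] := ubnP (k + m)%N; elim: n k m => // n IH.
have above k m : (0 < k)%N -> (k < m)%N -> (k + m < n.+1)%N -> rat (G k m).
  move=> k0 km kmn; have h : rat (G k (m - k)) by apply: IH => //; lia.
  pose a := (k * (k - 1))%N.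
  apply: (@rat_rel ('X^k)%:P (1%:P * 'X^a) _ _ _ _ h).
    by rewrite fpsLC evLXn; exact: Lpow_bij.
  rewrite fpsLC evLXn fpsL_mono (evLC 1) (G_blow char0 k0 km) scalerA fmonoM LpowD subrr Lpow0.
  by [].
have diag k : (0 < k)%N -> (k + k < n.+1)%N -> rat (G k k).
  move=> k0 kn; pose a := (k * (k - 1))%N.
  have [k1|k1] := leqP k 1.
    have -> : k = 1%N by apply/eqP; rewrite eqn_leq k1.
    exact: G11_rational.
  (* The relation for S multiplied by L^k to clear negative powers. Since a > 0, Q(0) = L^k, which
     acts bijectively. *)
  pose Q := ('X^k)%:P - 'X%:P * 'X^a : {poly {poly int}}.
  pose P := ('X - 1)%:P * 'X^a : {poly {poly int}}.
  have a0 : (0 == a)%N = false.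
    by apply/negbTE; rewrite eq_sym muln_eq0 negb_or -!lt0n subn_gt0 k0.
  have QE : fpsL F Q = fconst (Lpow k) * (1 - fmono (Lpow (1 - k%:Z)) a).
    rewrite fpsLD fpsLN fpsLC fpsL_mono evLXn evLX mulrBr mulr1 fmonoM LpowD add0n.
    by have -> : k%:Z + (1 - k%:Z) = 1 by lia.
  have PE : fpsL F P = fconst (Lpow 1 - 1) * (fconst (Lpow k) * fmono (Lpow (- k%:Z)) a).
    rewrite fpsL_mono !fmonoM LpowD subrr Lpow0 mulr1 !add0n evLD evLN evLX (evLC 1).
    reflexivity.
  have sum_rat : rat (\sum_(1 <= m < k) G k m).
    apply: rat_sum => m; rewrite mem_index_iota => /andP[m0 mk].
    by rewrite (G_swap char0) //; apply: above => //; lia.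
  apply: (@rat_rel Q P _ _ _ _ sum_rat).
    have -> : fpsL F Q 0%N = Lpow k; last exact: Lpow_bij.
    by rewrite QE fcoef_constM fcoefB fcoef1 fmonoE a0 subr0 mulr1.
  rewrite QE PE (G_diag char0 k0) scalerA mulrC -!scalerA (G_tail_eq char0 k0).
  reflexivity.
move=> k m kn k0 m0; case: (ltngtP k m) => [km|mk|km].
- exact: above.
- by rewrite (G_swap char0) //; apply: above => //; rewrite addnC.
- by subst m; apply: diag.
Qed.
End Rational.

Theorem mainTheorem3 (R : realType) :
  let C : closedFieldType := R[i] in
  [/\ (* the mu_level sets are cylindric, so the integrals are defined *)
      (forall k m n : nat, (0 < k)%N -> (0 < m)%N -> cylindric (mu_level C k m n)),
      (forall k m : nat, (0 < k)%N -> (0 < m)%N -> rational_in_L_t (G_mu C k m)),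
      G_mu C 1 1 = fconst (Mcls ((Lz C 1 - 1) ^+ 2 * Lz C (- 2%:Z))),
      (forall k m : nat, (0 < k)%N -> (0 < m)%N -> G_mu C k m = G_mu C m k) &
  [/\ (forall k m : nat, (0 < k)%N -> (k < m)%N ->
        G_mu C k m = fmono (Lpow (- k%:Z)) (k * (k - 1)) *: G_mu C k (m - k)%N),
      (forall k : nat, (0 < k)%N ->
        exists2 S : fps (Mhat C),
          fps_sum_to (fun i => G_mu C k (k + i.+1)%N) S &
          G_mu C k k = fconst (Lpow 1 - 1) *: S) &
      (forall k : nat, (2 <= k)%N ->
        G_mu C k k =
        (fconst (Lpow 1 - 1) * fmono (Lpow (- k%:Z)) (k * (k - 1))
           * fgeom (fmono (Lpow (1 - k%:Z)) (k * (k - 1))))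
        *: \sum_(1 <= m < k) G_mu C k m)]].
Proof.
move=> C; have char0 n : n.+1%:R != 0 :> C by rewrite pnatr_eq0.
split; last split.
- by move=> k m n k0 m0; exact: (mu_level_cylindric char0).
- by move=> k m k0 m0; exact: (G_rational char0).
- exact: (G11 char0).
- by move=> k m k0 m0; exact: (G_swap char0).
- by move=> k m k0 km; exact: (G_blow char0).
- by move=> k k0; exists (G_tail C k); [exact: (G_tail_sum char0)|exact: (G_diag char0)].
- by move=> k k2; exact: (G_diag_sum char0).
Qed.
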